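(* Let $Q=Q(b_1,b_2,b_3,b_4)$ be a Pitot quadrilateral. Then there exists a minimal graph $\Sigma$ defined over the quadrilateral $Q$ given in the Enneper–Weierstrass form by $$\Sigma=\{(\Re f(z),\Im f(z),T(z)):z\in\mathbb{D}\},\qquad T(z)=2\,\Im\int_0^z \mathbf{p}(\zeta)\,\mathbf{q}(\zeta)\,d\zeta,$$ whose unit normal at the point $(f(z),T(z))$ is $\mathbf{q}(z)$. The Weierstrass data $(\mathbf{p},\mathbf{q})$ can be chosen so that $\mathbf{q}$ is a Möbius automorphism of the unit disk and, for the harmonic diffeomorphism $f=h+\overline{g}$ of $\mathbb{D}$ onto $Q$ described in the context, $\mathbf{q}=\sqrt{g'/h'}$ and $\mathbf{p}=h'$. In particular, the Gauss map is a univalent diffeomorphism of the surface $\Sigma$ onto the open upper hemisphere of $\mathbb{S}^2$. The surface $\Sigma^\diamond=\{(u,v,\mathbf{f}^\diamond(u,v)):(u,v)\in Q\}$, where $\mathbf{f}^\diamond=T(f^{-1})$, has the following Scherk-type asymptotics: if $(u,v)\to\zeta\in(b_1,b_2)\cup(b_3,b_4)$, then $\mathbf{f}^\diamond(u,v)\to+\infty$; if $(u,v)\to\zeta\in(b_4,b_1)\cup(b_2,b_3)$, then $\mathbf{f}^\diamond(u,v)\to-\infty$.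
   Context: $\mathbb{D}=\{z\in\mathbb{C}:|z|<1\}$, and $\mathbb{R}^2$ is identified with $\mathbb{C}$. A quadrilateral $Q=Q(b_1,b_2,b_3,b_4)$ has its vertices ordered counterclockwise; as a domain, $Q$ denotes the region bounded by its sides. It is a Pitot quadrilateral (convex or concave) if $|b_1-b_2|+|b_3-b_4|=|b_2-b_3|+|b_4-b_1|$. $(b_i,b_j)$ denotes the open side joining $b_i$ and $b_j$. A minimal graph over $Q$ is a minimal surface in $\mathbb{R}^3$ that is the graph of a real function on $Q$. Unit normals lying in the open upper hemisphere of $\mathbb{S}^2$ are identified with points of $\mathbb{D}$ by stereographic projection; this is the sense in which the unit normal ''is $\mathbf{q}(z)$''. The harmonic diffeomorphism $f$: for a suitable $p=p(b_1,b_2,b_3,b_4)\in(0,\pi)$, let $F:[0,2\pi)\to\mathbb{C}$ be the step function equal to $b_4$ on $[0,p)$, $b_1$ on $[p,\pi)$, $b_2$ on $[\pi,\pi+p)$, $b_3$ on $[\pi+p,2\pi)$, and let $$f(z)=\frac1{2\pi}\int_0^{2\pi}\frac{1-|z|^2}{|e^{i\theta}-z|^2}F(\theta)\,d\theta=h(z)+\overline{g(z)},$$ with $h,g$ analytic in $\mathbb{D}$, $g(0)=0$. The parameter $p$ is chosen so that $f$ is a sense-preserving harmonic diffeomorphism of $\mathbb{D}$ onto $Q$ whose dilatation $g'/h'$ is the square of a Möbius automorphism of $\mathbb{D}$ (such a $p$ exists for every Pitot quadrilateral).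
   Formalization: With T = 2 Im of the integral of pq, the upward unit normal has stereographic coordinate -i times the conjugate of q(z), not q(z); so ''the unit normal is q(z)'' is formalized through stereographic projection followed by the fixed isometry w -> -i conj(w) of the disk. *)

(* Defs.v *)
From Stdlib Require Export Reals.
From Coquelicot Require Export Coquelicot.

Open Scope R_scope.

(** ** Quadrilaterals in the plane [R^2 = C] *)

Definition closed_segment (a b z : C) : Prop :=
  exists t : R, 0 <= t <= 1 /\ z = ((1 - t)%R * a + t * b)%C.

Definition open_side (a b z : C) : Prop :=
  exists t : R, 0 < t < 1 /\ z = ((1 - t)%R * a + t * b)%C.

Definition collinear (a b c : C) : Prop := Im (Cconj (b - a) * (c - a)) = 0.

(* Shoelace formula. *)
Definition signed_area (b1 b2 b3 b4 : C) : R :=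
  (Im (Cconj b1 * b2) + Im (Cconj b2 * b3) +
   Im (Cconj b3 * b4) + Im (Cconj b4 * b1)) / 2.

(* A simple four-sided polygon, convex or concave, with counterclockwise
   vertices.  Since no three vertices are collinear, adjacent sides meet only
   at their common vertex, so simplicity only concerns opposite sides. *)
Definition quadrilateral (b1 b2 b3 b4 : C) : Prop :=
  ~ collinear b1 b2 b3 /\ ~ collinear b2 b3 b4 /\
  ~ collinear b3 b4 b1 /\ ~ collinear b4 b1 b2 /\
  (forall z, ~ (closed_segment b1 b2 z /\ closed_segment b3 b4 z)) /\
  (forall z, ~ (closed_segment b2 b3 z /\ closed_segment b4 b1 z)) /\
  0 < signed_area b1 b2 b3 b4.

Definition pitot_quadrilateral (b1 b2 b3 b4 : C) : Prop :=
  quadrilateral b1 b2 b3 b4 /\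
  Cmod (b1 - b2) + Cmod (b3 - b4) = Cmod (b2 - b3) + Cmod (b4 - b1).

Definition on_sides (b1 b2 b3 b4 z : C) : Prop :=
  closed_segment b1 b2 z \/ closed_segment b2 b3 z \/
  closed_segment b3 b4 z \/ closed_segment b4 b1 z.

(* The region bounded by the sides: the points off the sides whose path
   component in the complement of the sides is bounded. *)
Definition region (b1 b2 b3 b4 w : C) : Prop :=
  ~ on_sides b1 b2 b3 b4 w /\
  exists M : R, forall gamma : R -> C,
    (forall t, continuous gamma t) -> gamma 0 = w ->
    (forall t, 0 <= t <= 1 -> ~ on_sides b1 b2 b3 b4 (gamma t)) ->
    Cmod (gamma 1) <= M.

(** ** Smooth maps and diffeomorphisms between subsets of normed spaces *)

(* Meant for finite-dimensional [V], where it suffices to require that the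
   differential evaluated at each fixed vector is of class [C^k]. *)
Fixpoint class_Ck {V W : NormedModule R_AbsRing} (k : nat)
    (U : V -> Prop) (F : V -> W) : Prop :=
  match k with
  | O => forall x, U x -> continuous F x
  | S k' => exists L : V -> V -> W,
      (forall x, U x -> filterdiff F (locally x) (L x)) /\
      (forall v, class_Ck k' U (fun x => L x v))
  end.

(* Smoothness on an arbitrary subset: local smooth extendability to open sets
   of the ambient space.  It applies to plane domains and to surfaces alike. *)
Definition smooth_on {V W : NormedModule R_AbsRing}
    (A : V -> Prop) (F : V -> W) : Prop :=
  forall x, A x -> exists (O : V -> Prop) (G : V -> W),
    open O /\ O x /\ (forall k, class_Ck k O G) /\
    (forall y, A y -> O y -> G y = F y).

Definition diffeomorphism {V W : NormedModule R_AbsRing}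
    (A : V -> Prop) (B : W -> Prop) (F : V -> W) (Finv : W -> V) : Prop :=
  (forall x, A x -> B (F x) /\ Finv (F x) = x) /\
  (forall y, B y -> A (Finv y) /\ F (Finv y) = y) /\
  smooth_on A F /\ smooth_on B Finv.

(** ** Real partial derivatives, harmonic maps *)

Definition D1 (u : C -> R) (w : C) : R := Derive (fun t => u (t, Im w)) (Re w).
Definition D2 (u : C -> R) (w : C) : R := Derive (fun t => u (Re w, t)) (Im w).

Definition laplacian (u : C -> R) (w : C) : R := D1 (D1 u) w + D2 (D2 u) w.

Definition harmonic_on (A : C -> Prop) (f : C -> C) : Prop :=
  @smooth_on C_R_NormedModule C_R_NormedModule A f /\
  forall z, A z -> laplacian (fun w => Re (f w)) z = 0 /\
                   laplacian (fun w => Im (f w)) z = 0.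

Definition jacobian (f : C -> C) (z : C) : R :=
  D1 (fun w => Re (f w)) z * D2 (fun w => Im (f w)) z -
  D2 (fun w => Re (f w)) z * D1 (fun w => Im (f w)) z.

Definition sense_preserving_on (A : C -> Prop) (f : C -> C) : Prop :=
  forall z, A z -> 0 < jacobian f z.

(** ** Complex analysis in the unit disk *)

Definition disk (z : C) : Prop := Cmod z < 1.

Definition analytic_on (A : C -> Prop) (h : C -> C) : Prop :=
  forall z, A z -> @ex_derive C_AbsRing C_NormedModule h z.

Definition mobius_disk_automorphism (q : C -> C) : Prop :=
  (exists a b c d : C, (a * d - b * c)%C <> RtoC 0 /\
     forall z, disk z -> (c * z + d)%C <> RtoC 0 /\
                         q z = ((a * z + b) / (c * z + d))%C) /\
  (forall z, disk z -> disk (q z)) /\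
  (forall w, disk w -> exists! z, disk z /\ q z = w).

(* The integral of [k] along the segment from [0] to [z]; for [k] analytic in
   the disk it is the integral along any path from [0] to [z]. *)
Definition integral_from_0 (k : C -> C) (z : C) : C :=
  @RInt C_R_CompleteNormedModule (fun t : R => (k (t * z) * z)%C) 0 1.

Definition boundary_step (b1 b2 b3 b4 : C) (p theta : R) : C :=
  if Rlt_dec theta p then b4
  else if Rlt_dec theta PI then b1
  else if Rlt_dec theta (PI + p) then b2
  else b3.

Definition poisson_kernel (z : C) (theta : R) : R :=
  (1 - Cmod z ^ 2) / Cmod ((cos theta, sin theta) - z) ^ 2.

Definition poisson_extension (F : R -> C) (z : C) : C :=
  (RtoC (1 / (2 * PI)) *
   @RInt C_R_CompleteNormedModule
     (fun theta => (RtoC (poisson_kernel z theta) * F theta)%C)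
     0 (2 * PI))%C.

(** ** Surfaces in space *)

Definition R3 : Type := (R * R * R)%type.

Definition R3_NormedModule : NormedModule R_AbsRing :=
  prod_NormedModule R_AbsRing
    (prod_NormedModule R_AbsRing R_NormedModule R_NormedModule) R_NormedModule.

Definition cx (P : R3) : R := fst (fst P).
Definition cy (P : R3) : R := snd (fst P).
Definition cz (P : R3) : R := snd P.

Definition dot3 (P S : R3) : R := cx P * cx S + cy P * cy S + cz P * cz S.
Definition norm3 (P : R3) : R := sqrt (dot3 P P).
Definition scal3 (c : R) (P : R3) : R3 := (c * cx P, c * cy P, c * cz P).
Definition cross3 (P S : R3) : R3 :=
  (cy P * cz S - cz P * cy S,
   cz P * cx S - cx P * cz S,
   cx P * cy S - cy P * cx S).

Definition partial_u (X : C -> R3) (w : C) : R3 :=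
  (D1 (fun v => cx (X v)) w, D1 (fun v => cy (X v)) w, D1 (fun v => cz (X v)) w).
Definition partial_v (X : C -> R3) (w : C) : R3 :=
  (D2 (fun v => cx (X v)) w, D2 (fun v => cy (X v)) w, D2 (fun v => cz (X v)) w).

(* For a graph [(u, v, phi (u, v))] this is the upward unit normal. *)
Definition unit_normal (X : C -> R3) (w : C) : R3 :=
  let n := cross3 (partial_u X w) (partial_v X w) in scal3 (/ norm3 n) n.

(* [(e G - 2 f F + g E) / (2 (E G - F^2))] with [E, F, G] and [e, f, g] the
   coefficients of the first and second fundamental forms. *)
Definition mean_curvature (X : C -> R3) (w : C) : R :=
  let Xu := partial_u X in
  let Xv := partial_v X in
  let N := unit_normal X w in
  let E := dot3 (Xu w) (Xu w) in
  let F := dot3 (Xu w) (Xv w) in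
  let G := dot3 (Xv w) (Xv w) in
  let e := dot3 (partial_u Xu w) N in
  let f := dot3 (partial_v Xu w) N in
  let g := dot3 (partial_v Xv w) N in
  (e * G - 2 * f * F + g * E) / (2 * (E * G - F ^ 2)).

Definition graph_param (phi : C -> R) (w : C) : R3 := (Re w, Im w, phi w).

Definition minimal_graph (Q : C -> Prop) (phi : C -> R) (Sigma : R3 -> Prop) :
    Prop :=
  @smooth_on C_R_NormedModule R_NormedModule Q phi /\
  (forall P, Sigma P <-> exists w, Q w /\ P = graph_param phi w) /\
  (forall w, Q w -> mean_curvature (graph_param phi) w = 0).

(* The Gauss map of the graph of [phi], as a function of the point of the
   graph. *)
Definition gauss_map (phi : C -> R) (P : R3) : R3 :=
  unit_normal (graph_param phi) (cx P, cy P).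

Definition upper_hemisphere (P : R3) : Prop := dot3 P P = 1 /\ 0 < cz P.

(* Inverse of the stereographic projection from the south pole; it maps the
   unit disk onto the open upper hemisphere. *)
Definition inv_stereographic (w : C) : R3 :=
  scal3 (/ (1 + Cmod w ^ 2)) (2 * Re w, 2 * Im w, 1 - Cmod w ^ 2).

(* The point of the upper hemisphere represented by [q], namely
   [- (2 Im q, 2 Re q, |q|^2 - 1) / (1 + |q|^2)].  With the normalisation
   [h' = p], [g' = p q^2], [T = 2 Im (int p q)] the stereographic coordinate
   of the upward normal is [- i * conj q]: the plane of the stereographic
   projection is read through the fixed isometry [w |-> - i * conj w]. *)
Definition hemisphere_point (q : C) : R3 :=
  inv_stereographic (- (Ci * Cconj q))%C.

(* Main.v *)
Require Import Defs.
From Stdlib Require Import Reals.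
From Coquelicot Require Import Coquelicot.
From Stdlib Require Import Lra Psatz ClassicalEpsilon FunctionalExtensionality.

(* The derivative [h'] of the analytic part of the Poisson extension of the step function is a rational
   function with simple poles at the four jumps [1, e, -1, -e], [e = exp (i p)], whose residues are
   multiples of the sides of [Q], regarded as complex numbers.  Its numerator is a quadratic polynomial,
   and its discriminant vanishes for a suitable [p]: solving for [cos p] gives the real part of a complex
   number that is unimodular exactly by the Pitot condition.  So [h' ~ (mu + nu z)^2], and reflection in the
   circle gives [g' ~ (conj mu z + conj nu)^2], whence the dilatation is the square of the Moebius map
   [q ~ (conj mu z + conj nu) / (mu + nu z)]; positivity of the area of [Q] gives [|nu| < |mu|].

   For univalence, one diagonal of [Q] separates the other two vertices.  Let [u] be the coordinate
   transversal to it.  The boundary values of [u] are unimodal along the circle, so in strip coordinates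
   on the disk [u] increases along horizontal lines, and its level sets are graphs over the vertical axis.
   Since the Jacobian is positive, the other coordinate increases along each level curve.  The values of
   [f] near the circle are close to the sides of [Q], so each level curve is mapped onto the whole chord
   of [Q].  The same properness gives the continuity of the inverse and the asymptotics: the
   height is a combination of [ln |1 - z / zeta|] over the four jumps with weights of alternating sign,
   and near an open side of [Q] the preimage tends to the corresponding jump. *)

(** That the dilatation be a perfect square is one complex equation for the single real unknown [p];
    the Pitot condition supplies the missing real equation. Since [Q] may be concave, convexity
    arguments of Rado-Kneser-Choquet type do not give univalence. It has to come from the sign of
    the Jacobian, that is from [|q| < 1], together with the behaviour at the boundary. There [f]
    collapses each open arc to a vertex and spreads each jump over a whole side, so there is no
    continuous boundary map and cluster sets take its place. The same collapse produces the
    asymptotics: over an open side of [Q] lies just one point of the circle, and that point is a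
    pole of the height. The region is defined by path components; a similarity turns it into the set
    between two graphs over one axis, where the intermediate value theorem replaces the Jordan curve
    theorem. The sign of the root [q] is not determined by its square; it is fixed by the sides on
    which the height has to tend to plus infinity. *)

Set Bullet Behavior "Strict Subproofs".

(** * Wirtinger derivatives *)

Local Open Scope C_scope.

(* [ring] does not see through Coquelicot's module structures on [C]. *)
Ltac cring := match goal with |- @eq _ ?x ?y => change (@eq C x y) end; ring.

(** Every real-linear map of the plane is [a v + b conj v] for a unique pair, so [a] and [b] are the
    Wirtinger derivatives. One predicate thus serves holomorphic maps ([b = 0]), harmonic maps,
    their inverses, and real functions read as complex ones. *)
Definition wirt (f : C -> C) (z a b : C) : Prop :=
  @filterdiff R_AbsRing C_R_NormedModule C_R_NormedModule f (@locally C_UniformSpace z)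
    (fun v : C => a * v + b * Cconj v).

Lemma C_R_norm (y : C) : @norm R_AbsRing C_R_NormedModule y = Cmod y.
Proof.
  destruct y as [y1 y2]. unfold norm; cbn. unfold prod_norm, Cmod; cbn.
  f_equal. unfold norm; cbn. unfold abs; cbn.
  rewrite !Rmult_1_r, <- !Rabs_mult, !Rabs_pos_eq by nra. reflexivity.
Qed.

Lemma wirt_is_linear (a b : C) :
  @is_linear R_AbsRing C_R_NormedModule C_R_NormedModule (fun v : C => a * v + b * Cconj v).
Proof.
  destruct a as [a1 a2], b as [b1 b2]. split.
  - intros [x1 x2] [y1 y2]. apply injective_projections; cbn; ring.
  - intros k [x1 x2]. apply injective_projections; cbn; ring.
  - exists (Cmod (a1, a2) + Cmod (b1, b2) + 1)%R. split.
    + assert (H1 := Cmod_ge_0 (a1, a2)). assert (H2 := Cmod_ge_0 (b1, b2)). lra.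
    + intros x.
      rewrite !C_R_norm.
      eapply Rle_trans. apply Cmod_triangle. rewrite !Cmod_mult, Cmod_conj.
      assert (H1 := Cmod_ge_0 x). nra.
Qed.

(** The balls of the uniform structure are squares; the factor [sqrt 2] passes between them and
    Euclidean disks. *)
Lemma locally_Cmod (z : C) (P : C -> Prop) :
  @locally C_UniformSpace z P <-> exists d : R, 0 < d /\ forall w, Cmod (w - z) < d -> P w.
Proof.
  split.
  - intros [d Hd]. exists d. split. apply cond_pos.
    intros w Hw. apply Hd. apply C_NormedModule_mixin_compat1. exact Hw.
  - intros [d [Hd H]].
    assert (Hs : 0 < d / sqrt 2). { apply Rdiv_lt_0_compat. lra. apply sqrt_lt_R0. lra. }
    exists (mkposreal _ Hs). intros w Hw. apply H.
    replace d with (sqrt 2 * (d / sqrt 2))%R.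
    apply (C_NormedModule_mixin_compat2 z w (mkposreal _ Hs)). exact Hw.
    field. apply Rgt_not_eq. apply sqrt_lt_R0. lra.
Qed.

Lemma wirt_eps (f : C -> C) (z a b : C) :
  wirt f z a b <->
  forall eps : R, 0 < eps -> exists d : R, 0 < d /\ forall w, Cmod (w - z) < d ->
    Cmod (f w - f z - (a * (w - z) + b * Cconj (w - z))) <= eps * Cmod (w - z).
Proof.
  split.
  - intros [_ H] eps Heps.
    specialize (H z (fun P HP => HP) (mkposreal _ Heps)).
    apply locally_Cmod in H. destruct H as [d [Hd H]]. exists d. split. exact Hd.
    intros w Hw. specialize (H w Hw). rewrite !C_R_norm in H. exact H.
  - intros H. split. apply wirt_is_linear.
    intros x Hx eps.
    assert (Hxz : x = z).
    { symmetry. apply (is_filter_lim_locally_unique (V := C_R_NormedModule) z x Hx). }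
    subst x. destruct (H eps (cond_pos eps)) as [d [Hd H']].
    apply locally_Cmod. exists d. split. exact Hd. intros w Hw.
    rewrite !C_R_norm. apply (H' w Hw).
Qed.

Lemma wirt_ext_loc (f g : C -> C) (z a b : C) :
  @locally C_UniformSpace z (fun w => f w = g w) -> wirt f z a b -> wirt g z a b.
Proof. intros H. apply (filterdiff_ext_locally (U := C_R_NormedModule)). exact H. Qed.

Lemma wirt_eq (f : C -> C) (z a b a' b' : C) :
  wirt f z a b -> a = a' -> b = b' -> wirt f z a' b'.
Proof. intros H -> ->. exact H. Qed.

Lemma wirt_lin (a b c z : C) : wirt (fun w => a * w + b * Cconj w + c) z a b.
Proof.
  apply wirt_eps. intros eps Heps. exists 1%R. split. lra. intros w _.
  replace (_ - _)%C with (RtoC 0).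
  - rewrite Cmod_0. apply Rmult_le_pos. lra. apply Cmod_ge_0.
  - rewrite Cminus_conj. ring.
Qed.

Lemma wirt_const (c z : C) : wirt (fun _ => c) z 0 0.
Proof.
  apply (wirt_ext_loc (fun w => 0 * w + 0 * Cconj w + c)). 2: apply wirt_lin.
  apply filter_forall. intros w. ring.
Qed.

Lemma wirt_id (z : C) : wirt (fun w => w) z 1 0.
Proof.
  apply (wirt_ext_loc (fun w => 1 * w + 0 * Cconj w + 0)). 2: apply wirt_lin.
  apply filter_forall. intros w. ring.
Qed.

Lemma wirt_comp (f g : C -> C) (z a b c d : C) :
  wirt f z a b -> wirt g (f z) c d ->
  wirt (fun w => g (f w)) z (c * a + d * Cconj b) (c * b + d * Cconj a).
Proof.
  intros Hf Hg.
  refine (filterdiff_ext_lin _ _ _ (filterdiff_comp' (U := C_R_NormedModule) (V := C_R_NormedModule) (W := C_R_NormedModule) _ _ z _ _ Hf Hg) _).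
  intros y. cbv beta. rewrite Cplus_conj, !Cmult_conj, Cconj_conj. cring.
Qed.

Lemma wirt_conj (f : C -> C) (z a b : C) :
  wirt f z a b -> wirt (fun w => Cconj (f w)) z (Cconj b) (Cconj a).
Proof.
  intros Hf. eapply wirt_eq.
  - apply (wirt_comp f Cconj z a b 0 1 Hf).
    apply (wirt_ext_loc (fun w => 0 * w + 1 * Cconj w + 0)). 2: apply wirt_lin.
    apply filter_forall. intros w. ring.
  - ring.
  - ring.
Qed.

Lemma wirt_plus (f g : C -> C) (z a b c d : C) :
  wirt f z a b -> wirt g z c d -> wirt (fun w => f w + g w) z (a + c) (b + d).
Proof.
  intros Hf Hg.
  refine (filterdiff_ext_lin _ _ _ (filterdiff_plus_fct (U := C_R_NormedModule) (V := C_R_NormedModule) _ _ _ _ Hf Hg) _).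
  intros y. change (@plus _) with Cplus. cring.
Qed.

Lemma wirt_scal (k : C) (f : C -> C) (z a b : C) :
  wirt f z a b -> wirt (fun w => k * f w) z (k * a) (k * b).
Proof.
  intros Hf. eapply wirt_eq.
  - apply (wirt_comp f (fun w => k * w) z a b k 0 Hf).
    apply (wirt_ext_loc (fun w => k * w + 0 * Cconj w + 0)). 2: apply wirt_lin.
    apply filter_forall. intros w. ring.
  - ring.
  - ring.
Qed.

Lemma wirt_minus (f g : C -> C) (z a b c d : C) :
  wirt f z a b -> wirt g z c d -> wirt (fun w => f w - g w) z (a - c) (b - d).
Proof.
  intros Hf Hg. eapply wirt_eq.
  - apply (wirt_ext_loc (fun w => f w + (-(1)) * g w)).
    + apply filter_forall. intros w. ring.
    + apply wirt_plus. exact Hf. apply wirt_scal. exact Hg.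
  - ring.
  - ring.
Qed.

Lemma wirt_mult (f g : C -> C) (z a b c d : C) :
  wirt f z a b -> wirt g z c d ->
  wirt (fun w => f w * g w) z (a * g z + f z * c) (b * g z + f z * d).
Proof.
  intros Hf Hg.
  assert (HRe : forall F a b, wirt F z a b ->
    @filterdiff R_AbsRing C_R_NormedModule R_NormedModule (fun w => Re (F w)) (@locally C_UniformSpace z)
      (fun v => Re (a * v + b * Cconj v))).
  { intros F a' b' HF.
    refine (filterdiff_comp' (U := C_R_NormedModule) (V := C_R_NormedModule) (W := R_NormedModule) F (@fst R R) z _ _ HF _).
    apply filterdiff_linear. apply (is_linear_fst (U := R_NormedModule) (V := R_NormedModule)). }
  assert (HIm : forall F a b, wirt F z a b ->
    @filterdiff R_AbsRing C_R_NormedModule R_NormedModule (fun w => Im (F w)) (@locally C_UniformSpace z)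
      (fun v => Im (a * v + b * Cconj v))).
  { intros F a' b' HF.
    refine (filterdiff_comp' (U := C_R_NormedModule) (V := C_R_NormedModule) (W := R_NormedModule) F (@snd R R) z _ _ HF _).
    apply filterdiff_linear. apply (is_linear_snd (U := R_NormedModule) (V := R_NormedModule)). }
  (* [f g = Re f . g + Im f . (i g)], so the product rule for a real scalar times a vector applies
     to each term. *)
  assert (H1 := filterdiff_scal_fct (U := C_R_NormedModule) (V := C_R_NormedModule) z _ _ _ _ Rmult_comm (HRe _ _ _ Hf) Hg).
  assert (H2 := filterdiff_scal_fct (U := C_R_NormedModule) (V := C_R_NormedModule) z _ _ _ _ Rmult_comm (HIm _ _ _ Hf) (wirt_scal Ci _ _ _ _ Hg)).
  assert (H3 := filterdiff_plus_fct (U := C_R_NormedModule) (V := C_R_NormedModule) _ _ _ _ H1 H2).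
  refine (filterdiff_ext_lin _ _ _ (filterdiff_ext _ _ _ _ H3) _).
  - intros y. destruct (f y), (g y). apply injective_projections; cbn; ring.
  - intros y. destruct (f z), (g z), a, b, c, d, y. apply injective_projections; cbn; ring.
Qed.

Lemma wirt_inv (z : C) : z <> 0 -> wirt (fun w => / w) z (- / (z * z)) 0.
Proof.
  intros Hz. apply wirt_eps. intros eps Heps.
  assert (Hm : 0 < Cmod z) by (apply Cmod_gt_0; exact Hz).
  (* The remainder is exactly [(w - z)^2 / (w z^2)]. The first bound keeps [|w| > |z| / 2], the
     second makes the quotient by [|w - z|] smaller than [eps]. *)
  exists (Rmin (Cmod z / 2) (eps * (Cmod z * Cmod z * Cmod z) / 2)). split.
  { apply Rmin_pos. lra. apply Rdiv_lt_0_compat; [|lra]. repeat apply Rmult_lt_0_compat; lra. }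
  intros w Hw.
  assert (H1 : Cmod (w - z) < Cmod z / 2) by (eapply Rlt_le_trans; [exact Hw | apply Rmin_l]).
  assert (H2 : Cmod (w - z) < eps * (Cmod z * Cmod z * Cmod z) / 2)
    by (eapply Rlt_le_trans; [exact Hw | apply Rmin_r]).
  assert (H3 : Cmod z / 2 < Cmod w).
  { assert (H := Cmod_triangle w (z - w)). replace (w + (z - w)) with z in H by ring.
    replace (z - w) with (- (w - z)) in H by ring. rewrite Cmod_opp in H. lra. }
  assert (Hw0 : w <> 0) by (apply Cmod_gt_0; lra).
  replace (/ w - / z - (- / (z * z) * (w - z) + 0 * Cconj (w - z)))
    with ((w - z) * ((w - z) / (w * (z * z)))) by (field; split; assumption).
  assert (Hzz : z * z <> 0) by (apply Cmult_neq_0; assumption).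
  rewrite Cmod_mult, Cmod_div, !Cmod_mult by (apply Cmult_neq_0; assumption).
  rewrite Rmult_comm. apply Rmult_le_compat_r. apply Cmod_ge_0.
  apply Rle_div_l.
  { repeat apply Rlt_gt, Rmult_lt_0_compat; lra. }
  apply Rlt_le. eapply Rlt_le_trans. exact H2.
  assert (0 <= eps * (Cmod z * Cmod z)) by (repeat apply Rmult_le_pos; lra).
  replace (eps * (Cmod z * Cmod z * Cmod z) / 2)%R with (eps * (Cmod z * Cmod z) * (Cmod z / 2))%R by field.
  replace (eps * (Cmod w * (Cmod z * Cmod z)))%R with (eps * (Cmod z * Cmod z) * Cmod w)%R by ring.
  apply Rmult_le_compat_l; lra.
Qed.

Lemma wirt_inv_fct (f : C -> C) (z a b : C) :
  wirt f z a b -> f z <> 0 ->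
  wirt (fun w => / f w) z (- a / (f z * f z)) (- b / (f z * f z)).
Proof.
  intros Hf Hz. eapply wirt_eq.
  - apply (wirt_comp f (fun w => / w) z a b (- / (f z * f z)) 0 Hf). apply wirt_inv. exact Hz.
  - unfold Cdiv. ring.
  - unfold Cdiv. ring.
Qed.

Lemma wirt_div (f g : C -> C) (z a b c d : C) :
  wirt f z a b -> wirt g z c d -> g z <> 0 ->
  wirt (fun w => f w / g w) z ((a * g z - f z * c) / (g z * g z)) ((b * g z - f z * d) / (g z * g z)).
Proof.
  intros Hf Hg Hz. eapply wirt_eq.
  - apply wirt_mult. exact Hf. apply wirt_inv_fct. exact Hg. exact Hz.
  - cbv beta. field. exact Hz.
  - cbv beta. field. exact Hz.
Qed.

Lemma wirt_holo (f : C -> C) (z l : C) :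
  wirt f z l 0 <-> @is_derive C_AbsRing C_NormedModule f z l.
Proof.
  split.
  - intros H. split.
    { apply (@is_linear_scal_l C_AbsRing C_NormedModule). }
    intros x Hx eps.
    assert (Hxz : x = z).
    { symmetry. apply (is_filter_lim_locally_unique (V := AbsRing_NormedModule C_AbsRing) z x Hx). }
    subst x.
    destruct (proj1 (wirt_eps _ _ _ _) H eps (cond_pos eps)) as [d [Hd H']].
    exists (mkposreal d Hd). intros w Hw.
    specialize (H' w Hw). change (Cmod (f w - f z - (w - z) * l) <= eps * Cmod (w - z))%R.
    refine (Rle_trans _ _ _ _ H'). apply Req_le. f_equal. ring.
  - intros [_ H]. apply wirt_eps. intros eps Heps.
    specialize (H z (fun P HP => HP) (mkposreal _ Heps)).
    destruct H as [d H]. exists d. split. apply cond_pos.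
    intros w Hw. specialize (H w Hw). change (Cmod (f w - f z - (w - z) * l) <= eps * Cmod (w - z))%R in H.
    refine (Rle_trans _ _ _ _ H). apply Req_le. f_equal. ring.
Qed.

Lemma wirt_along (f : C -> C) (g : R -> C) (t : R) (l a b : C) :
  wirt f (g t) a b ->
  @is_derive R_AbsRing C_R_NormedModule g t l ->
  @is_derive R_AbsRing C_R_NormedModule (fun s => f (g s)) t (a * l + b * Cconj l).
Proof.
  intros Hf Hg.
  refine (filterdiff_ext_lin _ _ _ (filterdiff_comp' (U := R_NormedModule) (V := C_R_NormedModule) (W := C_R_NormedModule) _ _ t _ _ Hg Hf) _).
  intros y. destruct a, b, l. apply injective_projections; cbn; ring.
Qed.

Lemma is_derive_C (g : R -> C) (t : R) (l : C) :
  @is_derive R_AbsRing C_R_NormedModule g t l <->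
  is_derive (fun s => Re (g s)) t (Re l) /\ is_derive (fun s => Im (g s)) t (Im l).
Proof.
  split.
  - intros H. split.
    + refine (filterdiff_ext_lin _ _ _ (filterdiff_comp' (U := R_NormedModule) (V := C_R_NormedModule) (W := R_NormedModule) g (@fst R R) t _ _ H
        (filterdiff_linear _ (is_linear_fst (U := R_NormedModule) (V := R_NormedModule)))) _).
      intros y. reflexivity.
    + refine (filterdiff_ext_lin _ _ _ (filterdiff_comp' (U := R_NormedModule) (V := C_R_NormedModule) (W := R_NormedModule) g (@snd R R) t _ _ H
        (filterdiff_linear _ (is_linear_snd (U := R_NormedModule) (V := R_NormedModule)))) _).
      intros y. reflexivity.
  - intros [H1 H2].
    assert (H3 := @is_derive_scal_l R_AbsRing C_R_NormedModule _ _ _ (RtoC 1) H1).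
    assert (H4 := @is_derive_scal_l R_AbsRing C_R_NormedModule _ _ _ Ci H2).
    assert (H5 := @is_derive_plus R_AbsRing C_R_NormedModule _ _ _ _ _ H3 H4).
    assert (E : l = plus (scal (Re l) (RtoC 1 : C_R_NormedModule)) (scal (Im l) (Ci : C_R_NormedModule))).
    { destruct l. apply injective_projections; cbn; ring. }
    rewrite E. revert H5. apply is_derive_ext.
    intros s. destruct (g s). apply injective_projections; cbn; ring.
Qed.

Lemma wirt_partials (f : C -> C) (z a b : C) :
  wirt f z a b ->
  (is_derive (fun t => Re (f (t, Im z))) (Re z) (Re (a + b)) /\
   is_derive (fun t => Im (f (t, Im z))) (Re z) (Im (a + b))) /\
  (is_derive (fun t => Re (f (Re z, t))) (Im z) (Re (Ci * (a - b))) /\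
   is_derive (fun t => Im (f (Re z, t))) (Im z) (Im (Ci * (a - b)))).
Proof.
  intros H. split; apply is_derive_C.
  - replace (a + b) with (a * RtoC 1 + b * Cconj (RtoC 1)).
    + apply (wirt_along f (fun t => (t, Im z))). destruct z; exact H.
      apply is_derive_C. split; cbn; auto_derive; trivial.
    + destruct a, b; apply injective_projections; cbn; ring.
  - replace (Ci * (a - b)) with (a * Ci + b * Cconj Ci).
    + apply (wirt_along f (fun t => (Re z, t))). destruct z; exact H.
      apply is_derive_C. split; cbn; auto_derive; trivial.
    + destruct a, b; apply injective_projections; cbn; ring.
Qed.

(** The tool for assembling [Clog] and [Cexp] from [ln], [atan], [exp], [cos] and [sin]: the
    arguments [|w|^2], [Im w / Re w] and [Im w] are written there as real parts of algebraic
    expressions in [w] and its conjugate. *)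
Lemma wirt_Re_comp (phi : R -> R) (f : C -> C) (z a b : C) (l : R) :
  wirt f z a b -> is_derive phi (Re (f z)) l ->
  wirt (fun w => RtoC (phi (Re (f w)))) z (l * (a + Cconj b) / 2) (l * (b + Cconj a) / 2).
Proof.
  intros Hf Hphi.
  assert (H1 : @filterdiff R_AbsRing C_R_NormedModule R_NormedModule (fun w => Re (f w))
      (@locally C_UniformSpace z) (fun v => Re (a * v + b * Cconj v))).
  { refine (filterdiff_comp' (U := C_R_NormedModule) (V := C_R_NormedModule) (W := R_NormedModule) f (@fst R R) z _ _ Hf _).
    apply filterdiff_linear. apply (is_linear_fst (U := R_NormedModule) (V := R_NormedModule)). }
  assert (H2 := filterdiff_comp' (U := C_R_NormedModule) (V := R_NormedModule) (W := R_NormedModule) _ _ z _ _ H1 Hphi).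
  assert (H3 := filterdiff_scal_l_fct (U := C_R_NormedModule) (V := C_R_NormedModule) (RtoC 1) _ _ H2).
  refine (filterdiff_ext_lin _ _ _ (filterdiff_ext _ _ _ _ H3) _).
  - intros y. apply injective_projections; cbn; ring.
  - intros y. destruct a, b, y. apply injective_projections; cbn; field.
Qed.

Lemma wirt_continuous (f : C -> C) (z a b : C) : wirt f z a b -> continuous f z.
Proof.
  intros H. apply (filterdiff_continuous (U := C_R_NormedModule) (V := C_R_NormedModule)).
  eexists. exact H.
Qed.

Local Close Scope C_scope.

(** * Smooth maps *)
Lemma class_Ck_pred {V W : NormedModule R_AbsRing} (k : nat) (U : V -> Prop) (F : V -> W) :
  class_Ck (S k) U F -> class_Ck k U F.
Proof.
  revert F. induction k as [|k IH]; intros F [L [HL HC]].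
  - intros x Hx. apply filterdiff_continuous. eexists. apply HL, Hx.
  - exists L. split. exact HL. intros v. apply IH, HC.
Qed.

Lemma class_Ck_ext {V W : NormedModule R_AbsRing} (k : nat) (U : V -> Prop) (F G : V -> W) :
  open U -> (forall x, U x -> F x = G x) -> class_Ck k U F -> class_Ck k U G.
Proof.
  intros HU HE. destruct k as [|k].
  - intros H x Hx. apply (continuous_ext_loc _ F).
    + apply (filter_imp U). exact HE. apply HU, Hx.
    + apply H, Hx.
  - intros [L [HL HC]]. exists L. split; [|exact HC]. intros x Hx.
    apply (filterdiff_ext_locally F).
    + apply (filter_imp U). exact HE. apply HU, Hx.
    + apply HL, Hx.
Qed.

Lemma class_Ck_const {V W : NormedModule R_AbsRing} (k : nat) (U : V -> Prop) (c : W) :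
  class_Ck k U (fun _ => c).
Proof.
  revert c. induction k as [|k IH]; intros c.
  - intros x Hx. apply continuous_const.
  - exists (fun _ _ => zero). split.
    + intros x Hx. apply filterdiff_const.
    + intros v. apply IH.
Qed.

Lemma class_Ck_linear {V W : NormedModule R_AbsRing} (k : nat) (U : V -> Prop) (l : V -> W) :
  is_linear l -> class_Ck k U l.
Proof.
  intros Hl. destruct k as [|k].
  - intros x Hx. apply filterdiff_continuous. eexists. apply filterdiff_linear, Hl.
  - exists (fun _ => l). split.
    + intros x Hx. apply filterdiff_linear, Hl.
    + intros v. apply class_Ck_const.
Qed.

Lemma class_Ck_plus {V W : NormedModule R_AbsRing} (k : nat) (U : V -> Prop) (F G : V -> W) :
  class_Ck k U F -> class_Ck k U G -> class_Ck k U (fun x => plus (F x) (G x)).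
Proof.
  revert F G. induction k as [|k IH]; intros F G.
  - intros HF HG x Hx. apply (continuous_plus F G); auto.
  - intros [L [HL HC]] [L' [HL' HC']]. exists (fun x v => plus (L x v) (L' x v)). split.
    + intros x Hx. apply filterdiff_plus_fct; auto.
    + intros v. apply IH; auto.
Qed.

Lemma class_Ck_scal {V W : NormedModule R_AbsRing} (k : nat) (U : V -> Prop) (F : V -> R_NormedModule) (G : V -> W) :
  class_Ck k U F -> class_Ck k U G -> class_Ck k U (fun x => scal (F x : R) (G x)).
Proof.
  revert F G. induction k as [|k IH]; intros F G.
  - intros HF HG x Hx. apply (continuous_scal F G); auto.
  - intros HF HG. assert (HF0 := class_Ck_pred _ _ _ HF). assert (HG0 := class_Ck_pred _ _ _ HG).
    destruct HF as [L [HL HC]], HG as [L' [HL' HC']].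
    exists (fun x v => plus (scal (L x v : R) (G x)) (scal (F x : R) (L' x v))). split.
    + intros x Hx. exact (filterdiff_scal_fct x F G (L x) (L' x) Rmult_comm (HL x Hx) (HL' x Hx)).
    + intros v. apply class_Ck_plus; apply IH; auto.
Qed.

Lemma class_Ck_linear_comp {V W X : NormedModule R_AbsRing} (k : nat) (U : V -> Prop) (F : V -> W) (l : W -> X) :
  is_linear l -> class_Ck k U F -> class_Ck k U (fun x => l (F x)).
Proof.
  intros Hl. revert F. induction k as [|k IH]; intros F.
  - intros HF x Hx. apply (continuous_comp F l). apply HF, Hx.
    apply filterdiff_continuous. eexists. apply filterdiff_linear, Hl.
  - intros [L [HL HC]]. exists (fun x v => l (L x v)). split.
    + intros x Hx. apply (filterdiff_comp' F l). auto. apply filterdiff_linear, Hl.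
    + intros v. apply IH, HC.
Qed.

Lemma class_Ck_comp_linear {V W X : NormedModule R_AbsRing} (k : nat) (U : W -> Prop) (F : W -> X) (l : V -> W) :
  is_linear l -> class_Ck k U F -> class_Ck k (fun x => U (l x)) (fun x => F (l x)).
Proof.
  intros Hl. revert F. induction k as [|k IH]; intros F.
  - intros HF x Hx. apply (continuous_comp l F).
    apply filterdiff_continuous. eexists. apply filterdiff_linear, Hl. apply HF, Hx.
  - intros [L [HL HC]]. exists (fun x v => L (l x) (l v)). split.
    + intros x Hx. apply (filterdiff_comp' l F). apply filterdiff_linear, Hl. auto.
    + intros v. apply (IH (fun y => L y (l v))), HC.
Qed.

Lemma is_linear_pair_l {V W : NormedModule R_AbsRing} :
  is_linear (fun x : V => (x, zero) : prod_NormedModule R_AbsRing V W).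
Proof.
  split.
  - intros x y. apply injective_projections; cbn. reflexivity. symmetry. apply plus_zero_l.
  - intros k x. apply injective_projections; cbn. reflexivity. symmetry. apply (scal_zero_r (V := W)).
  - exists 1. split. lra. intros x. rewrite Rmult_1_l.
    unfold norm at 1; cbn. unfold prod_norm; cbn. rewrite norm_zero.
    rewrite !Rmult_1_r, Rmult_0_r, Rplus_0_r. rewrite sqrt_square. apply Rle_refl. apply norm_ge_0.
Qed.

Lemma is_linear_pair_r {V W : NormedModule R_AbsRing} :
  is_linear (fun x : W => (zero, x) : prod_NormedModule R_AbsRing V W).
Proof.
  split.
  - intros x y. apply injective_projections; cbn. symmetry. apply plus_zero_l. reflexivity.
  - intros k x. apply injective_projections; cbn. symmetry. apply (scal_zero_r (V := V)). reflexivity.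
  - exists 1. split. lra. intros x. rewrite Rmult_1_l.
    unfold norm at 1; cbn. unfold prod_norm; cbn. rewrite norm_zero.
    rewrite !Rmult_1_r, Rmult_0_r, Rplus_0_l. rewrite sqrt_square. apply Rle_refl. apply norm_ge_0.
Qed.

(** A pair is the sum of its images under the two linear injections, so no further induction on [k]
    is needed. *)
Lemma class_Ck_pair {V W X : NormedModule R_AbsRing} (k : nat) (U : V -> Prop) (F : V -> W) (G : V -> X) :
  class_Ck k U F -> class_Ck k U G ->
  @class_Ck V (prod_NormedModule R_AbsRing W X) k U (fun x => (F x, G x)).
Proof.
  intros HF HG.
  assert (H := class_Ck_plus k U _ _ (class_Ck_linear_comp k U F _ (is_linear_pair_l (W := X)) HF)
    (class_Ck_linear_comp k U G _ (is_linear_pair_r (V := W)) HG)).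
  replace (fun x => (F x, G x)) with
    (fun x => @plus (prod_NormedModule R_AbsRing W X) ((F x, zero)) ((zero, G x))).
  exact H. apply functional_extensionality. intros x.
  apply injective_projections; cbn. apply plus_zero_r. apply plus_zero_l.
Qed.

Lemma class_Ck_Re {V : NormedModule R_AbsRing} (k : nat) (U : V -> Prop) (F : V -> C) :
  @class_Ck V C_R_NormedModule k U F -> @class_Ck V R_NormedModule k U (fun x => Re (F x)).
Proof.
  intros HF. apply (class_Ck_linear_comp (W := C_R_NormedModule) (X := R_NormedModule) k U F (@fst R R)).
  apply (is_linear_fst (U := R_NormedModule) (V := R_NormedModule)). exact HF.
Qed.

Lemma class_Ck_Im {V : NormedModule R_AbsRing} (k : nat) (U : V -> Prop) (F : V -> C) :
  @class_Ck V C_R_NormedModule k U F -> @class_Ck V R_NormedModule k U (fun x => Im (F x)).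
Proof.
  intros HF. apply (class_Ck_linear_comp (W := C_R_NormedModule) (X := R_NormedModule) k U F (@snd R R)).
  apply (is_linear_snd (U := R_NormedModule) (V := R_NormedModule)). exact HF.
Qed.

Lemma class_Ck_RtoC {V : NormedModule R_AbsRing} (k : nat) (U : V -> Prop) (F : V -> R) :
  @class_Ck V R_NormedModule k U F -> @class_Ck V C_R_NormedModule k U (fun x => RtoC (F x)).
Proof.
  intros HF. apply (class_Ck_linear_comp (W := R_NormedModule) (X := C_R_NormedModule) k U F RtoC).
  apply (is_linear_pair_l (V := R_NormedModule) (W := R_NormedModule)). exact HF.
Qed.

Lemma class_Ck_wlin {V : NormedModule R_AbsRing} (k : nat) (U : V -> Prop) (F : V -> C) (a b : C) :
  @class_Ck V C_R_NormedModule k U F ->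
  @class_Ck V C_R_NormedModule k U (fun x => a * F x + b * Cconj (F x))%C.
Proof.
  intros HF. apply (class_Ck_linear_comp (W := C_R_NormedModule) (X := C_R_NormedModule) k U F (fun v : C => a * v + b * Cconj v)%C).
  apply wirt_is_linear. exact HF.
Qed.

Lemma class_Ck_Cconj {V : NormedModule R_AbsRing} (k : nat) (U : V -> Prop) (F : V -> C) :
  @class_Ck V C_R_NormedModule k U F ->
  @class_Ck V C_R_NormedModule k U (fun x => Cconj (F x)).
Proof.
  intros HF. replace (fun x => Cconj (F x)) with (fun x => 0 * F x + 1 * Cconj (F x))%C.
  apply class_Ck_wlin, HF. apply functional_extensionality. intros x. ring.
Qed.

Lemma class_Ck_Cscal {V : NormedModule R_AbsRing} (k : nat) (U : V -> Prop) (c : C) (F : V -> C) :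
  @class_Ck V C_R_NormedModule k U F ->
  @class_Ck V C_R_NormedModule k U (fun x => c * F x)%C.
Proof.
  intros HF. replace (fun x => c * F x)%C with (fun x => c * F x + 0 * Cconj (F x))%C.
  apply class_Ck_wlin, HF. apply functional_extensionality. intros x. ring.
Qed.

Lemma class_Ck_Cplus {V : NormedModule R_AbsRing} (k : nat) (U : V -> Prop) (F G : V -> C) :
  @class_Ck V C_R_NormedModule k U F -> @class_Ck V C_R_NormedModule k U G ->
  @class_Ck V C_R_NormedModule k U (fun x => F x + G x)%C.
Proof. apply (class_Ck_plus (W := C_R_NormedModule)). Qed.

Lemma class_Ck_Cmult {V : NormedModule R_AbsRing} (k : nat) (U : V -> Prop) (F G : V -> C) :
  @class_Ck V C_R_NormedModule k U F -> @class_Ck V C_R_NormedModule k U G ->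
  @class_Ck V C_R_NormedModule k U (fun x => F x * G x)%C.
Proof.
  intros HF HG.
  assert (H := class_Ck_plus k U _ _
    (class_Ck_scal k U _ _ (class_Ck_Re k U F HF) HG)
    (class_Ck_scal k U _ _ (class_Ck_Im k U F HF) (class_Ck_Cscal k U Ci G HG))).
  refine (eq_ind _ (@class_Ck V C_R_NormedModule k U) H _ _).
  apply functional_extensionality. intros x. destruct (F x), (G x).
  apply injective_projections; cbn; ring.
Qed.

(** The intermediate space is the plane because [class_Ck] controls a differential only at fixed
    vectors: the differential of [G] along the moving vector [D x v] is expanded in the basis [1],
    [i], and the coefficients are smooth by themselves. *)
Lemma class_Ck_comp {V W : NormedModule R_AbsRing} (k : nat) (U : V -> Prop) (U' : C -> Prop)
    (s : V -> C) (G : C -> W) :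
  (forall x, U x -> U' (s x)) ->
  @class_Ck V C_R_NormedModule k U s -> @class_Ck C_R_NormedModule W k U' G ->
  class_Ck k U (fun x => G (s x)).
Proof.
  intros HU. revert s HU G. induction k as [|k IH]; intros s HU G.
  - intros Hs HG x Hx. apply (continuous_comp (V := C_R_NormedModule) s G). apply Hs, Hx. apply HG, HU, Hx.
  - intros Hs [L [HL HC]]. assert (Hs0 := class_Ck_pred _ _ _ Hs). destruct Hs as [D [HD HDC]].
    exists (fun x v => plus (scal (Re (D x v)) (L (s x) (RtoC 1))) (scal (Im (D x v)) (L (s x) Ci))).
    split.
    + intros x Hx.
      refine (filterdiff_ext_lin _ _ _ (filterdiff_comp' s G x _ _ (HD x Hx) (HL _ (HU x Hx))) _).
      intros v. cbv beta. destruct (HL _ (HU x Hx)) as [[Hp Hsc _] _].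
      rewrite <- !Hsc, <- Hp. f_equal. destruct (D x v). apply injective_projections; cbn; ring.
    + intros v. apply class_Ck_plus; apply class_Ck_scal.
      * apply class_Ck_Re, HDC.
      * apply (IH s HU (fun y => L y (RtoC 1))). exact Hs0. apply HC.
      * apply class_Ck_Im, HDC.
      * apply (IH s HU (fun y => L y Ci)). exact Hs0. apply HC.
Qed.

Lemma class_Ck_wirt (k : nat) (U : C -> Prop) (F A B : C -> C) :
  (forall z, U z -> wirt F z (A z) (B z)) ->
  @class_Ck C_R_NormedModule C_R_NormedModule k U A ->
  @class_Ck C_R_NormedModule C_R_NormedModule k U B ->
  @class_Ck C_R_NormedModule C_R_NormedModule (S k) U F.
Proof.
  intros HF HA HB. exists (fun z v => A z * v + B z * Cconj v)%C. split.
  - exact HF.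
  - intros v. apply class_Ck_Cplus; apply class_Ck_Cmult; auto; apply (class_Ck_const (W := C_R_NormedModule)).
Qed.

Lemma class_Ck_Cinv {V : NormedModule R_AbsRing} (k : nat) (U : V -> Prop) (F : V -> C) :
  (forall x, U x -> F x <> RtoC 0) ->
  @class_Ck V C_R_NormedModule k U F -> @class_Ck V C_R_NormedModule k U (fun x => / F x)%C.
Proof.
  intros H0 HF. apply (class_Ck_comp k U (fun z => z <> RtoC 0) F Cinv H0 HF).
  clear. induction k as [|k IH].
  - intros x Hx. apply (wirt_continuous _ _ (- / (x * x))%C 0%C). apply wirt_inv, Hx.
  (* Bootstrapping: the derivative of [/ z] is a polynomial in [/ z]. *)
  - apply (class_Ck_wirt k _ _ (fun z => (- (1)) * (/ z * / z))%C (fun _ => RtoC 0)).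
    + intros z Hz. eapply wirt_eq. apply wirt_inv, Hz. field. exact Hz. reflexivity.
    + apply class_Ck_Cscal, class_Ck_Cmult; exact IH.
    + apply (class_Ck_const (W := C_R_NormedModule)).
Qed.

Lemma class_Ck_Cdiv {V : NormedModule R_AbsRing} (k : nat) (U : V -> Prop) (F G : V -> C) :
  (forall x, U x -> G x <> RtoC 0) ->
  @class_Ck V C_R_NormedModule k U F -> @class_Ck V C_R_NormedModule k U G ->
  @class_Ck V C_R_NormedModule k U (fun x => F x / G x)%C.
Proof. intros H0 HF HG. apply class_Ck_Cmult. exact HF. apply class_Ck_Cinv; assumption. Qed.

Lemma class_Ck_Cminus {V : NormedModule R_AbsRing} (k : nat) (U : V -> Prop) (F G : V -> C) :
  @class_Ck V C_R_NormedModule k U F -> @class_Ck V C_R_NormedModule k U G ->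
  @class_Ck V C_R_NormedModule k U (fun x => F x - G x)%C.
Proof.
  intros HF HG. apply class_Ck_Cplus. exact HF.
  replace (fun x => - G x)%C with (fun x => (- (1)) * G x)%C.
  apply class_Ck_Cscal, HG. apply functional_extensionality. intros x. ring.
Qed.

Lemma class_Ck_Cconst {V : NormedModule R_AbsRing} (k : nat) (U : V -> Prop) (c : C) :
  @class_Ck V C_R_NormedModule k U (fun _ => c).
Proof. apply (class_Ck_const (W := C_R_NormedModule)). Qed.

Lemma class_Ck_Cid (k : nat) (U : C -> Prop) :
  @class_Ck C_R_NormedModule C_R_NormedModule k U (fun z => z).
Proof. apply (class_Ck_linear (V := C_R_NormedModule)). apply is_linear_id. Qed.

(* The differential of the inverse, obtained by solving [dw = a dz + b conj dz] for [dz]. *)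
Lemma wirt_inverse (f g : C -> C) (w a b : C) :
  continuous g w -> (@locally C_UniformSpace w (fun v => f (g v) = v)) ->
  wirt f (g w) a b -> Cmod b < Cmod a ->
  wirt g w (Cconj a / RtoC (Cmod a ^ 2 - Cmod b ^ 2)) (- b / RtoC (Cmod a ^ 2 - Cmod b ^ 2)).
Proof.
  intros Hc Hfg Hf Hab. apply wirt_eps. intros eps Heps.
  assert (Ha := Cmod_ge_0 a). assert (Hb := Cmod_ge_0 b).
  set (D := Cmod a ^ 2 - Cmod b ^ 2). assert (HD : 0 < D) by (unfold D; nra).
  assert (HDC : RtoC D <> RtoC 0) by (intros H; injection H; lra).
  assert (HDa : (a * Cconj a - b * Cconj b)%C = RtoC D).
  { unfold D. rewrite RtoC_minus, <- !Cmod2_conj. reflexivity. }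
  set (K := (Cmod a + Cmod b) / D).
  assert (HK : 0 < K) by (unfold K; apply Rdiv_lt_0_compat; lra).
  (* [K = 1 / (|a| - |b|)] bounds the inverse differential. The first bound on [e1] absorbs the
     error into half of [|dz|], whence [|dz| <= 2 K |dw|]; the second then makes the final error at
     most [eps |dw|]. *)
  assert (He1 : 0 < Rmin (/ (2 * K)) (eps / (2 * K * K))).
  { apply Rmin_pos. apply Rinv_0_lt_compat; lra. apply Rdiv_lt_0_compat; nra. }
  set (e1 := Rmin (/ (2 * K)) (eps / (2 * K * K))) in *.
  assert (He1a : K * e1 <= 1 / 2).
  { apply Rle_trans with (K * (/ (2 * K))). apply Rmult_le_compat_l. lra. apply Rmin_l.
    apply Req_le. field. lra. }
  assert (He1b : 2 * K * K * e1 <= eps).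
  { apply Rle_trans with (2 * K * K * (eps / (2 * K * K))). apply Rmult_le_compat_l. nra. apply Rmin_r.
    apply Req_le. field. lra. }
  destruct (proj1 (wirt_eps _ _ _ _) Hf e1 He1) as [d [Hd H]].
  assert (Hc' : @locally C_UniformSpace w (fun v => Cmod (g v - g w) < d)).
  { apply (Hc (fun u => Cmod (u - g w) < d)). apply locally_Cmod. exists d. auto. }
  destruct (proj1 (locally_Cmod _ _) (filter_and _ _ Hc' Hfg)) as [d' [Hd' H']].
  exists d'. split. exact Hd'. intros v Hv.
  destruct (H' v Hv) as [H1 H2].
  assert (H3 : f (g w) = w). { apply H'. replace (w - w)%C with (RtoC 0) by ring. rewrite Cmod_0. exact Hd'. }
  specialize (H _ H1). rewrite H2, H3 in H.
  set (dz := (g v - g w)%C) in *. set (dw := (v - w)%C) in *.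
  set (r := (dw - (a * dz + b * Cconj dz))%C) in *.
  assert (Hdz : (dz - (Cconj a / D * dw + - b / D * Cconj dw))%C = (- (Cconj a * r - b * Cconj r) / RtoC D)%C).
  { unfold r. rewrite !Cminus_conj, !Cplus_conj, !Cmult_conj, Cconj_conj.
    transitivity ((a * Cconj a - b * Cconj b) / D * dz - (Cconj a / D * dw + - b / D * Cconj dw))%C.
    { rewrite HDa. field. exact HDC. }
    field. exact HDC. }
  assert (Hr : Cmod (dz - (Cconj a / D * dw + - b / D * Cconj dw)) <= K * Cmod r).
  { rewrite Hdz, Cmod_div, Cmod_opp, Cmod_R, Rabs_pos_eq by (lra || exact HDC).
    unfold K. apply Rle_div_l. exact HD.
    replace ((Cmod a + Cmod b) / D * Cmod r * D) with ((Cmod a + Cmod b) * Cmod r) by (field; lra).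
    eapply Rle_trans. apply Cmod_triangle. rewrite Cmod_opp, !Cmod_mult, !Cmod_conj. lra. }
  assert (Hdz2 : Cmod dz <= K * Cmod dw + K * Cmod r).
  { assert (Ht : Cmod dz <= Cmod (Cconj a / D * dw + - b / D * Cconj dw) + K * Cmod r).
    { replace dz with ((Cconj a / D * dw + - b / D * Cconj dw) + (dz - (Cconj a / D * dw + - b / D * Cconj dw)))%C at 1 by ring.
      eapply Rle_trans. apply Cmod_triangle. lra. }
    assert (Ht2 : Cmod (Cconj a / D * dw + - b / D * Cconj dw) <= K * Cmod dw).
    { eapply Rle_trans. apply Cmod_triangle.
      rewrite !Cmod_mult, !Cmod_div, !Cmod_opp, !Cmod_conj, Cmod_R, Rabs_pos_eq by (lra || exact HDC).
      unfold K. apply Req_le. field. lra. }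
    lra. }
  assert (Hw0 := Cmod_ge_0 dw). assert (Hz0 := Cmod_ge_0 dz). assert (Hr0 := Cmod_ge_0 r).
  assert (Hdz3 : Cmod dz <= 2 * K * Cmod dw).
  { assert (K * Cmod r <= 1 / 2 * Cmod dz).
    { apply Rle_trans with (K * e1 * Cmod dz). rewrite Rmult_assoc. apply Rmult_le_compat_l; lra.
      apply Rmult_le_compat_r; lra. }
    lra. }
  eapply Rle_trans. exact Hr.
  apply Rle_trans with (K * (e1 * (2 * K * Cmod dw))).
  - apply Rmult_le_compat_l. lra. eapply Rle_trans. exact H. apply Rmult_le_compat_l; lra.
  - replace (K * (e1 * (2 * K * Cmod dw))) with (2 * K * K * e1 * Cmod dw) by ring.
    apply Rmult_le_compat_r; lra.
Qed.

(** The derivatives of [g] are quotients of expressions in [A], [B] and their conjugates, composed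
    with [g] itself; so each class reached by [g] yields the next one, starting from continuity. *)
Lemma class_Ck_inverse (k : nat) (U U' : C -> Prop) (f g A B : C -> C) :
  @open C_UniformSpace U' -> (forall w, U' w -> U (g w) /\ f (g w) = w) ->
  (forall w, U' w -> continuous g w) ->
  (forall z, U z -> wirt f z (A z) (B z) /\ Cmod (B z) < Cmod (A z)) ->
  (forall k, @class_Ck C_R_NormedModule C_R_NormedModule k U A) ->
  (forall k, @class_Ck C_R_NormedModule C_R_NormedModule k U B) ->
  @class_Ck C_R_NormedModule C_R_NormedModule k U' g.
Proof.
  intros HO Hg Hc Hf HA HB. induction k as [|k IH].
  - exact Hc.
  - set (D := fun z => (A z * Cconj (A z) - B z * Cconj (B z))%C).
    assert (HD : forall z, U z -> D z = RtoC (Cmod (A z) ^ 2 - Cmod (B z) ^ 2)).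
    { intros z Hz. unfold D. rewrite RtoC_minus, <- !Cmod2_conj. reflexivity. }
    assert (HD0 : forall z, U z -> D z <> RtoC 0).
    { intros z Hz. rewrite HD by exact Hz. destruct (Hf z Hz) as [_ H].
      assert (H1 := Cmod_ge_0 (B z)). intros H2. injection H2. nra. }
    assert (HCD : @class_Ck C_R_NormedModule C_R_NormedModule k U D).
    { apply class_Ck_Cminus; apply class_Ck_Cmult; auto; apply class_Ck_Cconj; auto. }
    apply (class_Ck_wirt k U' g (fun w => Cconj (A (g w)) / D (g w))%C
      (fun w => (- (1)) * (B (g w) / D (g w)))%C).
    + intros w Hw. destruct (Hg w Hw) as [H1 H2]. destruct (Hf _ H1) as [H3 H4].
      eapply wirt_eq.
      * apply (wirt_inverse f g w (A (g w)) (B (g w)) (Hc w Hw)). 2: exact H3. 2: exact H4.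
        apply (filter_imp U'). intros v Hv. apply Hg, Hv. apply HO, Hw.
      * rewrite HD by exact H1. reflexivity.
      * rewrite HD by exact H1. unfold Cdiv. ring.
    + apply (class_Ck_comp k U' U g (fun z => Cconj (A z) / D z)%C). intros; apply Hg; assumption. exact IH.
      apply class_Ck_Cdiv; auto. apply class_Ck_Cconj; auto.
    + apply class_Ck_Cscal. apply (class_Ck_comp k U' U g (fun z => B z / D z)%C). intros; apply Hg; assumption. exact IH.
      apply class_Ck_Cdiv; auto.
Qed.

(** * Harmonic extension of a step function *)

(** A Lebesgue number argument on the square around the disk. A point outside the closed disk
    receives a radius that keeps its neighbourhood off the disk, so that it imposes nothing. The
    predicate carries its scale, since the scale found locally has to be shrunk to a common one. *)
Lemma closed_disk_compact (P : C -> R -> Prop) :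
  (forall z e e', 0 < e' <= e -> P z e -> P z e') ->
  (forall z0, Cmod z0 <= 1 -> exists e, 0 < e /\
     forall z, Cmod (z - z0) < e -> Cmod z <= 1 -> P z e) ->
  exists e, 0 < e /\ forall z, Cmod z <= 1 -> P z e.
Proof.
  intros Hmon Hloc.
  assert (Hloc' : forall z0, exists e : posreal,
     forall z, Cmod (z - z0) < e -> Cmod z <= 1 -> P z e).
  { intros z0. destruct (Rle_dec (Cmod z0) 1) as [H|H].
    - destruct (Hloc z0 H) as [e [He H1]]. exists (mkposreal e He). exact H1.
    - assert (He : 0 < Cmod z0 - 1) by lra. exists (mkposreal _ He).
      intros z Hz Hz1. exfalso. cbn in Hz.
      assert (H1 := Cmod_triangle z (z0 - z)). replace (z + (z0 - z))%C with z0 in H1 by ring.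
      replace (z0 - z)%C with (- (z - z0))%C in H1 by ring. rewrite Cmod_opp in H1. lra. }
  set (rad := fun z0 => proj1_sig (constructive_indefinite_description _ (Hloc' z0))).
  assert (Hrad : forall z0 z, Cmod (z - z0) < rad z0 -> Cmod z <= 1 -> P z (rad z0)).
  { intros z0. exact (proj2_sig (constructive_indefinite_description _ (Hloc' z0))). }
  (* Half the radius pays for the passage from square to Euclidean neighbourhoods, as
     [sqrt 2 / 2 < 1]. *)
  destruct (compactness_value_2d (-1) 1 (-1) 1 (fun u v => pos_div_2 (rad (u, v)))) as [d Hd].
  exists d. split. apply cond_pos.
  intros z Hz. apply NNPP. intros HP.
  assert (H1 := re_le_Cmod z). assert (H2 := Rmax_Cmod z).
  assert (H3 := Rmax_r (Rabs (fst z)) (Rabs (snd z))).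
  apply (Hd (fst z) (snd z)).
  - apply Rabs_le_between. unfold Re in H1. lra.
  - apply Rabs_le_between. lra.
  - intros [u [v [_ [_ [Hu [Hv Hdd]]]]]]. apply HP. cbn in Hu, Hv, Hdd.
    assert (Hr := cond_pos (rad (u, v))).
    apply (Hmon z (rad (u, v))).
    + split. apply cond_pos. lra.
    + apply Hrad. 2: exact Hz.
      eapply Rle_lt_trans. apply Cmod_2Rmax. cbn.
      assert (Hs : sqrt 2 < 2).
      { rewrite <- (sqrt_square 2) at 2 by lra. apply sqrt_lt_1; lra. }
      assert (Hs0 := sqrt_pos 2).
      assert (Rmax (Rabs (fst z - u)) (Rabs (snd z - v)) < rad (u, v) / 2) by (apply Rmax_lub_lt; lra).
      assert (0 <= Rmax (Rabs (fst z - u)) (Rabs (snd z - v))).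
      { eapply Rle_trans. 2: apply Rmax_l. apply Rabs_pos. }
      assert (Heq : forall a b : R, a + - b = a - b) by (intros; ring).
      rewrite ?Heq. nra.
Qed.

(* Agrees with the principal logarithm only on the right half-plane. *)
Definition Clog (w : C) : C := (ln (Re w ^ 2 + Im w ^ 2) / 2, atan (Im w / Re w)).

Lemma C_ext (z w : C) : Re z = Re w -> Im z = Im w -> z = w.
Proof. apply injective_projections. Qed.

Lemma RtoC_neq (x : R) : x <> 0 -> RtoC x <> RtoC 0.
Proof. intros H H1. injection H1. exact H. Qed.

Lemma Re_pos_neq_0 (w : C) : 0 < Re w -> w <> RtoC 0.
Proof. intros H ->. cbn in H. lra. Qed.

Lemma wirt_Clog (w : C) : 0 < Re w -> wirt Clog w (/ w)%C 0.
Proof.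
  intros Hw.
  assert (Hw0 := Re_pos_neq_0 w Hw).
  assert (Hw1 : Cconj w <> RtoC 0) by (apply Re_pos_neq_0; exact Hw).
  assert (Hs : (w + Cconj w)%C = RtoC (2 * Re w)).
  { apply C_ext; destruct w; cbn; ring. }
  assert (Hs0 : (Ci * (w + Cconj w))%C <> RtoC 0).
  { rewrite Hs. apply Cmult_neq_0. intros H; injection H; lra. apply RtoC_neq. lra. }
  assert (Hid := wirt_id w). assert (Hcj := wirt_conj _ _ _ _ Hid).
  assert (H1 := wirt_mult _ _ _ _ _ _ _ Hid Hcj).
  assert (H2 := wirt_div _ _ _ _ _ _ _ (wirt_minus _ _ _ _ _ _ _ Hid Hcj)
     (wirt_scal Ci _ _ _ _ (wirt_plus _ _ _ _ _ _ _ Hid Hcj)) Hs0).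
  assert (Hr : Re (w * Cconj w) = Re w ^ 2 + Im w ^ 2) by (destruct w; cbn; ring).
  assert (Hi : Re ((w - Cconj w) / (Ci * (w + Cconj w))) = Im w / Re w).
  { rewrite Hs. destruct w as [x y]. cbn in Hw |- *. field. lra. }
  assert (Hpos : 0 < Re (w * Cconj w)) by (rewrite Hr; nra).
  assert (H3 := wirt_Re_comp ln _ _ _ _ _ H1 (is_derive_ln _ Hpos)).
  assert (H4 := wirt_Re_comp atan _ _ _ _ _ H2 (is_derive_atan _)).
  assert (H5 := wirt_plus _ _ _ _ _ _ _ (wirt_scal (/ 2) _ _ _ _ H3) (wirt_scal Ci _ _ _ _ H4)).
  eapply wirt_eq.
  - refine (wirt_ext_loc _ _ _ _ _ _ H5).
    apply locally_Cmod. exists (Re w). split. exact Hw. intros u Hu.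
    assert (Hu1 : 0 < Re u).
    { assert (H := re_le_Cmod (u - w)). assert (Hd : Re (u - w) = Re u - Re w) by reflexivity.
      rewrite Hd in H. assert (H' := Rle_abs (- (Re u - Re w))). rewrite Rabs_Ropp in H'. lra. }
    assert (Hur : Re (u * Cconj u) = Re u ^ 2 + Im u ^ 2) by (destruct u; cbn; ring).
    assert (Hui : Re ((u - Cconj u) / (Ci * (u + Cconj u))) = Im u / Re u).
    { destruct u as [x y]. cbn in Hu1 |- *. field; repeat split; nra. }
    rewrite Hur, Hui. apply C_ext; cbn; field.
  - rewrite Hr, Hi. clear - Hw Hw0. destruct w as [x y]. cbn in Hw.
    assert (x * x + y * y <> 0) by nra. assert (x <> 0) by lra.
    apply C_ext; cbn; unfold Rsqr; field; repeat split; try nra;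
      (match goal with |- ?e <> 0 => replace e with (16 * x * x * x * x) by ring end;
       repeat apply Rmult_integral_contrapositive_currified; lra).
  - rewrite Hr, Hi. clear - Hw Hw0. destruct w as [x y]. cbn in Hw.
    assert (x * x + y * y <> 0) by nra. assert (x <> 0) by lra.
    apply C_ext; cbn; unfold Rsqr; field; repeat split; try nra;
      (match goal with |- ?e <> 0 => replace e with (16 * x * x * x * x) by ring end;
       repeat apply Rmult_integral_contrapositive_currified; lra).
Qed.

Definition cis (t : R) : C := (cos t, sin t).

Lemma cis_plus (s t : R) : cis (s + t) = (cis s * cis t)%C.
Proof. apply C_ext; cbn. apply cos_plus. rewrite sin_plus. ring. Qed.

Lemma cis_0 : cis 0 = RtoC 1.
Proof. unfold cis. rewrite cos_0, sin_0. reflexivity. Qed.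

Lemma cis_opp_mult (t : R) : (cis t * cis (- t))%C = RtoC 1.
Proof. rewrite <- cis_plus, Rplus_opp_r. apply cis_0. Qed.

Lemma cis_conj (t : R) : Cconj (cis t) = cis (- t).
Proof. apply C_ext; cbn. symmetry; apply cos_neg. symmetry; apply sin_neg. Qed.

Lemma Cmod_cis (t : R) : Cmod (cis t) = 1.
Proof.
  unfold Cmod, cis; cbn. transitivity (sqrt 1); [f_equal | apply sqrt_1].
  assert (H := sin2_cos2 t). unfold Rsqr in H. lra.
Qed.

Lemma cis_neq_0 (t : R) : cis t <> RtoC 0.
Proof. intros H. assert (H1 := Cmod_cis t). rewrite H, Cmod_0 in H1. lra. Qed.

Lemma cis_PI (t : R) : cis (t + PI) = (- cis t)%C.
Proof. apply C_ext; cbn. apply neg_cos. apply neg_sin. Qed.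

Lemma cis_2PI (t : R) : cis (t + 2 * PI) = cis t.
Proof. apply C_ext; cbn. rewrite <- (cos_period t 1); f_equal; cbn; ring. rewrite <- (sin_period t 1); f_equal; cbn; ring. Qed.

(** [|z - w|^2 <= 2 - 2 Re (z conj w)] when [|z| <= 1 = |w|]. *)
Lemma Re_Cmod_lt (z w : C) : Cmod z <= 1 -> Cmod w = 1 -> z <> w -> 0 < Re (1 - z * Cconj w).
Proof.
  intros Hz Hw Hne.
  assert (Hz2 := Cmod2_alt z). assert (Hw2 := Cmod2_alt w). rewrite Hw in Hw2.
  assert (H0 := Cmod_ge_0 z).
  assert (Hz3 : Re z ^ 2 + Im z ^ 2 <= 1) by nra.
  replace (Re (1 - z * Cconj w)) with (1 - (Re z * Re w + Im z * Im w)) by (destruct z, w; cbn; ring).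
  assert (Hp : 0 < (Re z - Re w) ^ 2 + (Im z - Im w) ^ 2).
  { assert (P1 := pow2_ge_0 (Re z - Re w)). assert (P2 := pow2_ge_0 (Im z - Im w)).
    destruct (Req_dec (Re z) (Re w)) as [E1|E1].
    - assert (E3 : Im z <> Im w) by (intros E2; apply Hne, C_ext; assumption).
      assert (0 < (Im z - Im w) ^ 2) by (apply pow2_gt_0; intro; apply E3; lra). lra.
    - assert (0 < (Re z - Re w) ^ 2) by (apply pow2_gt_0; intro; apply E1; lra). lra. }
  nra.
Qed.

Lemma disk_neq_cis (z : C) (t : R) : Cmod z < 1 -> z <> cis t.
Proof. intros H ->. rewrite Cmod_cis in H. lra. Qed.

(** With [zeta = cis t] this is the logarithm of [1 - z / zeta]. For [z] in the closed disk,
    [z <> zeta], its argument stays in the right half-plane, where [Clog] is holomorphic; so one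
    branch serves the whole disk and the rest of the circle. *)
Definition clog_at (t : R) (z : C) : C := Clog (1 - z * cis (- t)).
Definition arc_angle (z : C) (t : R) : R := Im (clog_at t z).

Lemma Re_clog_at_pos (z : C) (t : R) : Cmod z <= 1 -> z <> cis t -> 0 < Re (1 - z * cis (- t)).
Proof. intros Hz Hne. rewrite <- cis_conj. apply Re_Cmod_lt; auto. apply Cmod_cis. Qed.

Lemma wirt_clog_at (z : C) (t : R) : Cmod z <= 1 -> z <> cis t ->
  wirt (clog_at t) z (- / (cis t - z))%C 0.
Proof.
  intros Hz Hne. assert (Hp := Re_clog_at_pos z t Hz Hne).
  assert (H1 := wirt_minus _ _ _ _ _ _ _ (wirt_const (RtoC 1) z) (wirt_scal (cis (- t)) _ _ _ _ (wirt_id z))).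
  assert (H2 := wirt_comp (fun w => 1 - cis (- t) * w)%C Clog z _ _ (/ (1 - cis (- t) * z))%C 0 H1).
  assert (Hne' : (cis t - z)%C <> RtoC 0).
  { intros H. apply Hne. replace z with (cis t - (cis t - z))%C by ring. rewrite H. ring. }
  assert (Hne2 := Re_pos_neq_0 _ Hp).
  eapply wirt_eq.
  - apply (wirt_ext_loc (fun w => Clog (1 - cis (- t) * w))).
    + apply filter_forall. intros w. unfold clog_at. f_equal. ring.
    + apply H2. apply wirt_Clog. rewrite Cmult_comm. exact Hp.
  - cbv beta.
    replace (cis t - z)%C with (cis t * (1 - cis (- t) * z))%C.
    2: { transitivity (cis t - (cis t * cis (- t)) * z)%C. ring. rewrite cis_opp_mult. ring. }
    replace (cis (- t)) with (/ cis t)%C.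
    2: { rewrite <- (Cmult_1_l (/ cis t)), <- (cis_opp_mult t). field. apply cis_neq_0. }
    assert (1 - / cis t * z <> 0)%C.
    { replace (/ cis t)%C with (cis (- t)). rewrite Cmult_comm. exact Hne2.
      rewrite <- (Cmult_1_l (/ cis t)), <- (cis_opp_mult t). field. apply cis_neq_0. }
    rewrite !Cminus_conj.
    replace (Cconj 0) with (RtoC 0) by (apply C_ext; cbn; ring).
    field; repeat split; try apply cis_neq_0; try assumption.
  - ring.
Qed.

(** The Poisson kernel is [1 + 2 Re (z / (zeta - z))] with [zeta = cis t], and the logarithm of
    [1 - z / zeta] has [t]-derivative [i z / (zeta - z)]. Hence the Poisson integral of a step
    function is elementary. *)
Lemma is_derive_arc_angle (z : C) (t : R) : Cmod z < 1 ->
  is_derive (arc_angle z) t ((poisson_kernel z t - 1) / 2).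
Proof.
  intros Hz. assert (Hne := disk_neq_cis z t Hz).
  assert (Hp := Re_clog_at_pos z t (Rlt_le _ _ Hz) Hne).
  assert (H0 : @is_derive R_AbsRing C_R_NormedModule (fun s => 1 - z * cis (- s))%C t (z * Ci * cis (- t))%C).
  { apply is_derive_C. split; cbn; auto_derive; trivial; ring. }
  assert (H1 := wirt_along Clog (fun s => 1 - z * cis (- s))%C t _ _ _ (wirt_Clog _ Hp) H0).
  apply is_derive_C in H1. destruct H1 as [_ H1].
  refine (eq_ind _ (fun l => is_derive (arc_angle z) t l) H1 _ _).
  unfold poisson_kernel.
  assert (Hm : forall w, Cmod w ^ 2 = Re w ^ 2 + Im w ^ 2) by apply Cmod2_alt.
  rewrite !Hm. fold (cis t).
  assert (Hc := sin2_cos2 t). unfold Rsqr in Hc.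
  assert (Hne2 : 0 < (cos t - Re z) ^ 2 + (sin t - Im z) ^ 2).
  { assert (Hq : 0 < Cmod (cis t - z)).
    { apply Cmod_gt_0. intros E. apply Hne. replace z with (cis t - (cis t - z))%C by ring. rewrite E. ring. }
    assert (Hq2 : 0 < Cmod (cis t - z) ^ 2) by nra. rewrite Hm in Hq2. exact Hq2. }
  clear - Hc Hne2 Hp. destruct z as [x y]. unfold cis in *. cbn in *.
  rewrite !cos_neg, !sin_neg in *.
  set (c := cos t) in *. set (s := sin t) in *.
  assert (E : (1 + - (x * c - y * - s)) ^ 2 + (0 + - (x * - s + y * c)) ^ 2 = (c - x) ^ 2 + (s - y) ^ 2) by nra.
  field_simplify_eq.
  2: { repeat split; nra. }
  assert (Hs : s ^ 2 = 1 - c * c) by (cbn; lra). ring [Hs].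
Qed.

(* The harmonic measure at [z] of the arc from [cis a] to [cis b]. *)
Definition arc_measure (z : C) (a b : R) : R :=
  ((b - a) + 2 * (arc_angle z b - arc_angle z a)) / (2 * PI).

Lemma cis_opp_unique (a b : R) : cis a = cis b -> cis (- a) = cis (- b).
Proof. intros H. rewrite <- !cis_conj, H. reflexivity. Qed.

Lemma arc_angle_cis (z : C) (a b : R) : cis a = cis b -> arc_angle z a = arc_angle z b.
Proof. intros H. unfold arc_angle, clog_at. rewrite (cis_opp_unique a b H). reflexivity. Qed.

Lemma arc_angle_rot (z : C) (s a : R) : arc_angle (z * cis s)%C (a + s) = arc_angle z a.
Proof.
  unfold arc_angle, clog_at. do 3 f_equal.
  replace (- (a + s)) with (- a + - s) by ring. rewrite cis_plus.
  transitivity (z * cis (- a) * (cis s * cis (- s)))%C. ring. rewrite cis_opp_mult. ring.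
Qed.

Lemma arc_measure_rot (z : C) (s a b : R) :
  arc_measure (z * cis s)%C (a + s) (b + s) = arc_measure z a b.
Proof. unfold arc_measure. rewrite !arc_angle_rot. f_equal. ring. Qed.

Lemma arc_measure_period (z : C) (a b : R) :
  arc_measure z (a + 2 * PI) (b + 2 * PI) = arc_measure z a b.
Proof.
  unfold arc_measure. rewrite !(arc_angle_cis z (_ + 2 * PI) _ (cis_2PI _)). f_equal. ring.
Qed.

Lemma arc_measure_circle (z : C) (a : R) : arc_measure z a (a + 2 * PI) = 1.
Proof.
  unfold arc_measure. rewrite !(arc_angle_cis z (_ + 2 * PI) _ (cis_2PI _)).
  assert (H := PI_RGT_0). field. lra.
Qed.

Lemma arc_measure_add (z : C) (a b c : R) :
  arc_measure z a b + arc_measure z b c = arc_measure z a c.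
Proof. unfold arc_measure. assert (H := PI_RGT_0). field. lra. Qed.

Lemma poisson_kernel_pos (z : C) (t : R) : Cmod z < 1 -> 0 < poisson_kernel z t.
Proof.
  intros Hz. unfold poisson_kernel. assert (H0 := Cmod_ge_0 z).
  assert (0 < Cmod ((cos t, sin t) - z)).
  { apply Cmod_gt_0. intros E. apply (disk_neq_cis z t Hz). unfold cis.
    replace z with ((cos t, sin t) - ((cos t, sin t) - z))%C by ring. rewrite E. ring. }
  apply Rdiv_lt_0_compat; nra.
Qed.

Lemma is_derive_arc_primitive (z : C) (t : R) : Cmod z < 1 ->
  is_derive (fun u => u + 2 * arc_angle z u) t (poisson_kernel z t).
Proof.
  intros Hz. assert (H := is_derive_arc_angle z t Hz).
  replace (poisson_kernel z t) with (1 + 2 * ((poisson_kernel z t - 1) / 2)) by field.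
  apply (is_derive_plus (K := R_AbsRing) (V := R_NormedModule) (fun u => u) (fun u => 2 * arc_angle z u) t 1
    (2 * ((poisson_kernel z t - 1) / 2))).
  - apply (is_derive_id (K := R_AbsRing)).
  - apply is_derive_scal. exact H.
Qed.

Lemma arc_measure_pos (z : C) (a b : R) : Cmod z < 1 -> a < b -> 0 < arc_measure z a b.
Proof.
  intros Hz Hab. unfold arc_measure.
  destruct (MVT_gen (fun t => t + 2 * arc_angle z t) a b (fun t => poisson_kernel z t)) as [c [_ Hc]].
  - intros x _. exact (is_derive_arc_primitive z x Hz).
  - intros x _. apply continuity_pt_filterlim.
    apply (ex_derive_continuous (V := R_NormedModule) (fun u => u + 2 * arc_angle z u)). eexists. exact (is_derive_arc_primitive z x Hz).
  - assert (Hp := poisson_kernel_pos z c Hz). assert (Hpi := PI_RGT_0).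
    apply Rdiv_lt_0_compat; nra.
Qed.

Lemma continuous_poisson_kernel (z : C) (t : R) : Cmod z < 1 -> continuous (poisson_kernel z) t.
Proof.
  intros Hz.
  assert (Hne : (cis t - z)%C <> RtoC 0).
  { intros E. apply (disk_neq_cis z t Hz). 
    replace z with (cis t - (cis t - z))%C by ring. rewrite E. ring. }
  assert (Hd : Cmod (cis t - z) ^ 2 <> 0) by (apply pow_nonzero; apply Rgt_not_eq, Cmod_gt_0, Hne).
  apply (continuous_ext (fun s => (1 - Cmod z ^ 2) / ((cos s - Re z) ^ 2 + (sin s - Im z) ^ 2))).
  - intros s. unfold poisson_kernel. rewrite (Cmod2_alt ((cos s, sin s) - z)). reflexivity.
  - apply (ex_derive_continuous (V := R_NormedModule)). auto_derive. rewrite Cmod2_alt in Hd. exact Hd.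
Qed.

Lemma is_RInt_poisson (z c : C) (a b : R) : Cmod z < 1 ->
  @is_RInt C_R_NormedModule (fun t => RtoC (poisson_kernel z t) * c)%C a b
    (RtoC (2 * PI * arc_measure z a b) * c)%C.
Proof.
  intros Hz. assert (Hpi := PI_RGT_0).
  assert (H : is_RInt (poisson_kernel z) a b (2 * PI * arc_measure z a b)).
  { replace (2 * PI * arc_measure z a b)
      with (minus ((fun t => t + 2 * arc_angle z t) b) ((fun t => t + 2 * arc_angle z t) a)).
    2: { unfold arc_measure, minus, plus, opp; cbn. field. lra. }
    apply (is_RInt_derive (V := R_CompleteNormedModule) (fun t => t + 2 * arc_angle z t)).
    - intros x _. exact (is_derive_arc_primitive z x Hz).
    - intros x _. apply continuous_poisson_kernel, Hz. }
  assert (H1 := is_RInt_scal _ _ _ (Re c) _ H).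
  assert (H2 := is_RInt_scal _ _ _ (Im c) _ H).
  assert (H3 := is_RInt_fct_extend_pair (U := R_NormedModule) (V := R_NormedModule)
    (fun t => RtoC (poisson_kernel z t) * c)%C a b
    (Re c * (2 * PI * arc_measure z a b)) (Im c * (2 * PI * arc_measure z a b))).
  replace (RtoC (2 * PI * arc_measure z a b) * c)%C
    with ((Re c * (2 * PI * arc_measure z a b), Im c * (2 * PI * arc_measure z a b)) : C).
  2: { generalize (2 * PI * arc_measure z a b); intros m. apply C_ext; cbn; unfold Re, Im; ring. }
  apply H3.
  - revert H1. apply is_RInt_ext. intros x _. generalize (poisson_kernel z x); intros k.
    unfold scal; cbn. unfold mult; cbn. unfold Re, Im. ring.
  - revert H2. apply is_RInt_ext. intros x _. generalize (poisson_kernel z x); intros k.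
    unfold scal; cbn. unfold mult; cbn. unfold Re, Im. ring.
Qed.

(* The harmonic extension of the step function with values [v1], [v2], [v3], [v4] on the
   successive arcs of lengths [s], [PI - s], [s], [PI - s] starting at angle [t]. *)
Definition step_extension (t s : R) (v1 v2 v3 v4 z : C) : C :=
  (RtoC (arc_measure z t (t + s)) * v1 + RtoC (arc_measure z (t + s) (t + PI)) * v2 +
   RtoC (arc_measure z (t + PI) (t + PI + s)) * v3 +
   RtoC (arc_measure z (t + PI + s) (t + 2 * PI)) * v4)%C.

Lemma poisson_extension_step (b1 b2 b3 b4 : C) (p : R) (z : C) :
  0 < p < PI -> Cmod z < 1 ->
  poisson_extension (boundary_step b1 b2 b3 b4 p) z = step_extension 0 p b4 b1 b2 b3 z.
Proof.
  intros Hp Hz. unfold poisson_extension, step_extension. rewrite !Rplus_0_l.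
  assert (Hext : forall a b c, a <= b -> (forall t, a < t < b -> boundary_step b1 b2 b3 b4 p t = c) ->
    @is_RInt C_R_NormedModule
      (fun t => RtoC (poisson_kernel z t) * boundary_step b1 b2 b3 b4 p t)%C a b
      (RtoC (2 * PI * arc_measure z a b) * c)%C).
  { intros a b c Hab Hc. apply (is_RInt_ext (V := C_R_NormedModule) (fun t => RtoC (poisson_kernel z t) * c)%C).
    - rewrite Rmin_left, Rmax_right by exact Hab. intros t Ht. rewrite Hc; auto.
    - apply is_RInt_poisson, Hz. }
  assert (H1 := Hext 0 p b4 ltac:(lra)). assert (H2 := Hext p PI b1 ltac:(lra)).
  assert (H3 := Hext PI (PI + p) b2 ltac:(lra)). assert (H4 := Hext (PI + p) (2 * PI) b3 ltac:(lra)).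
  assert (Hcase : forall t, boundary_step b1 b2 b3 b4 p t =
    if Rlt_dec t p then b4 else if Rlt_dec t PI then b1 else if Rlt_dec t (PI + p) then b2 else b3) by reflexivity.
  specialize (H1 ltac:(intros t Ht; rewrite Hcase; destruct (Rlt_dec t p); [reflexivity | lra])).
  specialize (H2 ltac:(intros t Ht; rewrite Hcase; destruct (Rlt_dec t p); [lra |];
    destruct (Rlt_dec t PI); [reflexivity | lra])).
  specialize (H3 ltac:(intros t Ht; rewrite Hcase; destruct (Rlt_dec t p); [lra |];
    destruct (Rlt_dec t PI); [lra |]; destruct (Rlt_dec t (PI + p)); [reflexivity | lra])).
  specialize (H4 ltac:(intros t Ht; rewrite Hcase; destruct (Rlt_dec t p); [lra |];
    destruct (Rlt_dec t PI); [lra |]; destruct (Rlt_dec t (PI + p)); [lra | reflexivity])).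
  assert (H := is_RInt_Chasles _ _ _ _ _ _ (is_RInt_Chasles _ _ _ _ _ _ (is_RInt_Chasles _ _ _ _ _ _ H1 H2) H3) H4).
  rewrite (is_RInt_unique (V := C_R_CompleteNormedModule) _ _ _ _ H).
  assert (Hpi := PI_RGT_0).
  apply C_ext; cbn; field; lra.
Qed.

(** Moving the starting point by one arc exchanges [s] and [PI - s]. By this symmetry facts about
    one side, one jump or one diagonal are proved once and transported to the others. *)
Lemma step_extension_cycle (t s : R) (v1 v2 v3 v4 z : C) :
  step_extension t s v1 v2 v3 v4 z = step_extension (t + s) (PI - s) v2 v3 v4 v1 z.
Proof.
  unfold step_extension.
  replace (t + s + (PI - s)) with (t + PI) by ring.
  replace (t + s + PI) with (t + PI + s) by ring.
  replace (t + PI + s + (PI - s)) with (t + 2 * PI) by ring.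
  replace (t + s + 2 * PI) with ((t + s) + 2 * PI) by ring.
  rewrite arc_measure_period. ring.
Qed.

Lemma step_extension_rot (t s u : R) (v1 v2 v3 v4 z : C) :
  step_extension (t + u) s v1 v2 v3 v4 (z * cis u)%C = step_extension t s v1 v2 v3 v4 z.
Proof.
  unfold step_extension.
  replace (t + u + s) with (t + s + u) by ring. replace (t + u + PI) with (t + PI + u) by ring.
  replace (t + PI + u + s) with (t + PI + s + u) by ring. replace (t + u + 2 * PI) with (t + 2 * PI + u) by ring.
  rewrite !arc_measure_rot. reflexivity.
Qed.

Lemma arc_measure_sum (t s : R) (z : C) :
  arc_measure z t (t + s) + arc_measure z (t + s) (t + PI) + arc_measure z (t + PI) (t + PI + s) +
  arc_measure z (t + PI + s) (t + 2 * PI) = 1.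
Proof. rewrite !arc_measure_add. apply arc_measure_circle. Qed.

(** The four weights sum to [1], so the extension commutes with affine maps of the target. *)
Lemma step_extension_affine (t s : R) (v1 v2 v3 v4 k l z : C) :
  (k * (step_extension t s v1 v2 v3 v4 z - l) =
   step_extension t s (k * (v1 - l)) (k * (v2 - l)) (k * (v3 - l)) (k * (v4 - l)) z)%C.
Proof.
  transitivity (k * (step_extension t s v1 v2 v3 v4 z - l * RtoC
    (arc_measure z t (t + s) + arc_measure z (t + s) (t + PI) + arc_measure z (t + PI) (t + PI + s) +
     arc_measure z (t + PI + s) (t + 2 * PI))))%C.
  - rewrite arc_measure_sum. ring.
  - unfold step_extension. rewrite !RtoC_plus. ring.
Qed.

(** * Boundary values, cluster sets and properness *)

Lemma arc_angle_boundary (u b : R) : 0 < u - b < 2 * PI -> arc_angle (cis u) b = (u - b - PI) / 2.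
Proof.
  intros H. unfold arc_angle, clog_at. rewrite <- cis_plus. unfold Clog; cbn.
  (* [1 - exp (2 i x) = 2 sin x exp (i (x - PI / 2))] with [x = (u - b) / 2], and the argument
     [x - PI / 2] is within the range of [atan]. *)
  replace (u + - b) with (2 * ((u - b) / 2)) by field.
  set (x := (u - b) / 2). assert (Hx : 0 < x < PI) by (unfold x; lra).
  assert (Hs : 0 < sin x) by (apply sin_gt_0; lra).
  assert (Hc := sin2_cos2 x). unfold Rsqr in Hc.
  rewrite sin_2a, cos_2a.
  replace ((u - b - PI) / 2) with (x - PI / 2) by (unfold x; field).
  rewrite <- (atan_tan (x - PI / 2)) by lra. f_equal.
  unfold tan. replace (x - PI / 2) with (- (PI / 2 - x)) by ring.
  rewrite sin_neg, cos_neg, sin_shift, cos_shift.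
  replace (1 + - (cos x * cos x - sin x * sin x)) with (2 * sin x * sin x) by lra.
  field. lra.
Qed.

Lemma arc_measure_boundary (u a b : R) : b < u < a + 2 * PI -> a < b -> arc_measure (cis u) a b = 0.
Proof.
  intros Hu Hab. unfold arc_measure. rewrite !arc_angle_boundary by lra.
  assert (H := PI_RGT_0). field. lra.
Qed.

Lemma continuous_arc_angle (z : C) (t : R) : Cmod z <= 1 -> z <> cis t ->
  continuous (fun w => arc_angle w t) z.
Proof.
  intros Hz Hne. apply (continuous_comp (U := C_UniformSpace) (V := C_UniformSpace) (W := R_UniformSpace) (clog_at t) (@snd R R)).
  - eapply wirt_continuous. apply wirt_clog_at; assumption.
  - apply continuous_snd.
Qed.

Lemma cis_neq (u b : R) : 0 < u - b < 2 * PI -> cis u <> cis b.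
Proof.
  intros H E.
  assert (E1 : cis (u - b) = RtoC 1).
  { unfold Rminus. rewrite cis_plus, E. apply cis_opp_mult. }
  assert (Hc : cos (u - b) = 1) by (change (Re (cis (u - b)) = 1); rewrite E1; reflexivity).
  replace (u - b) with (2 * ((u - b) / 2)) in Hc by field.
  rewrite cos_2a_sin in Hc.
  assert (0 < sin ((u - b) / 2)) by (apply sin_gt_0; lra). nra.
Qed.

Lemma arc_measure_small (u a b eps : R) : b < u < a + 2 * PI -> a < b -> 0 < eps ->
  exists d, 0 < d /\ forall z, Cmod (z - cis u) < d -> arc_measure z a b < eps.
Proof.
  intros Hu Hab He.
  assert (Hc : continuous (fun z => arc_measure z a b) (cis u)).
  { unfold arc_measure, Rdiv.
    apply (continuous_mult (U := C_UniformSpace) (K := R_AbsRing)). 2: apply continuous_const.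
    apply (continuous_plus (U := C_UniformSpace) (V := R_NormedModule)). apply continuous_const.
    apply (continuous_mult (U := C_UniformSpace) (K := R_AbsRing)). apply continuous_const.
    apply (continuous_minus (U := C_UniformSpace) (V := R_NormedModule));
      apply continuous_arc_angle; try (rewrite Cmod_cis; lra); apply cis_neq; lra. }
  assert (H0 := arc_measure_boundary u a b Hu Hab).
  assert (H1 := Hc (fun y => y < eps)). cbv beta in H1. rewrite H0 in H1.
  assert (H2 : locally 0 (fun y => y < eps)) by (apply (open_lt eps); exact He).
  specialize (H1 H2). apply locally_Cmod in H1. exact H1.
Qed.

Lemma cis_surj (z : C) (t : R) : Cmod z = 1 -> exists u, t < u <= t + 2 * PI /\ cis u = z.
Proof.
  intros Hz. assert (Hpi := PI_RGT_0).
  assert (H : exists u, 0 < u <= 2 * PI /\ cis u = (z * cis (- t))%C).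
  { assert (Hw : Cmod (z * cis (- t)) = 1) by (rewrite Cmod_mult, Hz, Cmod_cis; ring).
    revert Hw. generalize (z * cis (- t))%C. intros w Hw.
    assert (H1 := Cmod2_alt w). rewrite Hw in H1.
    assert (Hb : -1 <= Re w <= 1) by nra.
    assert (Hsin : sin (acos (Re w)) = Rabs (Im w)).
    { rewrite sin_acos by exact Hb. rewrite <- sqrt_Rsqr_abs. f_equal. unfold Rsqr. nra. }
    assert (Hac := acos_bound (Re w)).
    destruct (Rlt_le_dec 0 (Im w)) as [Hi|Hi].
    - exists (acos (Re w)). split.
      + split; [|lra]. destruct (Rlt_le_dec 0 (acos (Re w))) as [|Ha]; [assumption|].
        replace (acos (Re w)) with 0 in Hsin by lra. rewrite sin_0, Rabs_pos_eq in Hsin; lra.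
      + apply C_ext; cbn. apply cos_acos, Hb. rewrite Hsin. apply Rabs_pos_eq; lra.
    - exists (- acos (Re w) + 2 * PI). split.
      + split; [lra|]. lra.
      + rewrite cis_2PI. apply C_ext; cbn. rewrite cos_neg. apply cos_acos, Hb.
        rewrite sin_neg, Hsin, Rabs_left1; lra. }
  destruct H as [u [Hu E]]. exists (t + u). split. lra.
  rewrite cis_plus, E. transitivity (z * (cis t * cis (- t)))%C. ring. rewrite cis_opp_mult. ring.
Qed.

Lemma closed_segment_dist (a b z : C) : ~ closed_segment a b z ->
  exists e, 0 < e /\ forall w, closed_segment a b w -> e <= Cmod (z - w).
Proof.
  intros H.
  set (D := fun t => (Re z - ((1 - t) * Re a + t * Re b)) ^ 2 + (Im z - ((1 - t) * Im a + t * Im b)) ^ 2).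
  assert (HD : forall t, D t = Cmod (z - ((1 - t)%R * a + t * b)) ^ 2).
  { intros t. rewrite Cmod2_alt. unfold D. destruct z, a, b; cbn; ring. }
  destruct (continuity_ab_min D 0 1) as [t0 [Hmin Ht0]]. lra.
  { intros t _. apply continuity_pt_filterlim. apply (ex_derive_continuous (V := R_NormedModule) D).
    unfold D. auto_derive. trivial. }
  exists (Cmod (z - ((1 - t0)%R * a + t0 * b))). split.
  - apply Cmod_gt_0. intros E. apply H. exists t0. split. exact Ht0.
    replace z with (z - ((1 - t0)%R * a + t0 * b) + ((1 - t0)%R * a + t0 * b))%C by ring.
    rewrite E. ring.
  - intros w [t [Ht ->]]. specialize (Hmin t Ht). rewrite !HD in Hmin.
    apply Rsqr_incr_0; unfold Rsqr; try apply Cmod_ge_0. nra.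
Qed.

(* The cluster set of [F] at [z0] lies in the closure of [S]. *)
Definition cluster_in (F : C -> C) (z0 : C) (S : C -> Prop) : Prop :=
  forall eps, 0 < eps -> exists d, 0 < d /\ forall z, Cmod z < 1 -> Cmod (z - z0) < d ->
    exists w, S w /\ Cmod (F z - w) < eps.

(** The arcs carrying [v3] and [v4] stay away from [cis u], so their harmonic measures are small
    near it and the value is almost a convex combination of [v1] and [v2]. The range of [u] contains
    the jump [t + s], which is where a whole side is needed rather than a vertex. *)
Lemma cluster_in_step (t s u : R) (v1 v2 v3 v4 : C) : 0 < s < PI -> t < u < t + PI ->
  cluster_in (step_extension t s v1 v2 v3 v4) (cis u) (closed_segment v1 v2).
Proof.
  intros Hs Hu eps He.
  set (M := Cmod (v3 - v1) + Cmod (v4 - v1) + 1).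
  assert (H3 := Cmod_ge_0 (v3 - v1)). assert (H4 := Cmod_ge_0 (v4 - v1)).
  assert (HM : 0 < M) by (unfold M; lra).
  assert (He' : 0 < eps / M) by (apply Rdiv_lt_0_compat; lra).
  (* [arc_measure_small] wants the angle of the point to lie beyond the end of the arc, so [u] is
     taken one turn later. *)
  assert (Hu' : cis u = cis (u + 2 * PI)) by (symmetry; apply cis_2PI).
  destruct (arc_measure_small (u + 2 * PI) (t + PI) (t + PI + s) (eps / M)) as [d3 [Hd3 P3]]; [lra|lra|lra|].
  destruct (arc_measure_small (u + 2 * PI) (t + PI + s) (t + 2 * PI) (eps / M)) as [d4 [Hd4 P4]]; [lra|lra|lra|].
  exists (Rmin d3 d4). split. apply Rmin_pos; lra.
  intros z Hz Hzu. rewrite Hu' in Hzu.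
  specialize (P3 z ltac:(eapply Rlt_le_trans; [exact Hzu | apply Rmin_l])).
  specialize (P4 z ltac:(eapply Rlt_le_trans; [exact Hzu | apply Rmin_r])).
  assert (Hsum := arc_measure_sum t s z).
  assert (Q1 := arc_measure_pos z t (t + s) Hz ltac:(lra)).
  assert (Q2 := arc_measure_pos z (t + s) (t + PI) Hz ltac:(lra)).
  assert (Q3 := arc_measure_pos z (t + PI) (t + PI + s) Hz ltac:(lra)).
  assert (Q4 := arc_measure_pos z (t + PI + s) (t + 2 * PI) Hz ltac:(lra)).
  unfold step_extension.
  set (w1 := arc_measure z t (t + s)) in *. set (w2 := arc_measure z (t + s) (t + PI)) in *.
  set (w3 := arc_measure z (t + PI) (t + PI + s)) in *.
  set (w4 := arc_measure z (t + PI + s) (t + 2 * PI)) in *.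
  exists ((1 - w2)%R * v1 + w2 * v2)%C. split.
  - exists w2. split. lra. reflexivity.
  - replace (w1 * v1 + w2 * v2 + w3 * v3 + w4 * v4 - ((1 - w2)%R * v1 + w2 * v2))%C
      with (w3 * (v3 - v1) + w4 * (v4 - v1))%C.
    2: { replace w1 with (1 - w2 - w3 - w4) by lra. rewrite !RtoC_minus. ring. }
    eapply Rle_lt_trans. apply Cmod_triangle. rewrite !Cmod_mult, !Cmod_R, !Rabs_pos_eq by lra.
    apply Rle_lt_trans with (eps / M * (Cmod (v3 - v1) + Cmod (v4 - v1))).
    + rewrite Rmult_plus_distr_l. apply Rplus_le_compat; apply Rmult_le_compat_r; lra.
    + replace eps with (eps / M * M) at 2 by (field; lra). apply Rmult_lt_compat_l. exact He'. unfold M; lra.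
Qed.

Lemma cluster_in_ext (F G : C -> C) (z0 : C) (S : C -> Prop) :
  (forall z, F z = G z) -> cluster_in F z0 S -> cluster_in G z0 S.
Proof.
  intros HFG H eps He. destruct (H eps He) as [d [Hd H']]. exists d. split. exact Hd.
  intros z Hz Hzz. rewrite <- HFG. apply H'; assumption.
Qed.

Lemma cluster_in_step_2 (t s u : R) (v1 v2 v3 v4 : C) : 0 < s < PI -> t + s < u < t + s + PI ->
  cluster_in (step_extension t s v1 v2 v3 v4) (cis u) (closed_segment v2 v3).
Proof.
  intros Hs Hu. apply (cluster_in_ext (step_extension (t + s) (PI - s) v2 v3 v4 v1)).
  - intros z. symmetry. apply step_extension_cycle.
  - apply cluster_in_step; lra.
Qed.

Lemma cluster_in_step_3 (t s u : R) (v1 v2 v3 v4 : C) : 0 < s < PI -> t + PI < u < t + 2 * PI ->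
  cluster_in (step_extension t s v1 v2 v3 v4) (cis u) (closed_segment v3 v4).
Proof.
  intros Hs Hu. apply (cluster_in_ext (step_extension (t + s) (PI - s) v2 v3 v4 v1)).
  - intros z. symmetry. apply step_extension_cycle.
  - apply cluster_in_step_2; lra.
Qed.

Lemma cluster_in_step_4 (t s u : R) (v1 v2 v3 v4 : C) : 0 < s < PI -> t + PI + s < u < t + 2 * PI + s ->
  cluster_in (step_extension t s v1 v2 v3 v4) (cis u) (closed_segment v4 v1).
Proof.
  intros Hs Hu. apply (cluster_in_ext (step_extension (t + s) (PI - s) v2 v3 v4 v1)).
  - intros z. symmetry. apply step_extension_cycle.
  - apply cluster_in_step_3; lra.
Qed.

Lemma cluster_in_sides (t s : R) (v1 v2 v3 v4 z0 : C) : 0 < s < PI -> Cmod z0 = 1 ->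
  exists a b, (forall w, closed_segment a b w -> on_sides v1 v2 v3 v4 w) /\
    cluster_in (step_extension t s v1 v2 v3 v4) z0 (closed_segment a b).
Proof.
  intros Hs Hz. destruct (cis_surj z0 t Hz) as [u [Hu <-]]. assert (Hpi := PI_RGT_0).
  destruct (Rlt_le_dec u (t + PI)) as [H1|H1].
  { exists v1, v2. split. unfold on_sides; auto. apply cluster_in_step; lra. }
  destruct (Req_dec u (t + PI)) as [H2|H2].
  { exists v2, v3. split. unfold on_sides; auto. apply cluster_in_step_2; lra. }
  destruct (Rlt_le_dec u (t + 2 * PI)) as [H3|H3].
  { exists v3, v4. split. unfold on_sides; auto. apply cluster_in_step_3; lra. }
  exists v4, v1. split. unfold on_sides; auto. apply cluster_in_step_4; lra.
Qed.

(** Points of the open arcs carrying [v1] and [v2] are covered by the neighbouring sides as well,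
    since the boundary value there is a vertex. Only the jump between these two arcs requires the
    side [v1 v2], so no other boundary point can lie over the open side. *)
Lemma cluster_in_other_sides (t s : R) (v1 v2 v3 v4 z0 : C) : 0 < s < PI -> Cmod z0 = 1 ->
  z0 <> cis (t + s) ->
  cluster_in (step_extension t s v1 v2 v3 v4) z0 (closed_segment v2 v3) \/
  cluster_in (step_extension t s v1 v2 v3 v4) z0 (closed_segment v3 v4) \/
  cluster_in (step_extension t s v1 v2 v3 v4) z0 (closed_segment v4 v1).
Proof.
  intros Hs Hz Hne. destruct (cis_surj z0 (t + s) Hz) as [u [Hu <-]]. assert (Hpi := PI_RGT_0).
  assert (Hu2 : u <> t + s + 2 * PI) by (intros ->; apply Hne, cis_2PI).
  destruct (Rlt_le_dec u (t + s + PI)) as [H1|H1].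
  { left. apply cluster_in_step_2; lra. }
  destruct (Req_dec u (t + s + PI)) as [H2|H2].
  { right; left. apply cluster_in_step_3; lra. }
  right; right. apply cluster_in_step_4; lra.
Qed.

Lemma near_boundary_uniform (F : C -> C) (S : C -> Prop) :
  (forall z0, Cmod z0 = 1 -> cluster_in F z0 S) ->
  forall eps, 0 < eps -> exists d, 0 < d /\ forall z, Cmod z < 1 -> 1 - d < Cmod z ->
    exists w, S w /\ Cmod (F z - w) < eps.
Proof.
  intros H eps He.
  destruct (closed_disk_compact (fun z e => Cmod z < 1 -> 1 - e < Cmod z -> exists w, S w /\ Cmod (F z - w) < eps))
    as [d [Hd H']].
  - intros z e e' Hee HP Hz Hz'. apply HP; lra.
  - intros z0 Hz0. destruct (Req_dec (Cmod z0) 1) as [E|E].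
    + destruct (H z0 E eps He) as [d [Hd H']]. exists d. split. exact Hd.
      intros z Hzz _ Hz _. apply H'; assumption.
    + exists ((1 - Cmod z0) / 2). split. lra. intros z Hzz _ _ Hz1. exfalso.
      assert (Ht := Cmod_triangle z0 (z - z0)). replace (z0 + (z - z0))%C with z in Ht by ring. lra.
  - exists d. split. exact Hd. intros z Hz. apply H'; lra.
Qed.

(** Away from [z0] the values of [F] keep a positive distance from [w0]: inside the disk because
    [w0] is not attained there, at the circle because of the cluster sets; compactness makes the
    distance uniform. The point [z0] may be the preimage of [w0], which gives continuity of the
    inverse, or a point of the circle when [w0] lies on an open side and has no preimage, which
    locates the blow-up. *)
Lemma proper_inverse (F : C -> C) (z0 w0 : C) :
  (forall z, Cmod z < 1 -> continuous F z) ->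
  (forall z, Cmod z < 1 -> F z = w0 -> z = z0) ->
  (forall z, Cmod z = 1 -> z <> z0 ->
     exists a b, ~ closed_segment a b w0 /\ cluster_in F z (closed_segment a b)) ->
  forall eps, 0 < eps -> exists d, 0 < d /\ forall z, Cmod z < 1 -> Cmod (F z - w0) < d -> Cmod (z - z0) < eps.
Proof.
  intros Hc Hi Hb eps He.
  destruct (closed_disk_compact (fun z e => Cmod z < 1 -> Cmod (F z - w0) < e -> Cmod (z - z0) < eps))
    as [d [Hd H']].
  - intros z e e' Hee HP Hz Hz'. apply HP; lra.
  - intros z1 Hz1. destruct (Ceq_dec z1 z0) as [->|Hne].
    { exists eps. split. exact He. intros z Hz _ _ _. exact Hz. }
    destruct (Rle_lt_or_eq_dec _ _ Hz1) as [H1|H1].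
    + assert (Hr : 0 < Cmod (F z1 - w0)).
      { apply Cmod_gt_0. intros E. apply Hne, Hi. exact H1.
        replace (F z1) with ((F z1 - w0) + w0)%C by ring. rewrite E. ring. }
      assert (HL : @locally C_UniformSpace z1 (fun z => Cmod (F z - F z1) < Cmod (F z1 - w0) / 2)).
      { apply (Hc z1 H1 (fun y => Cmod (y - F z1) < Cmod (F z1 - w0) / 2)). apply locally_Cmod.
        exists (Cmod (F z1 - w0) / 2). split. lra. auto. }
      apply locally_Cmod in HL. destruct HL as [d [Hd HL]].
      exists (Rmin d (Cmod (F z1 - w0) / 2)). split. apply Rmin_pos; lra.
      intros z Hz _ _ Hz2. exfalso.
      specialize (HL z ltac:(eapply Rlt_le_trans; [exact Hz | apply Rmin_l])).
      assert (Hz3 := Rlt_le_trans _ _ _ Hz2 (Rmin_r _ _)).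
      assert (Ht := Cmod_triangle (F z - w0) (- (F z - F z1))).
      rewrite Cmod_opp in Ht. replace (F z - w0 + - (F z - F z1))%C with (F z1 - w0)%C in Ht by ring. lra.
    + destruct (Hb z1 H1 Hne) as [a [b [Hab Hcl]]].
      destruct (closed_segment_dist a b w0 Hab) as [e [He' Hdist]].
      destruct (Hcl (e / 2)) as [d [Hd Hcl']]. lra.
      exists (Rmin d (e / 2)). split. apply Rmin_pos; lra.
      intros z Hz _ Hz1' Hz2. exfalso.
      destruct (Hcl' z Hz1') as [w [Hw1 Hw2]]. eapply Rlt_le_trans; [exact Hz | apply Rmin_l].
      specialize (Hdist w Hw1). assert (Hz3 := Rlt_le_trans _ _ _ Hz2 (Rmin_r _ _)).
      assert (Ht := Cmod_triangle (- (F z - w0)) (F z - w)). rewrite Cmod_opp in Ht.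
      replace (- (F z - w0) + (F z - w))%C with (w0 - w)%C in Ht by ring. lra.
  - exists d. split. exact Hd. intros z Hz. apply H'; lra.
Qed.

(* For the jumps [j1, ..., j4] of a step function, [cauchy_sum] is the derivative [h'] of the
   analytic part of its harmonic extension, and [log_sum] is a primitive of it. *)
Definition log_sum (t s : R) (c j1 j2 j3 j4 z : C) : C :=
  (c + Ci / RtoC (2 * PI) * (j1 * clog_at t z + j2 * clog_at (t + s) z +
     j3 * clog_at (t + PI) z + j4 * clog_at (t + PI + s) z))%C.

Definition cauchy_sum (t s : R) (j1 j2 j3 j4 z : C) : C :=
  (- Ci / RtoC (2 * PI) * (j1 / (cis t - z) + j2 / (cis (t + s) - z) +
     j3 / (cis (t + PI) - z) + j4 / (cis (t + PI + s) - z)))%C.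

Lemma wirt_log_sum (t s : R) (c j1 j2 j3 j4 z : C) : Cmod z < 1 ->
  wirt (log_sum t s c j1 j2 j3 j4) z (cauchy_sum t s j1 j2 j3 j4 z) 0.
Proof.
  intros Hz.
  assert (H : forall u, wirt (clog_at u) z (- / (cis u - z))%C 0).
  { intros u. apply wirt_clog_at. lra. apply disk_neq_cis, Hz. }
  eapply wirt_eq.
  - unfold log_sum. apply wirt_plus. apply wirt_const. apply wirt_scal.
    apply wirt_plus; [apply wirt_plus; [apply wirt_plus|]|]; apply wirt_scal; apply H.
  - unfold cauchy_sum, Cdiv. ring.
  - ring.
Qed.

(** Summation by parts turns the values on the arcs into the jumps between them, and
    [Im l = (l - conj l) / (2 i)] splits each arc angle into an analytic and an antianalytic half.
    The constant [c] is the mean of the boundary values; it goes into the first summand, so that the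
    second vanishes at [0]. *)
Lemma step_extension_decomp (t s : R) (v1 v2 v3 v4 z : C) :
  let c := ((RtoC s * v1 + RtoC (PI - s) * v2 + RtoC s * v3 + RtoC (PI - s) * v4) / RtoC (2 * PI))%C in
  step_extension t s v1 v2 v3 v4 z =
    (log_sum t s c (v1 - v4) (v2 - v1) (v3 - v2) (v4 - v3) z +
     Cconj (log_sum t s 0 (Cconj (v1 - v4)) (Cconj (v2 - v1)) (Cconj (v3 - v2)) (Cconj (v4 - v3)) z))%C.
Proof.
  intros c. unfold step_extension, arc_measure.
  rewrite (arc_angle_cis z (t + 2 * PI) t (cis_2PI t)).
  assert (Hpi := PI_RGT_0).
  unfold log_sum, arc_angle, c.
  generalize (clog_at t z), (clog_at (t + s) z), (clog_at (t + PI) z), (clog_at (t + PI + s) z).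
  intros l1 l2 l3 l4.
  assert (Him : forall l, RtoC (Im l) = (- Ci / 2 * (l - Cconj l))%C).
  { intros l. apply C_ext; destruct l; cbn; field. }
  assert (Hc1 : Cconj 0 = RtoC 0) by (apply C_ext; cbn; ring).
  assert (Hc2 : Cconj (Ci / RtoC (2 * PI)) = (- Ci / RtoC (2 * PI))%C).
  { apply C_ext; cbn; field; nra. }
  rewrite ?Cplus_conj, ?Cmult_conj, ?Cplus_conj, ?Cmult_conj, ?Cconj_conj, Hc1, Hc2.
  assert (Hp : RtoC PI <> RtoC 0) by (apply RtoC_neq; lra).
  assert (H2 : RtoC 2 <> RtoC 0) by (apply RtoC_neq; lra).
  rewrite ?RtoC_div, ?RtoC_plus, ?RtoC_mult, ?RtoC_minus, ?RtoC_plus, ?RtoC_mult, ?RtoC_minus, ?RtoC_plus, !Him by lra.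
  field; repeat split; assumption.
Qed.

Lemma wirt_step_extension (t s : R) (v1 v2 v3 v4 z : C) : Cmod z < 1 ->
  wirt (step_extension t s v1 v2 v3 v4) z
    (cauchy_sum t s (v1 - v4) (v2 - v1) (v3 - v2) (v4 - v3) z)
    (Cconj (cauchy_sum t s (Cconj (v1 - v4)) (Cconj (v2 - v1)) (Cconj (v3 - v2)) (Cconj (v4 - v3)) z)).
Proof.
  intros Hz. eapply wirt_eq.
  - eapply wirt_ext_loc.
    + apply filter_forall. intros w. symmetry. apply step_extension_decomp.
    + apply wirt_plus. apply wirt_log_sum, Hz. apply wirt_conj, wirt_log_sum, Hz.
  - replace (Cconj 0) with (RtoC 0) by (apply C_ext; cbn; ring). ring.
  - ring.
Qed.

(** * Level curves *)

Definition Cexp (w : C) : C := (RtoC (exp (Re w)) * cis (Im w))%C.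

Lemma wirt_Cexp (w : C) : wirt Cexp w (Cexp w) 0.
Proof.
  assert (H1 := wirt_Re_comp exp _ _ _ _ _ (wirt_id w) (is_derive_exp (Re w))).
  assert (Hi := wirt_scal (- Ci)%C _ _ _ _ (wirt_id w)).
  assert (H2 := wirt_Re_comp cos _ _ _ _ _ Hi (is_derive_cos _)).
  assert (H3 := wirt_Re_comp sin _ _ _ _ _ Hi (is_derive_sin _)).
  assert (H4 := wirt_mult _ _ _ _ _ _ _ H1 (wirt_plus _ _ _ _ _ _ _ H2 (wirt_scal Ci _ _ _ _ H3))).
  assert (E : forall v : C, Re (- Ci * v) = Im v) by (intros v; destruct v; cbn; ring).
  eapply wirt_eq.
  - refine (wirt_ext_loc _ _ _ _ _ _ H4). apply filter_forall. intros v. rewrite E.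
    unfold Cexp, cis. f_equal. apply C_ext; cbn; ring.
  - rewrite !E. unfold Cexp. destruct w as [x y]. apply C_ext; cbn; field.
  - rewrite !E. destruct w as [x y]. apply C_ext; cbn; field.
Qed.

Definition strip (w : C) : Prop := - (PI / 2) < Im w < PI / 2.

(* [tanh (w / 2)], which maps the strip conformally onto the disk. *)
Definition strip_map (w : C) : C := ((Cexp w - 1) / (Cexp w + 1))%C.

Lemma Re_Cexp_pos (w : C) : strip w -> 0 < Re (Cexp w).
Proof.
  intros Hw. unfold Cexp; cbn. assert (H1 := exp_pos (Re w)).
  assert (H2 : 0 < cos (Im w)) by (apply cos_gt_0; apply Hw). nra.
Qed.

Lemma Cexp_plus_1_neq_0 (w : C) : strip w -> (Cexp w + 1)%C <> RtoC 0.
Proof. intros Hw. apply Re_pos_neq_0. assert (H := Re_Cexp_pos w Hw). cbn in *. lra. Qed.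

Lemma Cmod_sqr_lt_1 (z : C) : Cmod z ^ 2 < 1 -> Cmod z < 1.
Proof. intros H. assert (H0 := Cmod_ge_0 z). nra. Qed.

Lemma strip_map_norm (w : C) : strip w ->
  1 - Cmod (strip_map w) ^ 2 = 4 * Re (Cexp w) / Cmod (Cexp w + 1) ^ 2.
Proof.
  intros Hw. assert (Hn := Cexp_plus_1_neq_0 w Hw). unfold strip_map.
  rewrite Cmod_div by exact Hn.
  assert (Hn2 : Cmod (Cexp w + 1) <> 0) by (apply Rgt_not_eq, Cmod_gt_0, Hn).
  assert (E1 := Cmod2_alt (Cexp w - 1)). assert (E2 := Cmod2_alt (Cexp w + 1)).
  replace ((Cmod (Cexp w - 1) / Cmod (Cexp w + 1)) ^ 2)
    with (Cmod (Cexp w - 1) ^ 2 / Cmod (Cexp w + 1) ^ 2) by (field; exact Hn2).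
  rewrite E1. field_simplify_eq. 2: exact Hn2. rewrite E2.
  destruct (Cexp w); cbn; ring.
Qed.

Lemma strip_map_disk (w : C) : strip w -> Cmod (strip_map w) < 1.
Proof.
  intros Hw. apply Cmod_sqr_lt_1. assert (H := strip_map_norm w Hw).
  assert (Hp : 0 < 4 * Re (Cexp w) / Cmod (Cexp w + 1) ^ 2).
  { apply Rdiv_lt_0_compat. assert (H1 := Re_Cexp_pos w Hw). lra.
    apply pow_lt, Cmod_gt_0, Cexp_plus_1_neq_0, Hw. }
  lra.
Qed.

Lemma Cmod_Cexp (w : C) : Cmod (Cexp w) = exp (Re w).
Proof.
  unfold Cexp. rewrite Cmod_mult, Cmod_cis, Cmod_R, Rabs_pos_eq. ring. apply Rlt_le, exp_pos.
Qed.

Lemma Cexp_plus_1_Cmod (w : C) : strip w ->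
  exp (Re w) <= Cmod (Cexp w + 1) /\ 1 <= Cmod (Cexp w + 1).
Proof.
  intros Hw. assert (H := Re_Cexp_pos w Hw).
  assert (E2 := Cmod2_alt (Cexp w + 1)). assert (E1 := Cmod2_alt (Cexp w)).
  rewrite Cmod_Cexp in E1. assert (H0 := Cmod_ge_0 (Cexp w + 1)). assert (He := exp_pos (Re w)).
  assert (E3 : Re (Cexp w + 1) = Re (Cexp w) + 1) by reflexivity.
  assert (E4 : Im (Cexp w + 1) = Im (Cexp w)) by (cbn; ring).
  rewrite E3, E4 in E2.
  split; apply Rsqr_incr_0_var; unfold Rsqr; nra.
Qed.

(** The bound is uniform in [Re w]: when [Im w] tends to an end of its range the image tends to the
    circle, however far a level curve runs out horizontally. *)
Lemma strip_map_boundary (w : C) : strip w -> 1 - 2 * cos (Im w) <= Cmod (strip_map w) ^ 2.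
Proof.
  intros Hw. assert (H := strip_map_norm w Hw).
  destruct (Cexp_plus_1_Cmod w Hw) as [Hn1 Hn2].
  assert (Hc : 0 < cos (Im w)) by (apply cos_gt_0; apply Hw).
  assert (Hd : 4 * Re (Cexp w) / Cmod (Cexp w + 1) ^ 2 <= 2 * cos (Im w)); [|lra].
  apply Rle_div_l. apply Rlt_gt, pow_lt; lra.
  rewrite (Cmod2_alt (Cexp w + 1)).
  assert (He := exp_pos (Re w)). unfold Cexp; cbn.
  assert (Hs := sin2_cos2 (Im w)). unfold Rsqr in Hs.
  set (e := exp (Re w)) in *. set (c := cos (Im w)) in *. set (s := sin (Im w)) in *.
  replace ((e * c - 0 * s + 1) * ((e * c - 0 * s + 1) * 1) + (e * s + 0 * c + 0) * ((e * s + 0 * c + 0) * 1))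
    with (e * e * (s * s + c * c) + 2 * e * c + 1) by ring.
  rewrite Hs. assert (P1 : 0 <= c * ((e - 1) * (e - 1))) by (apply Rmult_le_pos; [lra | apply Rle_0_sqr]).
  assert (P2 : 0 <= e * (c * c)) by (apply Rmult_le_pos; [lra | apply Rle_0_sqr]).
  ring_simplify. ring_simplify in P1. ring_simplify in P2. lra.
Qed.

(** Horizontal lines of the strip become arcs from [- 1] to [1]. In the normalised problem these
    points are the midpoints of the arcs carrying [c3] and [c1], so the transversal coordinate runs
    between its two extreme values along every such line. *)
Lemma strip_map_right (w : C) : strip w -> Cmod (strip_map w - 1) <= 2 * exp (- Re w).
Proof.
  intros Hw. assert (Hn := Cexp_plus_1_neq_0 w Hw). destruct (Cexp_plus_1_Cmod w Hw) as [Hm1 Hm2].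
  assert (He := exp_pos (Re w)).
  replace (strip_map w - 1)%C with (- (RtoC 2) / (Cexp w + 1))%C.
  2: { unfold strip_map. replace (RtoC 2) with (1 + 1)%C by (rewrite <- RtoC_plus; f_equal; ring). field. exact Hn. }
  rewrite Cmod_div, Cmod_opp, Cmod_R, Rabs_pos_eq by (lra || exact Hn).
  rewrite exp_Ropp. unfold Rdiv. apply Rmult_le_compat_l. lra. apply Rinv_le_contravar; lra.
Qed.

Lemma strip_map_left (w : C) : strip w -> Cmod (strip_map w - (- 1)) <= 2 * exp (Re w).
Proof.
  intros Hw. assert (Hn := Cexp_plus_1_neq_0 w Hw). destruct (Cexp_plus_1_Cmod w Hw) as [Hm1 Hm2].
  assert (He := exp_pos (Re w)).
  replace (strip_map w - (- 1))%C with (RtoC 2 * Cexp w / (Cexp w + 1))%C.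
  2: { unfold strip_map. replace (RtoC 2) with (1 + 1)%C by (rewrite <- RtoC_plus; f_equal; ring). field. exact Hn. }
  rewrite Cmod_div, Cmod_mult, Cmod_R, Rabs_pos_eq, Cmod_Cexp by (lra || exact Hn).
  apply Rle_div_l; nra.
Qed.

(** The preimage is [log ((1 + z) / (1 - z))], taken in the right half-plane. *)
Lemma strip_map_surj (z : C) : Cmod z < 1 -> exists w, strip w /\ strip_map w = z.
Proof.
  intros Hz.
  assert (H1 : (1 - z)%C <> RtoC 0).
  { intros E. replace z with (RtoC 1) in Hz. rewrite Cmod_1 in Hz. lra.
    replace z with (1 - (1 - z))%C by ring. rewrite E. ring. }
  set (u := ((1 + z) / (1 - z))%C).
  assert (Hu : 0 < Re u).
  { assert (Hm := Cmod2_alt z). assert (H0 := Cmod_ge_0 z).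
    assert (Hd : 0 < Cmod (1 - z) ^ 2) by (apply pow_lt, Cmod_gt_0, H1).
    rewrite Cmod2_alt in Hd.
    replace (Re u) with ((1 - (Re z ^ 2 + Im z ^ 2)) / (Re (1 - z) ^ 2 + Im (1 - z) ^ 2)).
    - apply Rdiv_lt_0_compat. nra. exact Hd.
    - unfold u. destruct z as [x y]. cbn in Hd |- *. field. nra. }
  exists (Clog u). split.
  - assert (Ha := atan_bound (Im u / Re u)). unfold strip. change (Im (Clog u)) with (atan (Im u / Re u)). lra.
  - assert (E : Cexp (Clog u) = u).
    { unfold Cexp, Clog; cbn [Re Im fst snd].
      assert (Hp : 0 < Re u ^ 2 + Im u ^ 2) by nra.
      replace (exp (ln (Re u ^ 2 + Im u ^ 2) / 2)) with (sqrt (Re u ^ 2 + Im u ^ 2)).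
      2: { rewrite <- Rpower_sqrt by exact Hp. unfold Rpower. f_equal. field. }
      assert (Hs : sqrt (1 + (Im u / Re u)²) = sqrt (Re u ^ 2 + Im u ^ 2) / Re u).
      { rewrite <- (sqrt_Rsqr (Re u)) at 3 by lra. rewrite <- sqrt_div_alt by (unfold Rsqr; nra).
        f_equal. unfold Rsqr. field. lra. }
      assert (Hq : 0 < sqrt (Re u ^ 2 + Im u ^ 2)) by (apply sqrt_lt_R0, Hp).
      assert (Hcos : cos (atan (Im u / Re u)) = Re u / sqrt (Re u ^ 2 + Im u ^ 2)).
      { rewrite cos_atan, Hs. field. lra. }
      assert (Hsin : sin (atan (Im u / Re u)) = Im u / sqrt (Re u ^ 2 + Im u ^ 2)).
      { rewrite sin_atan, Hs. field. lra. }
      unfold cis. rewrite Hcos, Hsin. apply C_ext; cbn [Re Im fst snd RtoC Cmult]; field; lra. }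
    unfold strip_map. rewrite E. unfold u. field. repeat split; try exact H1.
    replace (1 + z + (1 - z))%C with (RtoC 2) by (replace (RtoC 2) with (1 + 1)%C by (rewrite <- RtoC_plus; f_equal; ring); ring).
    apply RtoC_neq. lra.
Qed.

Lemma wirt_strip_map (w : C) : strip w -> wirt strip_map w ((1 - strip_map w * strip_map w) / 2)%C 0.
Proof.
  intros Hw. assert (Hn := Cexp_plus_1_neq_0 w Hw).
  assert (H := wirt_div _ _ _ _ _ _ _ (wirt_minus _ _ _ _ _ _ _ (wirt_Cexp w) (wirt_const (RtoC 1) w))
    (wirt_plus _ _ _ _ _ _ _ (wirt_Cexp w) (wirt_const (RtoC 1) w)) Hn).
  eapply wirt_eq. exact H.
  - unfold strip_map. field. exact Hn.
  - field. exact Hn.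
Qed.

Lemma one_minus_sqr_neq_0 (z : C) : Cmod z < 1 -> (1 - z * z)%C <> RtoC 0.
Proof.
  intros Hz E. assert (H : (z * z)%C = RtoC 1).
  { replace (z * z)%C with (1 - (1 - z * z))%C by ring. rewrite E. ring. }
  assert (H1 : Cmod z * Cmod z = 1) by (rewrite <- Cmod_mult, H; apply Cmod_1).
  assert (H0 := Cmod_ge_0 z). nra.
Qed.

Lemma derive_pos_local (phi : R -> R) (y d : R) : is_derive phi y d -> 0 < d ->
  exists r, 0 < r /\ forall h, h <> 0 -> Rabs h < r -> 0 < (phi (y + h) - phi y) * h.
Proof.
  intros H Hd. apply is_derive_Reals in H. destruct (H (d / 2)) as [r Hr]. lra.
  exists r. split. apply cond_pos. intros h Hh Hhr. specialize (Hr h Hh Hhr).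
  apply Rabs_lt_between in Hr.
  assert (Hq : 0 < (phi (y + h) - phi y) / h) by lra.
  replace ((phi (y + h) - phi y) * h) with ((phi (y + h) - phi y) / h * (h * h)) by (field; exact Hh).
  apply Rmult_lt_0_compat. exact Hq. nra.
Qed.

(* A level curve of [Re G] is a graph over the [Im] axis of the strip, along which [Im G] increases
   because the Jacobian of [G] is positive. *)
Section LevelCurve.
Variable G : C -> C.
Hypothesis HG : forall w, strip w -> exists a b, wirt G w a b /\ Cmod b < Cmod a /\ 0 < Re (a + b).

Lemma Re_strict_increasing (x1 x2 y : R) : - (PI / 2) < y < PI / 2 -> x1 < x2 ->
  Re (G (x1, y)) < Re (G (x2, y)).
Proof.
  intros Hy Hx.
  assert (Hd : forall x, exists d, is_derive (fun t => Re (G (t, y))) x d /\ 0 < d).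
  { intros x. destruct (HG (x, y) Hy) as [a [b [Hw [_ Hp]]]].
    destruct (wirt_partials _ _ _ _ Hw) as [[H _] _]. exists (Re (a + b)). split. exact H. exact Hp. }
  destruct (MVT_gen (fun t => Re (G (t, y))) x1 x2
    (fun x => proj1_sig (constructive_indefinite_description _ (Hd x)))) as [c [_ Hc]].
  - intros x _. apply (proj2_sig (constructive_indefinite_description _ (Hd x))).
  - intros x _. apply continuity_pt_filterlim. destruct (Hd x) as [d [H _]].
    apply (ex_derive_continuous (V := R_NormedModule) (fun t => Re (G (t, y)))). exists d. exact H.
  - assert (Hp := proj2 (proj2_sig (constructive_indefinite_description _ (Hd c)))). cbv beta in Hc, Hp.
    nra.
Qed.

Variables (c : R) (X : R -> R).
Hypothesis HX : forall y, - (PI / 2) < y < PI / 2 -> Re (G (X y, y)) = c.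

(** An implicit function theorem for a bare function [X] whose continuity is not known beforehand.
    Along the line of slope [m] through the point, [Re G - c] has derivative [ux (m - l)]; as [Re G]
    increases horizontally, the level curve is squeezed between the lines of slopes [l - eps] and
    [l + eps]. The derivative of [Im G] along it is the Jacobian divided by [ux]. *)
Lemma level_curve_derive (y : R) : - (PI / 2) < y < PI / 2 ->
  exists l, is_derive (fun t => Im (G (X t, t))) y l /\ 0 < l.
Proof.
  intros Hy. destruct (HG (X y, y) Hy) as [a [b [Hw [Hab Hp]]]].
  set (ux := Re (a + b)) in *. set (uy := Re (Ci * (a - b))).
  set (l := - uy / ux).
  assert (Hslope : forall m, exists r, 0 < r /\ forall h, h <> 0 -> Rabs h < r ->
     0 < (Re (G (X y + m * h, y + h)) - c) * h * (m - l) \/ m = l).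
  { intros m. destruct (Req_dec m l) as [E|E]. { exists 1. split. lra. intros; right; exact E. }
    assert (Hd : is_derive (fun t => Re (G (X y + m * (t - y), t))) y (ux * (m - l))).
    { assert (H := wirt_along G (fun t => (X y + m * (t - y), t)) y (m, 1) a b).
      cbv beta in H. replace (X y + m * (y - y)) with (X y) in H by ring.
      specialize (H Hw).
      assert (Hg : @is_derive R_AbsRing C_R_NormedModule (fun t => (X y + m * (t - y), t)) y (m, 1)).
      { apply is_derive_C. split; cbn; auto_derive; trivial; ring. }
      specialize (H Hg). apply is_derive_C in H. destruct H as [H _].
      refine (eq_ind _ (fun d => is_derive _ y d) H _ _).
      match goal with |- @eq _ ?p ?q => change (@eq R p q) end. unfold l, uy. field_simplify_eq. 2: lra. unfold ux. destruct a, b; cbn; ring. }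
    destruct (Rlt_le_dec l m) as [Hm|Hm].
    - destruct (derive_pos_local _ _ _ Hd) as [r [Hr H]]. apply Rmult_lt_0_compat; lra.
      exists r. split. exact Hr. intros h Hh Hhr. left. specialize (H h Hh Hhr).
      change (0 < (Re (G (X y + m * (y + h - y), y + h)) - Re (G (X y + m * (y - y), y))) * h) in H. replace (X y + m * (y - y)) with (X y) in H by ring. rewrite (HX y Hy) in H.
      replace (X y + m * (y + h - y)) with (X y + m * h) in H by ring.
      apply Rmult_lt_0_compat; lra.
    - assert (Hd' := is_derive_opp _ _ _ Hd).
      destruct (derive_pos_local _ _ _ Hd') as [r [Hr H]].
      { change (0 < - (ux * (m - l))). assert (m < l) by lra. nra. }
      exists r. split. exact Hr. intros h Hh Hhr. left. specialize (H h Hh Hhr).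
      change (0 < (- Re (G (X y + m * (y + h - y), y + h)) - - Re (G (X y + m * (y - y), y))) * h) in H.
      replace (X y + m * (y - y)) with (X y) in H by ring. rewrite (HX y Hy) in H.
      replace (X y + m * (y + h - y)) with (X y + m * h) in H by ring.
      assert (m < l) by lra. unfold Re in *. nra. }
  assert (HXd : is_derive X y l).
  { apply is_derive_Reals. intros eps He.
    destruct (Hslope (l + eps)) as [r1 [Hr1 H1]]. destruct (Hslope (l - eps)) as [r2 [Hr2 H2]].
    assert (Hr : 0 < Rmin (Rmin r1 r2) (Rmin (PI / 2 - y) (y + PI / 2))).
    { repeat apply Rmin_pos; lra. }
    exists (mkposreal _ Hr). intros h Hh Hhr. cbn in Hhr.
    assert (Ha := Rlt_le_trans _ _ _ Hhr (Rmin_l _ _)). assert (Hb := Rlt_le_trans _ _ _ Hhr (Rmin_r _ _)).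
    assert (Ha1 := Rlt_le_trans _ _ _ Ha (Rmin_l _ _)). assert (Ha2 := Rlt_le_trans _ _ _ Ha (Rmin_r _ _)).
    assert (Hb1 := Rlt_le_trans _ _ _ Hb (Rmin_l _ _)). assert (Hb2 := Rlt_le_trans _ _ _ Hb (Rmin_r _ _)).
    apply Rabs_lt_between in Hb1. apply Rabs_lt_between in Hb2.
    assert (Hyh : - (PI / 2) < y + h < PI / 2) by lra.
    assert (Hq := HX _ Hyh).
    destruct (H1 h Hh Ha1) as [H1'|]; [|lra]. destruct (H2 h Hh Ha2) as [H2'|]; [|lra].
    replace (l + eps - l) with eps in H1' by ring. replace (l - eps - l) with (- eps) in H2' by ring.
    assert (Hcmp : forall m, (Re (G (X y + m * h, y + h)) - c > 0 -> X (y + h) < X y + m * h) /\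
       (Re (G (X y + m * h, y + h)) - c < 0 -> X y + m * h < X (y + h))).
    { intros m. split; intros Hm.
      - apply Rnot_le_lt. intros Hle. destruct (Rle_lt_or_eq_dec _ _ Hle) as [Hlt|Heq].
        + assert (Hinc := Re_strict_increasing _ _ _ Hyh Hlt). lra.
        + rewrite Heq, Hq in Hm. lra.
      - apply Rnot_le_lt. intros Hle. destruct (Rle_lt_or_eq_dec _ _ Hle) as [Hlt|Heq].
        + assert (Hinc := Re_strict_increasing _ _ _ Hyh Hlt). lra.
        + rewrite <- Heq, Hq in Hm. lra. }
    assert (Hd1 : 0 < (X y + (l + eps) * h - X (y + h)) * h).
    { destruct (Hcmp (l + eps)) as [C1 C2].
      destruct (Rlt_le_dec 0 h) as [Hh0|Hh0].
      - assert (X (y + h) < X y + (l + eps) * h).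
        { apply C1. apply Rnot_le_gt. intros Hle. assert ((Re (G (X y + (l + eps) * h, y + h)) - c) * h <= 0) by nra. nra. }
        nra.
      - assert (h < 0) by lra. assert (X y + (l + eps) * h < X (y + h)).
        { apply C2. apply Rnot_le_gt. intros Hle. assert ((Re (G (X y + (l + eps) * h, y + h)) - c) * h <= 0) by nra. nra. }
        nra. }
    assert (Hd2 : 0 < (X (y + h) - (X y + (l - eps) * h)) * h).
    { destruct (Hcmp (l - eps)) as [C1 C2].
      destruct (Rlt_le_dec 0 h) as [Hh0|Hh0].
      - assert (X y + (l - eps) * h < X (y + h)).
        { apply C2. apply Rnot_le_gt. intros Hle. assert (0 <= (Re (G (X y + (l - eps) * h, y + h)) - c) * h) by nra. nra. }
        nra.
      - assert (h < 0) by lra. assert (X (y + h) < X y + (l - eps) * h).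
        { apply C1. apply Rnot_le_gt. intros Hle. assert (0 <= (Re (G (X y + (l - eps) * h, y + h)) - c) * h) by nra. nra. }
        nra. }
    assert (Hhh : 0 < h * h) by nra.
    apply Rabs_lt_between. split.
    - apply Rmult_lt_reg_r with (h * h). exact Hhh.
      replace (((X (y + h) - X y) / h - l) * (h * h)) with ((X (y + h) - X y) * h - l * (h * h)) by (field; exact Hh).
      nra.
    - apply Rmult_lt_reg_r with (h * h). exact Hhh.
      replace (((X (y + h) - X y) / h - l) * (h * h)) with ((X (y + h) - X y) * h - l * (h * h)) by (field; exact Hh).
      nra. }
  assert (Hg : @is_derive R_AbsRing C_R_NormedModule (fun t => (X t, t)) y (l, 1)).
  { apply is_derive_C. split; cbn. exact HXd. auto_derive; trivial. }
  assert (H := wirt_along G (fun t => (X t, t)) y (l, 1) a b Hw Hg).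
  apply is_derive_C in H. destruct H as [_ H]. eexists. split. exact H.
  assert (Hm1 := Cmod2_alt a). assert (Hm2 := Cmod2_alt b).
  assert (Hm3 := Cmod_ge_0 b). assert (Hm4 : Cmod b ^ 2 < Cmod a ^ 2) by nra.
  replace (Im (a * (l, 1) + b * Cconj (l, 1))) with ((Cmod a ^ 2 - Cmod b ^ 2) / ux).
  - apply Rdiv_lt_0_compat; lra.
  - rewrite Hm1, Hm2. unfold l, uy, ux in *. destruct a, b; cbn in *. field. lra.
Qed.

Lemma level_curve_increasing (y1 y2 : R) : - (PI / 2) < y1 -> y1 < y2 -> y2 < PI / 2 ->
  Im (G (X y1, y1)) < Im (G (X y2, y2)).
Proof.
  intros H1 H12 H2.
  assert (Hd : forall y, exists d, - (PI / 2) < y < PI / 2 -> is_derive (fun t => Im (G (X t, t))) y d /\ 0 < d).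
  { intros y. destruct (Rlt_le_dec (- (PI / 2)) y) as [Ha|Ha]. destruct (Rlt_le_dec y (PI / 2)) as [Hb|Hb].
    - destruct (level_curve_derive y (conj Ha Hb)) as [d Hd]. exists d. intros _. exact Hd.
    - exists 0. lra.
    - exists 0. lra. }
  destruct (MVT_gen (fun t => Im (G (X t, t))) y1 y2
    (fun x => proj1_sig (constructive_indefinite_description _ (Hd x)))) as [u [Hu Hc]].
  - rewrite Rmin_left, Rmax_right by lra. intros x Hx.
    apply (proj2_sig (constructive_indefinite_description _ (Hd x))). lra.
  - rewrite Rmin_left, Rmax_right by lra. intros x Hx.
    apply continuity_pt_filterlim. destruct (level_curve_derive x) as [d [H _]]. lra.
    apply (ex_derive_continuous (V := R_NormedModule) (fun t => Im (G (X t, t)))). exists d. exact H.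
  - rewrite Rmin_left, Rmax_right in Hu by lra.
    assert (Hp := proj2_sig (constructive_indefinite_description _ (Hd u))). cbv beta in Hc, Hp.
    destruct Hp as [_ Hp]. lra. nra.
Qed.

Lemma level_curve_continuous (y : R) : - (PI / 2) < y < PI / 2 ->
  continuous (fun t => Im (G (X t, t))) y.
Proof.
  intros Hy. destruct (level_curve_derive y Hy) as [d [H _]].
  apply (ex_derive_continuous (V := R_NormedModule) (fun t => Im (G (X t, t)))). exists d. exact H.
Qed.
End LevelCurve.

(** * The region bounded by a quadrilateral *)

(** Near the boundary a level curve is only known to be mapped close to the lower or to the upper
    broken line, so the hypothesis on the ends does not say which limit is approached. Monotonicity
    decides: [lo] at the left end and [hi] at the right end. *)
Lemma increasing_between_limits (V : R -> R) (H lo hi : R) : 0 < H -> lo < hi ->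
  (forall y1 y2, - H < y1 -> y1 < y2 -> y2 < H -> V y1 < V y2) ->
  (forall y, - H < y < H -> continuous V y) ->
  (forall eps, 0 < eps -> exists e, 0 < e < H /\ forall y, - H < y < H -> e < Rabs y ->
     Rabs (V y - lo) < eps \/ Rabs (V y - hi) < eps) ->
  (forall y, - H < y < H -> lo < V y < hi) /\
  (forall v, lo < v < hi -> exists y, - H < y < H /\ V y = v).
Proof.
  intros HH Hlh Hinc Hcont Hends.
  assert (Hup : forall eps y0, 0 < eps -> - H < y0 < H -> exists y, y0 < y < H /\
     (Rabs (V y - lo) < eps \/ Rabs (V y - hi) < eps)).
  { intros eps y0 He Hy0. destruct (Hends eps He) as [e [He' H']].
    assert (Hm1 := Rmax_l e y0). assert (Hm2 := Rmax_r e y0).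
    assert (Hm3 : Rmax e y0 < H) by (apply Rmax_lub_lt; lra).
    exists ((Rmax e y0 + H) / 2). split. lra. apply H'. lra. rewrite Rabs_pos_eq; lra. }
  assert (Hdown : forall eps y0, 0 < eps -> - H < y0 < H -> exists y, - H < y < y0 /\
     (Rabs (V y - lo) < eps \/ Rabs (V y - hi) < eps)).
  { intros eps y0 He Hy0. destruct (Hends eps He) as [e [He' H']].
    assert (Hm1 := Rmin_l (- e) y0). assert (Hm2 := Rmin_r (- e) y0).
    assert (Hm3 : - H < Rmin (- e) y0) by (apply Rmin_glb_lt; lra).
    exists ((Rmin (- e) y0 + - H) / 2). split. lra. apply H'. lra. rewrite Rabs_left; lra. }
  assert (Hin : forall y, - H < y < H -> lo < V y < hi).
  { intros y Hy. split.
    - apply Rnot_le_lt. intros Hle.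
      assert (Hlt : V ((- H + y) / 2) < V y) by (apply Hinc; lra).
      destruct (Hdown (V y - V ((- H + y) / 2)) ((- H + y) / 2)) as [y' [Hy' C]]. lra. lra.
      assert (Hlt' : V y' < V ((- H + y) / 2)) by (apply Hinc; lra).
      destruct C as [C|C]; apply Rabs_lt_between in C; lra.
    - apply Rnot_le_lt. intros Hle.
      assert (Hlt : V y < V ((H + y) / 2)) by (apply Hinc; lra).
      destruct (Hup (V ((H + y) / 2) - V y) ((H + y) / 2)) as [y' [Hy' C]]. lra. lra.
      assert (Hlt' : V ((H + y) / 2) < V y') by (apply Hinc; lra).
      destruct C as [C|C]; apply Rabs_lt_between in C; lra. }
  split. exact Hin.
  intros v Hv.
  assert (Hgap : V 0 < V (H / 2)) by (apply Hinc; lra).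
  assert (Hhigh : exists y, - H < y < H /\ v < V y).
  { apply NNPP. intros Hn.
    assert (Hn' : forall y, - H < y < H -> V y <= v).
    { intros y Hy. apply Rnot_lt_le. intros Hlt. apply Hn. exists y. auto. }
    (* Beyond [H / 2] the function cannot be within [eps] of [lo], having risen by at least [2 eps]
       since [0]; being within [eps] of [hi] would contradict the bound by [v]. *)
    set (eps := Rmin ((V (H / 2) - V 0) / 2) (hi - v)).
    assert (He : 0 < eps) by (apply Rmin_pos; lra).
    assert (He1 := Rmin_l ((V (H / 2) - V 0) / 2) (hi - v)). fold eps in He1.
    assert (He2 := Rmin_r ((V (H / 2) - V 0) / 2) (hi - v)). fold eps in He2.
    destruct (Hup eps (H / 2)) as [y [Hy C]]. exact He. lra.
    assert (L1 := Hinc (H / 2) y ltac:(lra) ltac:(lra) ltac:(lra)).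
    assert (L2 := Hn' y ltac:(lra)). assert (L3 := Hin 0 ltac:(lra)).
    destruct C as [C|C]; apply Rabs_lt_between in C; [|lra].
    destruct (Hdown eps 0) as [y' [Hy' C']]. exact He. lra.
    assert (L4 := Hin y' ltac:(lra)). assert (L5 := Hinc y' 0 ltac:(lra) ltac:(lra) ltac:(lra)).
    destruct C' as [C'|C']; apply Rabs_lt_between in C'; lra. }
  assert (Hlow : exists y, - H < y < H /\ V y < v).
  { apply NNPP. intros Hn.
    assert (Hn' : forall y, - H < y < H -> v <= V y).
    { intros y Hy. apply Rnot_lt_le. intros Hlt. apply Hn. exists y. auto. }
    set (eps := Rmin ((V (H / 2) - V 0) / 2) (v - lo)).
    assert (He : 0 < eps) by (apply Rmin_pos; lra).
    assert (He1 := Rmin_l ((V (H / 2) - V 0) / 2) (v - lo)). fold eps in He1.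
    assert (He2 := Rmin_r ((V (H / 2) - V 0) / 2) (v - lo)). fold eps in He2.
    destruct (Hdown eps 0) as [y [Hy C]]. exact He. lra.
    assert (L1 := Hinc y 0 ltac:(lra) ltac:(lra) ltac:(lra)).
    assert (L2 := Hn' y ltac:(lra)). assert (L3 := Hin (H / 2) ltac:(lra)).
    destruct C as [C|C]; apply Rabs_lt_between in C; [lra|].
    destruct (Hup eps (H / 2)) as [y' [Hy' C']]. exact He. lra.
    assert (L4 := Hin y' ltac:(lra)). assert (L5 := Hinc (H / 2) y' ltac:(lra) ltac:(lra) ltac:(lra)).
    destruct C' as [C'|C']; apply Rabs_lt_between in C'; lra. }
  destruct Hhigh as [yh [Hyh Hvh]], Hlow as [yl [Hyl Hvl]].
  assert (Hlt : yl < yh).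
  { apply Rnot_le_lt. intros Hle. destruct (Rle_lt_or_eq_dec _ _ Hle) as [Hl|He].
    - assert (L := Hinc yh yl ltac:(lra) Hl ltac:(lra)). lra.
    - subst. lra. }
  destruct (Ranalysis5.IVT_interv (fun y => V y - v) yl yh) as [y [Hy E]].
  - intros a Ha. apply continuity_pt_minus. apply continuity_pt_filterlim. apply Hcont. lra.
    apply continuity_pt_const. intros ? ?; reflexivity.
  - exact Hlt.
  - lra.
  - lra.
  - exists y. split; lra.
Qed.

(* A quadrilateral with [Re c2 = Re c4 = 0] and [c1], [c3] to the right and to the left of
   the diagonal [c2 c4]: [side_upper] and [side_lower] are the broken lines [c3 c2 c1] and
   [c3 c4 c1] as graphs over the real axis. *)
Definition side_upper (c1 c2 c3 : C) (x : R) : R :=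
  Im c2 + (Im c1 - Im c2) / Re c1 * ((x + Rabs x) / 2) + (Im c3 - Im c2) / Re c3 * ((x - Rabs x) / 2).

Definition normal_quad (c1 c2 c3 c4 : C) : Prop :=
  0 < Re c1 /\ Re c2 = 0 /\ Re c3 < 0 /\ Re c4 = 0 /\ Im c4 < Im c2.

(** A continuous function that vanishes exactly on the sides and is positive exactly inside, so that
    the intermediate value theorem along a path does the work of the Jordan curve theorem. *)
Definition depth (c1 c2 c3 c4 w : C) : R :=
  Rmin (Im w - side_upper c1 c4 c3 (Re w)) (side_upper c1 c2 c3 (Re w) - Im w).

Lemma side_gap (c1 c2 c3 c4 : C) (x : R) : normal_quad c1 c2 c3 c4 ->
  (Re c3 < x < Re c1 -> side_upper c1 c4 c3 x < side_upper c1 c2 c3 x) /\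
  (side_upper c1 c4 c3 x < side_upper c1 c2 c3 x -> Re c3 < x < Re c1) /\
  (Re c3 <= x <= Re c1 -> side_upper c1 c4 c3 x <= side_upper c1 c2 c3 x) /\
  (side_upper c1 c4 c3 x <= side_upper c1 c2 c3 x -> Re c3 <= x <= Re c1).
Proof.
  intros [H1 [_ [H3 [_ H24]]]].
  assert (Hgap : side_upper c1 c2 c3 x - side_upper c1 c4 c3 x =
    (Im c2 - Im c4) * (if Rle_dec 0 x then (Re c1 - x) / Re c1 else (x - Re c3) / - Re c3)).
  { unfold side_upper. destruct (Rle_dec 0 x) as [Hx|Hx].
    - rewrite Rabs_pos_eq by exact Hx. field. lra.
    - rewrite Rabs_left by lra. field. lra. }
  destruct (Rle_dec 0 x) as [Hx|Hx].
  - assert (E : (Re c1 - x) = (Re c1 - x) / Re c1 * Re c1) by (field; lra).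
    set (q := (Re c1 - x) / Re c1) in *. repeat split; intros; try lra; nra.
  - assert (E : (x - Re c3) = (x - Re c3) / - Re c3 * - Re c3) by (field; lra).
    set (q := (x - Re c3) / - Re c3) in *. repeat split; intros; try lra; nra.
Qed.

Lemma on_sides_normal (c1 c2 c3 c4 w : C) : normal_quad c1 c2 c3 c4 ->
  on_sides c1 c2 c3 c4 w <->
  Re c3 <= Re w <= Re c1 /\ (Im w = side_upper c1 c4 c3 (Re w) \/ Im w = side_upper c1 c2 c3 (Re w)).
Proof.
  intros [H1 [H2 [H3 [H4 H24]]]].
  assert (Hseg : forall a b t, Re ((1 - t)%R * a + t * b)%C = (1 - t) * Re a + t * Re b /\
     Im ((1 - t)%R * a + t * b)%C = (1 - t) * Im a + t * Im b).
  { intros a b t. destruct a, b; cbn; split; ring. }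
  split.
  - intros [[t [Ht ->]]|[[t [Ht ->]]|[[t [Ht ->]]|[t [Ht ->]]]]];
    rewrite !(proj1 (Hseg _ _ _)), !(proj2 (Hseg _ _ _)); unfold side_upper; rewrite ?H2, ?H4.
    + split. nra. right. rewrite Rabs_pos_eq by nra. field. lra.
    + split. nra. right. rewrite Rabs_left1 by nra. field. lra.
    + split. nra. left. rewrite Rabs_left1 by nra. field. lra.
    + split. nra. left. rewrite Rabs_pos_eq by nra. field. lra.
  - intros [Hx HI].
    assert (Hd : forall a b t, Re w = (1 - t) * Re a + t * Re b -> Im w = (1 - t) * Im a + t * Im b ->
       0 <= t <= 1 -> closed_segment a b w).
    { intros a b t E1 E2 Ht. exists t. split. exact Ht. destruct (Hseg a b t) as [F1 F2]. apply C_ext; congruence. }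
    unfold side_upper in HI. unfold on_sides.
    destruct (Rle_dec 0 (Re w)) as [Hw|Hw].
    + assert (Ht : 0 <= Re w / Re c1 <= 1).
      { split. apply Rdiv_le_0_compat; lra. apply Rle_div_l; lra. }
      rewrite Rabs_pos_eq in HI by exact Hw.
      destruct HI as [HI|HI].
      * right; right; right. apply (Hd _ _ (1 - (1 - Re w / Re c1))); [| |lra].
        rewrite H4. field. lra. rewrite HI. field. lra.
      * left. apply (Hd _ _ (1 - Re w / Re c1)); [| |lra].
        rewrite H2. field. lra. rewrite HI. field. lra.
    + assert (Ht : 0 <= Re w / Re c3 <= 1).
      { replace (Re w / Re c3) with (- Re w / - Re c3) by (field; lra).
        split. apply Rdiv_le_0_compat; lra. apply Rle_div_l; lra. }
      rewrite Rabs_left in HI by lra.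
      destruct HI as [HI|HI].
      * right; right; left. apply (Hd _ _ (1 - Re w / Re c3)); [| |lra].
        rewrite H4. field. lra. rewrite HI. field. lra.
      * right; left. apply (Hd _ _ (Re w / Re c3)); [| |lra].
        rewrite H2. field. lra. rewrite HI. field. lra.
Qed.

Lemma continuous_side_upper (c1 c2 c3 : C) (x : R) : continuous (side_upper c1 c2 c3) x.
Proof.
  assert (Hid : continuous (fun y : R => y) x) by apply continuous_id.
  assert (Hab : continuous (fun y : R => Rabs y) x) by apply (continuous_Rabs x).
  assert (Hk : forall (k : R) (f : R -> R), continuous f x -> continuous (fun y => k * f y) x).
  { intros k f Hf. apply (continuous_mult (U := R_UniformSpace) (K := R_AbsRing) (fun _ => k) f).
    apply continuous_const. exact Hf. }
  assert (H1 := continuous_plus (U := R_UniformSpace) (V := R_NormedModule) _ _ _ Hid Hab).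
  assert (H2 := continuous_minus (U := R_UniformSpace) (V := R_NormedModule) _ _ _ Hid Hab).
  assert (H3 := continuous_plus (U := R_UniformSpace) (V := R_NormedModule) _ _ _
    (Hk ((Im c1 - Im c2) / Re c1 / 2) _ H1) (Hk ((Im c3 - Im c2) / Re c3 / 2) _ H2)).
  assert (H4 := continuous_plus (U := R_UniformSpace) (V := R_NormedModule) _ _ _
    (continuous_const (Im c2) x) H3).
  refine (continuous_ext _ _ _ _ H4). intros y. unfold side_upper, minus, plus, opp; cbn. unfold Rdiv. ring.
Qed.

Lemma continuous_depth (c1 c2 c3 c4 w : C) : continuous (depth c1 c2 c3 c4) w.
Proof.
  assert (HRe : @continuous C_UniformSpace R_UniformSpace Re w) by apply continuous_fst.
  assert (HIm : @continuous C_UniformSpace R_UniformSpace Im w) by apply continuous_snd.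
  assert (HU : forall a b c, @continuous C_UniformSpace R_UniformSpace (fun v => side_upper a b c (Re v)) w).
  { intros a b c. apply (continuous_comp (U := C_UniformSpace) (V := R_UniformSpace) (W := R_UniformSpace) Re).
    exact HRe. apply continuous_side_upper. }
  apply (continuous_ext (fun v => ((Im v - side_upper c1 c4 c3 (Re v)) + (side_upper c1 c2 c3 (Re v) - Im v) -
    Rabs ((Im v - side_upper c1 c4 c3 (Re v)) - (side_upper c1 c2 c3 (Re v) - Im v))) * (/ 2))).
  - intros v. unfold depth, Rmin. destruct (Rle_dec _ _) as [H|H].
    rewrite Rabs_left1 by lra. match goal with |- @eq _ ?p ?q => change (@eq R p q) end. field.
    rewrite Rabs_pos_eq by lra. match goal with |- @eq _ ?p ?q => change (@eq R p q) end. field.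
  - apply (continuous_mult (U := C_UniformSpace) (K := R_AbsRing)). 2: apply continuous_const.
    apply (continuous_minus (U := C_UniformSpace) (V := R_NormedModule)).
    + apply (continuous_plus (U := C_UniformSpace) (V := R_NormedModule));
      apply (continuous_minus (U := C_UniformSpace) (V := R_NormedModule)); auto.
    + apply (continuous_comp (U := C_UniformSpace) (V := R_UniformSpace) (W := R_UniformSpace)
        (fun v => (Im v - side_upper c1 c4 c3 (Re v)) - (side_upper c1 c2 c3 (Re v) - Im v)) Rabs).
      2: apply continuous_Rabs.
      repeat apply (continuous_minus (U := C_UniformSpace) (V := R_NormedModule)); auto.
Qed.

Lemma depth_pos (c1 c2 c3 c4 w : C) : normal_quad c1 c2 c3 c4 ->
  0 < depth c1 c2 c3 c4 w <->
  Re c3 < Re w < Re c1 /\ side_upper c1 c4 c3 (Re w) < Im w < side_upper c1 c2 c3 (Re w).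
Proof.
  intros Hn. destruct (side_gap c1 c2 c3 c4 (Re w) Hn) as [_ [G _]]. unfold depth. split.
  - intros H. assert (A := Rmin_l (Im w - side_upper c1 c4 c3 (Re w)) (side_upper c1 c2 c3 (Re w) - Im w)).
    assert (B := Rmin_r (Im w - side_upper c1 c4 c3 (Re w)) (side_upper c1 c2 c3 (Re w) - Im w)).
    split. apply G. lra. lra.
  - intros [_ H]. apply Rmin_pos; lra.
Qed.

Lemma depth_zero (c1 c2 c3 c4 w : C) : normal_quad c1 c2 c3 c4 ->
  depth c1 c2 c3 c4 w = 0 -> on_sides c1 c2 c3 c4 w.
Proof.
  intros Hn H. apply on_sides_normal. exact Hn.
  destruct (side_gap c1 c2 c3 c4 (Re w) Hn) as [_ [_ [_ G]]]. revert H. unfold depth, Rmin.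
  destruct (Rle_dec _ _); intros H; (split; [apply G; lra|]); [left|right]; lra.
Qed.

(** A point outside escapes along a vertical ray, upwards when it is above the upper broken line and
    downwards when it is below the lower one; such a ray never meets the sides. A path from inside
    cannot get out without a zero of [depth]. *)
Lemma region_normal (c1 c2 c3 c4 w : C) : normal_quad c1 c2 c3 c4 ->
  region c1 c2 c3 c4 w <-> 0 < depth c1 c2 c3 c4 w.
Proof.
  intros Hn. split.
  - intros [Hns [M HM]]. apply Rnot_le_lt. intros Hle.
    assert (Hd : depth c1 c2 c3 c4 w < 0).
    { destruct (Rle_lt_or_eq_dec _ _ Hle) as [|E]; [assumption|]. exfalso. apply Hns, depth_zero; assumption. }
    assert (Hray : forall K : R, (forall t, 0 <= t -> ~ on_sides c1 c2 c3 c4 (Re w, Im w + t * K)) ->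
      Rabs K <= M + Cmod w).
    { intros K HK.
      assert (Hb := HM (fun t => (Re w, Im w + t * K))).
      assert (Hm : Cmod (Re w, Im w + 1 * K) <= M).
      { apply Hb.
        - intros t. apply (continuous_comp_2 (fun _ : R => Re w) (fun t => Im w + t * K) (fun x y => (x, y) : C)).
          apply continuous_const.
          apply (ex_derive_continuous (V := R_NormedModule) (fun t => Im w + t * K)). auto_derive. trivial.
          apply (continuous_ext (fun v : R * R => v)). intros []; reflexivity. apply continuous_id.
        - destruct w. cbn. f_equal. ring.
        - intros t Ht. apply HK. lra. }
      assert (Ht := Cmod_triangle (Re w, Im w + 1 * K) (- w)). rewrite Cmod_opp in Ht.
      assert (Hi : Rabs K <= Cmod ((Re w, (Im w + 1 * K)%R) + - w)%C).
      { eapply Rle_trans. 2: apply Rmax_Cmod. eapply Rle_trans. 2: apply Rmax_r.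
        apply Req_le. f_equal. destruct w; cbn; ring. }
      lra. }
    assert (Hcw := Cmod_ge_0 w).
    (* Long enough for the end of the vertical segment to leave the disk of radius [M]. *)
    set (K := Rabs M + Cmod w + 1). assert (HM0 := Rle_abs M).
    destruct (Rle_lt_dec (side_upper c1 c2 c3 (Re w)) (Im w)) as [Hu|Hu].
    + assert (HK : Rabs K <= M + Cmod w).
      { apply Hray. intros t Ht Hon. apply (on_sides_normal _ _ _ _ _ Hn) in Hon. cbn in Hon.
        destruct Hon as [Hr Hon]. destruct (side_gap c1 c2 c3 c4 (Re w) Hn) as [_ [_ [G _]]].
        assert (G' := G Hr).
        assert (HtK : 0 <= t * K). { apply Rmult_le_pos. exact Ht. unfold K. assert (H := Rabs_pos M). lra. }
        fold (Re w) in Hon. fold (Im w) in Hon.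
        assert (E : t * K = 0 /\ Im w = side_upper c1 c2 c3 (Re w)) by lra.
        apply Hns. apply on_sides_normal. exact Hn. split. exact Hr. right. apply E. }
      rewrite Rabs_pos_eq in HK; unfold K in *; assert (H := Rabs_pos M); lra.
    + assert (Hl : Im w < side_upper c1 c4 c3 (Re w)).
      { revert Hd. unfold depth, Rmin. destruct (Rle_dec _ _); lra. }
      assert (HK : Rabs (- K) <= M + Cmod w).
      { apply Hray. intros t Ht Hon. apply (on_sides_normal _ _ _ _ _ Hn) in Hon. cbn in Hon.
        destruct Hon as [Hr Hon]. destruct (side_gap c1 c2 c3 c4 (Re w) Hn) as [_ [_ [G _]]].
        assert (G' := G Hr).
        assert (HtK : 0 <= t * K). { apply Rmult_le_pos. exact Ht. unfold K. assert (H := Rabs_pos M). lra. }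
        fold (Re w) in Hon. fold (Im w) in Hon. lra. }
      assert (H := Rabs_pos M). rewrite Rabs_Ropp, (Rabs_pos_eq K) in HK by (unfold K; lra). unfold K in HK. lra.
  - intros Hd. split.
    + intros Hon. apply (on_sides_normal _ _ _ _ _ Hn) in Hon. apply (depth_pos _ _ _ _ _ Hn) in Hd.
      destruct Hon as [_ Hon]. destruct Hd as [_ Hd]. lra.
    + assert (Hside : forall v, on_sides c1 c2 c3 c4 v ->
        Rabs (Im v) <= Rabs (Im c1) + Rabs (Im c2) + Rabs (Im c3) + Rabs (Im c4)).
      { assert (Hseg : forall a b v, closed_segment a b v -> Rabs (Im v) <= Rabs (Im a) + Rabs (Im b)).
        { intros a b v [t [Ht ->]].
          replace (Im ((1 - t)%R * a + t * b)) with ((1 - t) * Im a + t * Im b) by (destruct a, b; cbn; ring).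
          eapply Rle_trans. apply Rabs_triang. rewrite !Rabs_mult, !(Rabs_pos_eq t), !(Rabs_pos_eq (1 - t)) by lra.
          assert (Ha := Rabs_pos (Im a)). assert (Hb := Rabs_pos (Im b)). nra. }
        assert (A1 := Rabs_pos (Im c1)). assert (A2 := Rabs_pos (Im c2)).
        assert (A3 := Rabs_pos (Im c3)). assert (A4 := Rabs_pos (Im c4)).
        intros v [S|[S|[S|S]]]; apply Hseg in S; lra. }
      set (M := Rabs (Im c1) + Rabs (Im c2) + Rabs (Im c3) + Rabs (Im c4)) in *.
      exists (Rabs (Re c3) + Rabs (Re c1) + M). intros gamma Hc H0 Hns.
      assert (Hd1 : 0 < depth c1 c2 c3 c4 (gamma 1)).
      { apply Rnot_le_lt. intros Hle.
        destruct (Rle_lt_or_eq_dec _ _ Hle) as [Hlt|E].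
        - destruct (Ranalysis5.IVT_interv (fun t => - depth c1 c2 c3 c4 (gamma t)) 0 1) as [t [Ht E]].
          + intros a _. apply continuity_pt_opp, continuity_pt_filterlim.
            apply (continuous_comp (U := R_UniformSpace) (V := C_UniformSpace) (W := R_UniformSpace) gamma).
            apply Hc. apply continuous_depth.
          + lra.
          + rewrite H0. lra.
          + lra.
          + apply (Hns t Ht). apply depth_zero. exact Hn. lra.
        - apply (Hns 1); [lra|]. apply depth_zero; assumption. }
      apply (depth_pos _ _ _ _ _ Hn) in Hd1. destruct Hd1 as [Hr Hi].
      assert (B1 : on_sides c1 c2 c3 c4 (Re (gamma 1), side_upper c1 c4 c3 (Re (gamma 1)))).
      { apply on_sides_normal. exact Hn. cbn. split. lra. left. reflexivity. }
      assert (B2 : on_sides c1 c2 c3 c4 (Re (gamma 1), side_upper c1 c2 c3 (Re (gamma 1)))).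
      { apply on_sides_normal. exact Hn. cbn. split. lra. right. reflexivity. }
      apply Hside in B1. apply Hside in B2. cbn in B1, B2.
      apply Rabs_le_between in B1. apply Rabs_le_between in B2.
      assert (B3 : Rabs (Im (gamma 1)) <= M) by (apply Rabs_le_between; unfold Re in *; lra).
      assert (B4 : Rabs (Re (gamma 1)) <= Rabs (Re c3) + Rabs (Re c1)).
      { destruct Hn as [N1 [_ [N3 _]]]. rewrite (Rabs_left (Re c3)), (Rabs_pos_eq (Re c1)) by lra.
        apply Rabs_le_between. lra. }
      replace (gamma 1) with (RtoC (Re (gamma 1)) + RtoC (Im (gamma 1)) * Ci)%C
        by (destruct (gamma 1); apply C_ext; cbn; ring).
      eapply Rle_trans. apply Cmod_triangle. rewrite Cmod_mult, !Cmod_R, Cmod_Ci. lra.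
Qed.

(** * Univalence and image of the normalised extension *)

Lemma Re_inv_one_minus (w : C) : Cmod w < 1 -> 1 / 2 < Re (/ (1 - w)).
Proof.
  intros Hw. assert (Hm := Cmod2_alt w). assert (H0 := Cmod_ge_0 w).
  assert (Hm2 : Re w ^ 2 + Im w ^ 2 < 1) by nra.
  destruct w as [x y]. cbn in *.
  set (D := (1 + - x) * ((1 + - x) * 1) + (0 + - y) * ((0 + - y) * 1)).
  assert (HD : 0 < D) by (unfold D; nra).
  apply Rmult_lt_reg_r with D. exact HD.
  replace ((1 + - x) / D * D) with (1 + - x) by (field; lra). unfold D. nra.
Qed.

(* The kernel is [sin u] times the mean of the Poisson kernels at the end points [cis u] and [cis (- u)]. *)
Lemma arc_kernel_pos (z : C) (u : R) : Cmod z < 1 -> 0 < u < PI ->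
  0 < Re (- Ci * (((1 - z * z) / 2) * (/ (cis (- u) - z) - / (cis u - z)))).
Proof.
  intros Hz Hu.
  assert (Hn : forall v, (1 - z * cis v)%C <> RtoC 0 /\ Cmod (z * cis v) < 1).
  { intros v. assert (H : Cmod (z * cis v) < 1) by (rewrite Cmod_mult, Cmod_cis; lra). split; [|exact H].
    intros E. replace (z * cis v)%C with (1 - (1 - z * cis v))%C in H by ring.
    rewrite E in H. replace (1 - 0)%C with (RtoC 1) in H by ring. rewrite Cmod_1 in H. lra. }
  assert (Hc : forall v, (cis v - z)%C = (cis v * (1 - z * cis (- v)))%C).
  { intros v. transitivity (cis v - z * (cis v * cis (- v)))%C. rewrite cis_opp_mult. ring. ring. }
  destruct (Hn u) as [N1 M1]. destruct (Hn (- u)) as [N2 M2].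
  assert (Hk : forall v, (1 - z * cis (- v))%C <> RtoC 0 -> (/ (cis v - z))%C = (cis (- v) / (1 - z * cis (- v)))%C).
  { intros v Hv. rewrite Hc.
    transitivity ((cis v * cis (- v)) / (cis v * (1 - z * cis (- v))))%C.
    - rewrite cis_opp_mult. field. split; [exact Hv | apply cis_neq_0].
    - field. split; [exact Hv | apply cis_neq_0]. }
  assert (K1 := Hk (- u)). rewrite Ropp_involutive in K1. specialize (K1 N1).
  assert (K2 := Hk u N2).
  assert (Hs : (cis u - cis (- u))%C = (2 * Ci * RtoC (sin u))%C).
  { apply C_ext; unfold cis; cbn; rewrite ?cos_neg, ?sin_neg; ring. }
  replace (- Ci * (((1 - z * z) / 2) * (/ (cis (- u) - z) - / (cis u - z))))%C
    with (RtoC (sin u) * (/ (1 - z * cis u) + / (1 - z * cis (- u)) - 1))%C.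
  - assert (R1 := Re_inv_one_minus _ M1). assert (R2 := Re_inv_one_minus _ M2).
    assert (Hsin : 0 < sin u) by (apply sin_gt_0; lra).
    replace (Re (RtoC (sin u) * (/ (1 - z * cis u) + / (1 - z * cis (- u)) - 1)))
      with (sin u * (Re (/ (1 - z * cis u)) + Re (/ (1 - z * cis (- u))) - 1)).
    + apply Rmult_lt_0_compat; lra.
    + destruct (/ (1 - z * cis u))%C, (/ (1 - z * cis (- u)))%C. cbn. ring.
  - rewrite K1, K2.
    assert (E2 : RtoC 2 <> RtoC 0) by (apply RtoC_neq; lra).
    assert (ECi : (Ci * Ci)%C = (- (1))%C) by (apply C_ext; cbn; ring).
    transitivity (- Ci * ((1 - z * z) / 2 * ((cis u - cis (- u)) / ((1 - z * cis u) * (1 - z * cis (- u))))))%C.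
    + rewrite Hs.
      transitivity (RtoC (sin u) * (1 - z * z * (cis u * cis (- u))) / ((1 - z * cis u) * (1 - z * cis (- u))))%C.
      { field. split; assumption. }
      rewrite cis_opp_mult.
      transitivity (- (Ci * Ci) * (RtoC (sin u) * (1 - z * z) / ((1 - z * cis u) * (1 - z * cis (- u)))))%C.
      { rewrite ECi. field. split; assumption. }
      field. repeat split; assumption.
    + field. repeat split; assumption.
Qed.

Section NormalStep.
Variables (u : R) (c1 c2 c3 c4 : C).
Hypothesis Hu : 0 < u < PI / 2.
Hypothesis Hn : normal_quad c1 c2 c3 c4.
Let F := step_extension (- u) (2 * u) c1 c2 c3 c4.
Let A := cauchy_sum (- u) (2 * u) (c1 - c4) (c2 - c1) (c3 - c2) (c4 - c3).
Let B := cauchy_sum (- u) (2 * u) (Cconj (c1 - c4)) (Cconj (c2 - c1)) (Cconj (c3 - c2)) (Cconj (c4 - c3)).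
Hypothesis HJ : forall z, Cmod z < 1 -> Cmod (B z) < Cmod (A z).

(** Since [c2] and [c4] lie on the imaginary axis, the real part has the jumps [Re c1], [- Re c1],
    [Re c3], [- Re c3]. Its horizontal derivative is therefore, up to the factor [/ PI], [Re c1]
    times the positive kernel at [z] minus [Re c3] times the positive kernel at [- z], and
    [Re c3 < 0]. *)
Lemma normal_step_wirt (w : C) : strip w ->
  exists a b, wirt (fun v => F (strip_map v)) w a b /\ Cmod b < Cmod a /\ 0 < Re (a + b).
Proof.
  intros Hw. set (z := strip_map w). assert (Hz : Cmod z < 1) by (apply strip_map_disk, Hw).
  set (D := ((1 - z * z) / 2)%C).
  assert (E2 : RtoC 2 <> RtoC 0) by (apply RtoC_neq; lra).
  assert (HD : D <> RtoC 0).
  { unfold D. intros E. apply (one_minus_sqr_neq_0 z Hz).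
    replace (1 - z * z)%C with ((1 - z * z) / 2 * 2)%C by (field; exact E2). rewrite E. ring. }
  exists (A z * D)%C, (Cconj (B z) * Cconj D)%C. split; [|split].
  - eapply wirt_eq.
    + apply (wirt_comp strip_map F w D 0 (A z) (Cconj (B z))).
      apply wirt_strip_map, Hw. apply wirt_step_extension, Hz.
    + replace (Cconj 0) with (RtoC 0) by (apply C_ext; cbn; ring). ring.
    + ring.
  - rewrite !Cmod_mult, !Cmod_conj. apply Rmult_lt_compat_r. apply Cmod_gt_0, HD. apply HJ, Hz.
  - destruct Hn as [N1 [N2 [N3 [N4 _]]]].
    assert (Hpi := PI_RGT_0).
    assert (K1 := arc_kernel_pos z u Hz ltac:(lra)).
    assert (K3 := arc_kernel_pos (- z) u ltac:(rewrite Cmod_opp; exact Hz) ltac:(lra)).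
    replace (1 - - z * - z)%C with (1 - z * z)%C in K3 by ring. fold D in K1, K3.
    assert (Hcs : forall v, cis (v + PI) = (- cis v)%C) by apply cis_PI.
    (* The horizontal derivative is [Re ((A + B) D)], and in [A + B] each jump is added to its
       conjugate, so only real parts of the vertices remain. *)
    assert (E : (A z + B z)%C = (RtoC (/ PI) * (- Ci *
       (RtoC (Re c1) * (/ (cis (- u) - z) - / (cis u - z)) -
        RtoC (Re c3) * (/ (cis (- u) - - z) - / (cis u - - z)))))%C).
    { unfold A, B, cauchy_sum. replace (- u + 2 * u) with u by ring.
      replace (- u + PI + 2 * u) with (u + PI) by ring. rewrite !Hcs.
      assert (Hre : forall v : C, (v + Cconj v)%C = RtoC (2 * Re v)) by (intros v; apply C_ext; destruct v; cbn; ring).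
      assert (Hiv : forall v, (/ (- cis v - z))%C = (- / (cis v - - z))%C).
      { intros v. replace (- cis v - z)%C with (- (cis v - - z))%C by ring.
        assert (cis v - - z <> 0)%C. { intros E. apply (disk_neq_cis (- z) v). rewrite Cmod_opp. exact Hz.
          replace (- z)%C with (cis v - (cis v - - z))%C by ring. rewrite E. ring. }
        field. exact H. }
      unfold Cdiv. rewrite !Hiv.
      set (k1 := (/ (cis (- u) - z))%C). set (k2 := (/ (cis u - z))%C).
      set (k3 := (/ (cis (- u) - - z))%C). set (k4 := (/ (cis u - - z))%C).
      transitivity (- Ci * / RtoC (2 * PI) * (((c1 - c4) + Cconj (c1 - c4)) * k1 + ((c2 - c1) + Cconj (c2 - c1)) * k2 -
        ((c3 - c2) + Cconj (c3 - c2)) * k3 - ((c4 - c3) + Cconj (c4 - c3)) * k4))%C. ring.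
      rewrite !Hre.
      replace (Re (c1 - c4)) with (Re c1 - Re c4) by reflexivity.
      replace (Re (c2 - c1)) with (Re c2 - Re c1) by reflexivity.
      replace (Re (c3 - c2)) with (Re c3 - Re c2) by reflexivity.
      replace (Re (c4 - c3)) with (Re c4 - Re c3) by reflexivity.
      rewrite N2, N4, !RtoC_mult, !RtoC_minus, RtoC_inv by lra.
      field; repeat split; apply RtoC_neq; lra. }
    replace (Re (A z * D + Cconj (B z) * Cconj D)) with (Re ((A z + B z) * D)).
    2: { destruct (A z), (B z), D. cbn. ring. }
    rewrite E.
    replace (Re _) with (/ PI * (Re c1 * Re (- Ci * (D * (/ (cis (- u) - z) - / (cis u - z)))) -
      Re c3 * Re (- Ci * (D * (/ (cis (- u) - - z) - / (cis u - - z)))))).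
    2: { destruct (/ (cis (- u) - z) - / (cis u - z))%C, (/ (cis (- u) - - z) - / (cis u - - z))%C, D. cbn. ring. }
    apply Rmult_lt_0_compat. apply Rinv_0_lt_compat; lra. nra.
Qed.

Lemma normal_step_Re (z : C) : Cmod z < 1 ->
  Re (F z) = Re c1 * arc_measure z (- u) u + Re c3 * arc_measure z (- u + PI) (u + PI) /\
  Re c3 < Re (F z) < Re c1.
Proof.
  intros Hz. destruct Hn as [N1 [N2 [N3 [N4 _]]]].
  assert (E : Re (F z) = Re c1 * arc_measure z (- u) u + Re c3 * arc_measure z (- u + PI) (u + PI)).
  { unfold F, step_extension. replace (- u + 2 * u) with u by ring. replace (- u + PI + 2 * u) with (u + PI) by ring.
    generalize (arc_measure z (- u) u), (arc_measure z u (- u + PI)), (arc_measure z (- u + PI) (u + PI)),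
      (arc_measure z (u + PI) (- u + 2 * PI)). intros m1 m2 m3 m4.
    transitivity (m1 * Re c1 + m2 * Re c2 + m3 * Re c3 + m4 * Re c4). destruct c1, c2, c3, c4; cbn; ring.
    rewrite N2, N4. ring. }
  split. exact E. rewrite E.
  assert (Hsum := arc_measure_sum (- u) (2 * u) z).
  replace (- u + 2 * u) with u in Hsum by ring. replace (- u + PI + 2 * u) with (u + PI) in Hsum by ring.
  assert (Hpi := PI_RGT_0).
  assert (Q1 := arc_measure_pos z (- u) u Hz ltac:(lra)).
  assert (Q2 := arc_measure_pos z u (- u + PI) Hz ltac:(lra)).
  assert (Q3 := arc_measure_pos z (- u + PI) (u + PI) Hz ltac:(lra)).
  assert (Q4 := arc_measure_pos z (u + PI) (- u + 2 * PI) Hz ltac:(lra)).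
  nra.
Qed.

Lemma normal_step_level (c y : R) : Re c3 < c < Re c1 -> - (PI / 2) < y < PI / 2 ->
  exists x, Re (F (strip_map (x, y))) = c.
Proof.
  intros Hc Hy. assert (Hpi := PI_RGT_0). destruct Hn as [N1 [N2 [N3 [N4 _]]]].
  assert (Hst : forall x, strip (x, y)) by (intros x; exact Hy).
  assert (Hcont : forall x, continuous (fun t => Re (F (strip_map (t, y)))) x).
  { intros x. destruct (normal_step_wirt (x, y) (Hst x)) as [a [b [Hw _]]].
    destruct (wirt_partials _ _ _ _ Hw) as [[H _] _].
    apply (ex_derive_continuous (V := R_NormedModule) (fun t => Re (F (strip_map (t, y))))). exists (Re (a + b)). exact H. }
  assert (Hsmall : forall d, 0 < d -> exists M, 0 < M /\ 2 * exp (- M) < d).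
  { intros d Hd. exists (Rmax 1 (1 - ln (d / 2))). assert (Hm1 := Rmax_l 1 (1 - ln (d / 2))).
    assert (Hm2 := Rmax_r 1 (1 - ln (d / 2))). split. lra.
    assert (exp (- Rmax 1 (1 - ln (d / 2))) < exp (ln (d / 2))) by (apply exp_increasing; lra).
    rewrite exp_ln in H by lra. lra. }
  assert (Hsum : forall z, Cmod z < 1 -> let m1 := arc_measure z (- u) u in
    let m3 := arc_measure z (- u + PI) (u + PI) in
    m1 + arc_measure z u (- u + 2 * PI) = 1 /\ m3 + arc_measure z (u + PI) (- u + PI + 2 * PI) = 1 /\
    0 < m1 /\ 0 < m3 /\ m1 + m3 < 1).
  { intros z Hz. cbv zeta. rewrite !arc_measure_add, !arc_measure_circle.
    assert (Hs := arc_measure_sum (- u) (2 * u) z).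
    replace (- u + 2 * u) with u in Hs by ring. replace (- u + PI + 2 * u) with (u + PI) in Hs by ring.
    assert (Q1 := arc_measure_pos z (- u) u Hz ltac:(lra)).
    assert (Q2 := arc_measure_pos z u (- u + PI) Hz ltac:(lra)).
    assert (Q3 := arc_measure_pos z (- u + PI) (u + PI) Hz ltac:(lra)).
    assert (Q4 := arc_measure_pos z (u + PI) (- u + 2 * PI) Hz ltac:(lra)). lra. }
  assert (Hhi : exists x, c < Re (F (strip_map (x, y)))).
  (* Far to the right the complement of the arc of [c1] has harmonic measure below [eps]; even if
     all of it carried [c3], the value would still exceed [c]. *)
  { set (eps := (Re c1 - c) / (Re c1 - Re c3)).
    assert (He : 0 < eps) by (unfold eps; apply Rdiv_lt_0_compat; lra).
    assert (Ec : c = Re c1 - eps * (Re c1 - Re c3)) by (unfold eps; field; lra).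
    destruct (arc_measure_small (0 + 2 * PI) u (- u + 2 * PI) eps) as [d [Hd P]]; [lra|lra|exact He|].
    destruct (Hsmall d Hd) as [M [HM1 HM]]. exists M.
    specialize (P (strip_map (M, y))). rewrite cis_2PI, cis_0 in P.
    specialize (P (Rle_lt_trans _ _ _ (strip_map_right (M, y) (Hst M)) HM)).
    assert (Hz := strip_map_disk _ (Hst M)). destruct (normal_step_Re _ Hz) as [E _]. rewrite E.
    destruct (Hsum _ Hz) as [S1 [S3 [Q1 [Q3 Q]]]]. nra. }
  assert (Hlo : exists x, Re (F (strip_map (x, y))) < c).
  { set (eps := (c - Re c3) / (Re c1 - Re c3)).
    assert (He : 0 < eps) by (unfold eps; apply Rdiv_lt_0_compat; lra).
    assert (Ec : c = Re c3 + eps * (Re c1 - Re c3)) by (unfold eps; field; lra).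
    destruct (arc_measure_small (PI + 2 * PI) (u + PI) (- u + PI + 2 * PI) eps) as [d [Hd P]]; [lra|lra|exact He|].
    destruct (Hsmall d Hd) as [M [HM1 HM]]. exists (- M).
    specialize (P (strip_map (- M, y))). rewrite cis_2PI in P.
    replace (cis PI) with (RtoC (-1)) in P by (apply C_ext; symmetry; [apply cos_PI | apply sin_PI]).
    specialize (P (Rle_lt_trans _ _ _ (strip_map_left (- M, y) (Hst (- M))) HM)).
    assert (Hz := strip_map_disk _ (Hst (- M))). destruct (normal_step_Re _ Hz) as [E _]. rewrite E.
    destruct (Hsum _ Hz) as [S1 [S3 [Q1 [Q3 Q]]]]. nra. }
  destruct Hhi as [xh Hxh], Hlo as [xl Hxl].
  assert (Hlt : xl < xh).
  { apply Rnot_le_lt. intros Hle. destruct (Rle_lt_or_eq_dec _ _ Hle) as [H|H].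
    - assert (Hm := Re_strict_increasing _ normal_step_wirt _ _ _ Hy H). cbv beta in Hm. lra.
    - subst. lra. }
  destruct (Ranalysis5.IVT_interv (fun x => Re (F (strip_map (x, y))) - c) xl xh) as [x [Hx E]].
  - intros a Ha. apply continuity_pt_minus. apply continuity_pt_filterlim. apply Hcont.
    apply continuity_pt_const. intros ? ?; reflexivity.
  - exact Hlt.
  - lra.
  - lra.
  - exists x. lra.
Qed.

Definition level_abscissa (c y : R) : R := epsilon (inhabits 0) (fun x => Re (F (strip_map (x, y))) = c).

Lemma level_abscissa_spec (c y : R) : Re c3 < c < Re c1 -> - (PI / 2) < y < PI / 2 ->
  Re (F (strip_map (level_abscissa c y, y))) = c.
Proof. intros Hc Hy. unfold level_abscissa. apply epsilon_spec. apply normal_step_level; assumption. Qed.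

Lemma level_abscissa_unique (c x y : R) : Re c3 < c < Re c1 -> - (PI / 2) < y < PI / 2 ->
  Re (F (strip_map (x, y))) = c -> x = level_abscissa c y.
Proof.
  intros Hc Hy E. assert (E' := level_abscissa_spec c y Hc Hy).
  destruct (Rtotal_order x (level_abscissa c y)) as [H|[H|H]]; [|exact H|];
  assert (Hm := Re_strict_increasing _ normal_step_wirt _ _ _ Hy H); cbv beta in Hm; lra.
Qed.

Lemma normal_step_injective (z1 z2 : C) : Cmod z1 < 1 -> Cmod z2 < 1 -> F z1 = F z2 -> z1 = z2.
Proof.
  intros H1 H2 E.
  destruct (normal_step_Re z1 H1) as [_ Hc]. set (c := Re (F z1)) in *.
  destruct (strip_map_surj z1 H1) as [[x1 y1] [S1 E1]]. destruct (strip_map_surj z2 H2) as [[x2 y2] [S2 E2]].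
  assert (U1 : x1 = level_abscissa c y1) by (apply level_abscissa_unique; [exact Hc|exact S1|rewrite E1; reflexivity]).
  assert (U2 : x2 = level_abscissa c y2) by (apply level_abscissa_unique; [exact Hc|exact S2|rewrite E2, <- E; reflexivity]).
  assert (Hinc := level_curve_increasing _ normal_step_wirt c (level_abscissa c)
    (fun y Hy => level_abscissa_spec c y Hc Hy)). cbv beta in Hinc.
  unfold strip in S1, S2; cbn in S1, S2.
  assert (Hy : y1 = y2).
  { destruct (Rtotal_order y1 y2) as [H|[H|H]]; [exfalso|exact H|exfalso].
    - specialize (Hinc y1 y2 ltac:(lra) H ltac:(lra)). rewrite <- U1, <- U2, E1, E2, E in Hinc. lra.
    - specialize (Hinc y2 y1 ltac:(lra) H ltac:(lra)). rewrite <- U1, <- U2, E1, E2, E in Hinc. lra. }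
  rewrite <- E1, <- E2, U1, U2, Hy. reflexivity.
Qed.

Definition level_ordinate (c y : R) : R := Im (F (strip_map (level_abscissa c y, y))).

Lemma level_curve_ends (c : R) : Re c3 < c < Re c1 ->
  (forall y, - (PI / 2) < y < PI / 2 -> side_upper c1 c4 c3 c < level_ordinate c y < side_upper c1 c2 c3 c) /\
  (forall v, side_upper c1 c4 c3 c < v < side_upper c1 c2 c3 c -> exists y, - (PI / 2) < y < PI / 2 /\ level_ordinate c y = v).
Proof.
  intros Hc. assert (Hpi := PI_RGT_0).
  assert (HX : forall y, - (PI / 2) < y < PI / 2 -> Re (F (strip_map (level_abscissa c y, y))) = c)
    by (intros y Hy; apply level_abscissa_spec; assumption).
  apply increasing_between_limits.
  - lra.
  - apply (side_gap _ _ _ _ _ Hn), Hc.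
  - exact (level_curve_increasing _ normal_step_wirt c (level_abscissa c) HX).
  - exact (level_curve_continuous _ normal_step_wirt c (level_abscissa c) HX).
  - intros eps He.
    assert (Hside : forall a b d, exists r, 0 < r /\ forall x, Rabs (x - c) < r ->
      Rabs (side_upper a b d x - side_upper a b d c) < eps / 2).
    { intros a b d. assert (Hcont := continuous_side_upper a b d c).
      assert (He2 : 0 < eps / 2) by lra.
      destruct (Hcont (ball (side_upper a b d c) (mkposreal _ He2)) (locally_ball _ _)) as [r Hr].
      exists r. split. apply cond_pos. intros x Hx. apply Hr. exact Hx. }
    destruct (Hside c1 c4 c3) as [r1 [Hr1 P1]]. destruct (Hside c1 c2 c3) as [r2 [Hr2 P2]].
    (* The nearby point [w] of the sides has an abscissa only close to [c]; half of [eps] is spent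
       on the variation of the two side graphs. *)
    set (e' := Rmin (eps / 2) (Rmin r1 r2)).
    assert (He' : 0 < e') by (repeat apply Rmin_pos; lra).
    assert (L0 := Rmin_l (eps / 2) (Rmin r1 r2)). assert (L1 := Rmin_r (eps / 2) (Rmin r1 r2)).
    assert (L2 := Rmin_l r1 r2). assert (L3 := Rmin_r r1 r2). fold e' in L0, L1.
    destruct (near_boundary_uniform F (on_sides c1 c2 c3 c4)) with (eps := e') as [d [Hd Hnear]].
    + intros z0 Hz0. intros ep Hep.
      destruct (cluster_in_sides (- u) (2 * u) c1 c2 c3 c4 z0 ltac:(lra) Hz0) as [a [b [Hab Hcl]]].
      destruct (Hcl ep Hep) as [d [Hd Hcl']]. exists d. split. exact Hd. intros z Hz Hzz.
      destruct (Hcl' z Hz Hzz) as [w [Hw1 Hw2]]. exists w. split. apply Hab, Hw1. exact Hw2.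
    + exact He'.
    (* Beyond this height [cos y < PI / 2 - |y| < d / 2], so [|z| >= |z|^2 >= 1 - 2 cos y > 1 - d].
       The minimum with [PI / 4] keeps the bound positive. *)
    + exists (PI / 2 - Rmin (d / 2) (PI / 4)).
      assert (M1 := Rmin_l (d / 2) (PI / 4)). assert (M2 := Rmin_r (d / 2) (PI / 4)).
      assert (M3 : 0 < Rmin (d / 2) (PI / 4)) by (apply Rmin_pos; lra).
      split. lra. intros y Hy Hyabs.
      assert (Hst : strip (level_abscissa c y, y)) by exact Hy.
      assert (Hcos : 2 * cos y < d).
      { assert (Habs : Rabs y < PI / 2) by (apply Rabs_lt_between; lra).
        replace (cos y) with (sin (PI / 2 - Rabs y)).
        - assert (sin (PI / 2 - Rabs y) < PI / 2 - Rabs y) by (apply sin_lt_x; lra). lra.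
        - rewrite sin_shift. unfold Rabs. destruct (Rcase_abs y). apply cos_neg. reflexivity. }
      assert (Hz := strip_map_disk _ Hst). assert (Hb := strip_map_boundary _ Hst).
      change (Im (level_abscissa c y, y)) with y in Hb.
      set (z := strip_map (level_abscissa c y, y)) in *.
      assert (Hz0 := Cmod_ge_0 z).
      destruct (Hnear z Hz) as [w [Hw1 Hw2]]. nra.
      apply (on_sides_normal _ _ _ _ _ Hn) in Hw1. destruct Hw1 as [_ Hw1].
      assert (HRe : Rabs (Re w - c) < e').
      { rewrite <- (HX y Hy). fold z. rewrite Rabs_minus_sym.
        eapply Rle_lt_trans. 2: exact Hw2. apply (re_le_Cmod (F z - w)). }
      assert (HIm : Rabs (level_ordinate c y - Im w) < e').
      { eapply Rle_lt_trans. 2: exact Hw2. unfold level_ordinate. fold z.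
        eapply Rle_trans. 2: apply Rmax_Cmod. apply (Rle_trans _ (Rabs (snd (F z - w)%C))).
        apply Rle_refl. apply Rmax_r. }
      specialize (P1 (Re w) ltac:(lra)). specialize (P2 (Re w) ltac:(lra)).
      apply Rabs_lt_between in HIm. apply Rabs_lt_between in P1. apply Rabs_lt_between in P2.
      destruct Hw1 as [Hw1|Hw1]; [left|right]; apply Rabs_lt_between; lra.
Qed.

Lemma normal_step_image (w : C) : region c1 c2 c3 c4 w <-> exists z, Cmod z < 1 /\ F z = w.
Proof.
  rewrite (region_normal _ _ _ _ _ Hn), (depth_pos _ _ _ _ _ Hn). split.
  - intros [Hr Hi]. destruct (level_curve_ends (Re w) Hr) as [_ H].
    destruct (H (Im w) Hi) as [y [Hy E]].
    exists (strip_map (level_abscissa (Re w) y, y)). split. apply strip_map_disk. exact Hy.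
    apply C_ext. apply level_abscissa_spec; assumption. exact E.
  - intros [z [Hz <-]]. destruct (normal_step_Re z Hz) as [_ Hc]. split. exact Hc.
    destruct (level_curve_ends (Re (F z)) Hc) as [H _].
    destruct (strip_map_surj z Hz) as [[x y] [S E]].
    assert (Ux := level_abscissa_unique (Re (F z)) x y Hc S ltac:(rewrite E; reflexivity)).
    specialize (H y S). unfold level_ordinate in H. rewrite <- Ux, E in H. exact H.
Qed.
End NormalStep.

(** * Choice of the diagonal and reduction to the normalised case *)

Definition orient (a b c : C) : R := Im (Cconj (b - a) * (c - a)).

(** [orient c d] is affine along [a b] and changes sign, so its zero divides the segment in the
    ratio of the end values; the parameter along [c d] is found in the same way and gives the same
    point. *)
Lemma segments_cross (a b c d : C) :
  orient a b c * orient a b d < 0 -> orient c d a * orient c d b < 0 ->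
  exists z, closed_segment a b z /\ closed_segment c d z.
Proof.
  intros H1 H2.
  assert (Hfrac : forall x y : R, x * y < 0 -> x - y <> 0 /\ 0 <= x / (x - y) <= 1).
  { intros x y Hxy. assert (Hne : x - y <> 0) by (intros E; assert (x = y) by lra; subst; nra).
    split. exact Hne. destruct (Rlt_le_dec 0 (x - y)) as [Hp|Hp].
    - assert (0 < x) by nra. split. apply Rdiv_le_0_compat; lra. apply Rle_div_l. lra. nra.
    - replace (x / (x - y)) with (- x / - (x - y)) by (field; exact Hne).
      assert (x < 0) by nra. split. apply Rdiv_le_0_compat; lra. apply Rle_div_l. lra. nra. }
  destruct (Hfrac _ _ H1) as [N1 T1]. destruct (Hfrac _ _ H2) as [N2 T2].
  set (t := orient c d a / (orient c d a - orient c d b)) in *.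
  set (r := orient a b c / (orient a b c - orient a b d)) in *.
  exists ((1 - t)%R * a + t * b)%C. split. { exists t. auto. }
  exists r. split. exact T1. unfold t, r, orient in *.
  destruct a as [a1 a2], b as [b1 b2], c as [c1 c2], d as [d1 d2]. cbn in *.
  apply C_ext; cbn; field; split; assumption.
Qed.

(** The two corner triangles cut off by a diagonal have together the signed area of [Q], so of two
    opposite corners at most one is negative. If both pairs contained a negative corner, the two
    negative corners would be adjacent, and the signs would force two opposite sides to cross. *)
Lemma quadrilateral_diagonal (b1 b2 b3 b4 : C) : quadrilateral b1 b2 b3 b4 ->
  (0 < orient b4 b1 b2 /\ 0 < orient b2 b3 b4) \/ (0 < orient b1 b2 b3 /\ 0 < orient b3 b4 b1).
Proof.
  intros [N2 [N3 [N4 [N1 [X1 [X2 HA]]]]]].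
  unfold collinear in *.
  change (orient b1 b2 b3 <> 0) in N2. change (orient b2 b3 b4 <> 0) in N3.
  change (orient b3 b4 b1 <> 0) in N4. change (orient b4 b1 b2 <> 0) in N1.
  assert (S1 : orient b4 b1 b2 + orient b2 b3 b4 = 2 * signed_area b1 b2 b3 b4).
  { unfold orient, signed_area. destruct b1, b2, b3, b4; cbn; field. }
  assert (S2 : orient b1 b2 b3 + orient b3 b4 b1 = 2 * signed_area b1 b2 b3 b4).
  { unfold orient, signed_area. destruct b1, b2, b3, b4; cbn; field. }
  assert (C1 : orient b2 b3 b1 = orient b1 b2 b3) by (unfold orient; destruct b1, b2, b3; cbn; ring).
  assert (C2 : orient b3 b4 b2 = orient b2 b3 b4) by (unfold orient; destruct b2, b3, b4; cbn; ring).
  assert (C3 : orient b4 b1 b3 = orient b3 b4 b1) by (unfold orient; destruct b1, b3, b4; cbn; ring).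
  assert (C4 : orient b1 b2 b4 = orient b4 b1 b2) by (unfold orient; destruct b1, b2, b4; cbn; ring).
  assert (K1 : ~ (orient b2 b3 b4 * orient b1 b2 b3 < 0 /\ orient b4 b1 b2 * orient b3 b4 b1 < 0)).
  { intros [K K']. destruct (segments_cross b2 b3 b4 b1) as [z Hz]; rewrite ?C1, ?C3; try assumption.
    exact (X2 z Hz). }
  assert (K2 : ~ (orient b1 b2 b3 * orient b4 b1 b2 < 0 /\ orient b3 b4 b1 * orient b2 b3 b4 < 0)).
  { intros [K K']. destruct (segments_cross b1 b2 b3 b4) as [z Hz]; rewrite ?C2, ?C4; try assumption.
    exact (X1 z Hz). }
  set (o1 := orient b4 b1 b2) in *. set (o2 := orient b1 b2 b3) in *.
  set (o3 := orient b2 b3 b4) in *. set (o4 := orient b3 b4 b1) in *.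
  destruct (Rtotal_order o1 0) as [P1|[P1|P1]]; [|contradiction|];
  (destruct (Rtotal_order o2 0) as [P2|[P2|P2]]; [|contradiction|]);
  (destruct (Rtotal_order o3 0) as [P3|[P3|P3]]; [|contradiction|]);
  (destruct (Rtotal_order o4 0) as [P4|[P4|P4]]; [|contradiction|]);
  try lra; solve [exfalso; apply K1; split; nra | exfalso; apply K2; split; nra].
Qed.

Lemma closed_segment_affine (k l a b z : C) :
  closed_segment a b z -> closed_segment (k * (a - l)) (k * (b - l)) (k * (z - l))%C.
Proof.
  intros [t [Ht ->]]. exists t. split. exact Ht. rewrite RtoC_minus. ring.
Qed.

Lemma on_sides_affine (k l v1 v2 v3 v4 z : C) : on_sides v1 v2 v3 v4 z ->
  on_sides (k * (v1 - l)) (k * (v2 - l)) (k * (v3 - l)) (k * (v4 - l)) (k * (z - l))%C.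
Proof.
  unfold on_sides. intros [H|[H|[H|H]]]; apply (closed_segment_affine k l) in H; auto.
Qed.

(** The inverse of [k (z - l)] has again this shape, with [/ k] and [- (k l)], so invariance of the
    region needs one implication only. *)
Lemma affine_cancel (k l z : C) : k <> RtoC 0 -> (/ k * (k * (z - l) - - (k * l)))%C = z.
Proof. intros Hk. field. exact Hk. Qed.

Lemma region_affine_imp (k l v1 v2 v3 v4 w : C) : k <> RtoC 0 -> region v1 v2 v3 v4 w ->
  region (k * (v1 - l)) (k * (v2 - l)) (k * (v3 - l)) (k * (v4 - l)) (k * (w - l))%C.
Proof.
  intros Hk [Hns [M HM]].
  assert (Hback : forall z, on_sides (k * (v1 - l)) (k * (v2 - l)) (k * (v3 - l)) (k * (v4 - l)) z ->
    on_sides v1 v2 v3 v4 (/ k * (z - - (k * l)))%C).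
  { intros z Hz. apply (on_sides_affine (/ k)%C (- (k * l))%C) in Hz. rewrite !affine_cancel in Hz by exact Hk.
    exact Hz. }
  split.
  - intros H. apply Hns. apply Hback in H. rewrite affine_cancel in H by exact Hk. exact H.
  - exists (Cmod k * (M + Cmod l)). intros gamma Hc H0 Hg.
    assert (HB := HM (fun t => / k * (gamma t - - (k * l)))%C).
    assert (HB' : Cmod (/ k * (gamma 1 - - (k * l))) <= M).
    { apply HB.
      - intros t. apply (continuous_comp (U := R_UniformSpace) (V := C_UniformSpace) (W := C_UniformSpace) gamma
          (fun z => / k * (z - - (k * l)))%C). apply Hc.
        eapply wirt_continuous. apply wirt_scal, wirt_minus. apply wirt_id. apply wirt_const.
      - rewrite H0. apply affine_cancel, Hk.
      - intros t Ht Hon. apply (Hg t Ht). apply (on_sides_affine k l) in Hon.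
        replace (k * (/ k * (gamma t - - (k * l)) - l))%C with (gamma t) in Hon by (field; exact Hk). exact Hon. }
    replace (gamma 1) with (k * ((/ k * (gamma 1 - - (k * l))) + - l))%C by (field; exact Hk).
    rewrite Cmod_mult. apply Rmult_le_compat_l. apply Cmod_ge_0.
    eapply Rle_trans. apply Cmod_triangle. rewrite Cmod_opp. lra.
Qed.

Lemma region_affine (k l v1 v2 v3 v4 w : C) : k <> RtoC 0 ->
  region (k * (v1 - l)) (k * (v2 - l)) (k * (v3 - l)) (k * (v4 - l)) (k * (w - l))%C <-> region v1 v2 v3 v4 w.
Proof.
  intros Hk. split.
  - intros H. apply (region_affine_imp (/ k)%C (- (k * l))%C) in H. rewrite !affine_cancel in H by exact Hk. exact H.
    intros E. apply Hk. replace k with (k * (k * / k))%C. rewrite E. ring. field. exact Hk.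
  - apply region_affine_imp, Hk.
Qed.

Lemma region_cycle (v1 v2 v3 v4 w : C) : region v1 v2 v3 v4 w <-> region v2 v3 v4 v1 w.
Proof.
  assert (H : forall z, on_sides v1 v2 v3 v4 z <-> on_sides v2 v3 v4 v1 z) by (unfold on_sides; tauto).
  unfold region. split; intros [Hns [M HM]]; (split; [rewrite ?H, <- ?H in *; tauto|]); exists M;
    intros gamma Hc H0 Hg; apply HM; auto; intros t Ht Hon; apply (Hg t Ht), H, Hon.
Qed.

Lemma cauchy_sum_rot (t s w : R) (j1 j2 j3 j4 z : C) :
  cauchy_sum (t + w) s j1 j2 j3 j4 (z * cis w)%C = (cis (- w) * cauchy_sum t s j1 j2 j3 j4 z)%C.
Proof.
  unfold cauchy_sum.
  assert (Hd : forall v, (/ (cis (v + w) - z * cis w))%C = (cis (- w) * / (cis v - z))%C).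
  { intros v. rewrite cis_plus. destruct (Ceq_dec (cis v - z) 0) as [E|E].
    - replace (cis v * cis w - z * cis w)%C with ((cis v - z) * cis w)%C by ring. rewrite E, Cmult_0_l.
      apply C_ext; cbn; unfold Rdiv; ring.
    - transitivity ((cis w * cis (- w)) * / (cis v * cis w - z * cis w))%C. rewrite cis_opp_mult. ring.
      field. split. exact E.
      replace (cis v * cis w - z * cis w)%C with ((cis v - z) * cis w)%C by ring.
      apply Cmult_neq_0. exact E. apply cis_neq_0. }
  replace (t + w + s) with (t + s + w) by ring. replace (t + w + PI) with (t + PI + w) by ring.
  replace (t + PI + w + s) with (t + PI + s + w) by ring.
  unfold Cdiv. rewrite !Hd. ring.
Qed.

Lemma cauchy_sum_scal (t s : R) (k j1 j2 j3 j4 z : C) :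
  cauchy_sum t s (k * j1) (k * j2) (k * j3) (k * j4) z = (k * cauchy_sum t s j1 j2 j3 j4 z)%C.
Proof. unfold cauchy_sum, Cdiv. ring. Qed.

Lemma step_extension_bijective (t s : R) (v1 v2 v3 v4 : C) : 0 < s < PI ->
  0 < orient v4 v1 v2 -> 0 < orient v2 v3 v4 ->
  (forall z, Cmod z < 1 ->
    Cmod (cauchy_sum t s (Cconj (v1 - v4)) (Cconj (v2 - v1)) (Cconj (v3 - v2)) (Cconj (v4 - v3)) z) <
    Cmod (cauchy_sum t s (v1 - v4) (v2 - v1) (v3 - v2) (v4 - v3) z)) ->
  let f := step_extension t s v1 v2 v3 v4 in
  (forall z1 z2, Cmod z1 < 1 -> Cmod z2 < 1 -> f z1 = f z2 -> z1 = z2) /\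
  (forall w, region v1 v2 v3 v4 w <-> exists z, Cmod z < 1 /\ f z = w) /\
  @open C_UniformSpace (region v1 v2 v3 v4).
Proof.
  intros Hs H4 H2 HJ f.
  (* Multiplication by [k] turns the diagonal from [v4] to [v2] into the positive imaginary axis;
     the real parts of [c1] and [c3] are then [orient v4 v1 v2] and [- orient v2 v3 v4]. *)
  set (k := (Ci * Cconj (v2 - v4))%C).
  set (c1 := (k * (v1 - v4))%C). set (c2 := (k * (v2 - v4))%C).
  set (c3 := (k * (v3 - v4))%C). set (c4 := (k * (v4 - v4))%C).
  assert (Hk : k <> RtoC 0).
  { intros E. revert H4. unfold orient.
    assert (E2 : (v2 - v4)%C = RtoC 0).
    { rewrite <- (Cconj_conj (v2 - v4)). replace (Cconj (v2 - v4)) with (- Ci * k)%C.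
      rewrite E. apply C_ext; cbn; ring. unfold k. apply C_ext; cbn; ring. }
    rewrite E2. intros H. replace (Im (Cconj (v1 - v4) * 0)) with 0 in H by (cbn; ring). lra. }
  assert (Hn : normal_quad c1 c2 c3 c4).
  { unfold normal_quad, c1, c2, c3, c4, k. unfold orient in H2, H4.
    assert (Hm : 0 < Cmod (v2 - v4)).
    { apply Cmod_gt_0. intros E. apply Hk. unfold k. rewrite E. apply C_ext; cbn; ring. }
    assert (Hm2 := Cmod2_alt (v2 - v4)). assert (Hm3 : 0 < Cmod (v2 - v4) ^ 2) by (apply pow_lt, Hm).
    rewrite Hm2 in Hm3.
    destruct v1, v2, v3, v4. cbn in *. repeat split; nra. }
  (* The midpoint of the arc carrying [v1], rotated to angle [0]. *)
  set (w := t + s / 2).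
  assert (Hf : forall z, (k * (f z - v4))%C = step_extension (- (s / 2)) (2 * (s / 2)) c1 c2 c3 c4 (z * cis (- w))%C).
  { intros z. unfold f. rewrite step_extension_affine. fold c1 c2 c3 c4.
    replace (2 * (s / 2)) with s by field.
    rewrite <- (step_extension_rot (- (s / 2)) s w).
    replace (- (s / 2) + w) with t by (unfold w; field). f_equal.
    transitivity (z * (cis w * cis (- w)))%C. rewrite cis_opp_mult. ring. ring. }
  (* Rotation multiplies both sums by the same unimodular number, and the similarity multiplies one
     by [k] and the other by [conj k], so the inequality between the moduli survives. *)
  assert (HJ' : forall z, Cmod z < 1 ->
    Cmod (cauchy_sum (- (s / 2)) (2 * (s / 2)) (Cconj (c1 - c4)) (Cconj (c2 - c1)) (Cconj (c3 - c2)) (Cconj (c4 - c3)) z) <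
    Cmod (cauchy_sum (- (s / 2)) (2 * (s / 2)) (c1 - c4) (c2 - c1) (c3 - c2) (c4 - c3) z)).
  { intros z Hz.
    assert (Hz' : Cmod (z * cis w) < 1) by (rewrite Cmod_mult, Cmod_cis; lra).
    specialize (HJ _ Hz'). replace t with (- (s / 2) + w) in HJ by (unfold w; field).
    rewrite !cauchy_sum_rot, !(Cmod_mult (cis (- w))), !Cmod_cis, !Rmult_1_l in HJ.
    replace (2 * (s / 2)) with s by field.
    assert (Hd : forall a b, (k * (a - v4) - k * (b - v4))%C = (k * (a - b))%C) by (intros; ring).
    unfold c1, c2, c3, c4. rewrite !Hd, !(Cmult_conj k), !cauchy_sum_scal, !Cmod_mult, Cmod_conj.
    apply Rmult_lt_compat_l. apply Cmod_gt_0, Hk. exact HJ. }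
  assert (Hu : 0 < s / 2 < PI / 2) by lra.
  assert (Hinj := normal_step_injective _ _ _ _ _ Hu Hn HJ').
  assert (Himg := fun w => normal_step_image _ _ _ _ _ Hu Hn HJ' w).
  assert (Hrot : forall z u, Cmod (z * cis u) = Cmod z) by (intros; rewrite Cmod_mult, Cmod_cis; ring).
  assert (Hrc : forall z u, (z * cis u * cis (- u))%C = z).
  { intros z u. transitivity (z * (cis u * cis (- u)))%C. ring. rewrite cis_opp_mult. ring. }
  split; [|split].
  - intros z1 z2 H1' H2' E.
    assert (E' : (z1 * cis (- w) = z2 * cis (- w))%C).
    { apply Hinj; rewrite ?Hrot; try assumption. rewrite <- !Hf, E. reflexivity. }
    rewrite <- (Hrc z1 (- w)), <- (Hrc z2 (- w)), E'. reflexivity.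
  - intros y. rewrite <- (region_affine k v4 v1 v2 v3 v4 y Hk). fold c1 c2 c3 c4. rewrite Himg. split.
    + intros [z [Hz E]]. exists (z * cis w)%C. split. rewrite Hrot; exact Hz.
      assert (E' := Hf (z * cis w)%C). rewrite Hrc, E in E'.
      rewrite <- (affine_cancel k v4 (f (z * cis w)%C) Hk), E'. apply affine_cancel, Hk.
    + intros [z [Hz <-]]. exists (z * cis (- w))%C. split. rewrite Hrot; exact Hz. rewrite Hf. reflexivity.
  - apply (open_ext (T := C_UniformSpace) (fun y => 0 < depth c1 c2 c3 c4 (k * (y - v4))%C)).
    + intros y. rewrite <- (region_affine k v4 v1 v2 v3 v4 y Hk). symmetry. apply region_normal, Hn.
    + apply (open_comp (T := C_UniformSpace) (U := R_UniformSpace) (fun y => depth c1 c2 c3 c4 (k * (y - v4))%C) (fun x => 0 < x)).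
      2: apply open_gt.
      intros y _. apply (continuous_comp (U := C_UniformSpace) (V := C_UniformSpace) (W := R_UniformSpace)
        (fun y => k * (y - v4))%C (depth c1 c2 c3 c4)).
      * eapply wirt_continuous. apply wirt_scal, wirt_minus. apply wirt_id. apply wirt_const.
      * apply continuous_depth.
Qed.

(** * The Weierstrass data *)

Lemma Csqrt_exists (z : C) : exists w, (w * w)%C = z.
Proof.
  destruct (Ceq_dec z 0) as [->|Hz]. { exists (RtoC 0). ring. }
  assert (Hm : 0 < Cmod z) by (apply Cmod_gt_0, Hz).
  assert (Hm' : RtoC (Cmod z) <> RtoC 0) by (apply RtoC_neq; lra).
  destruct (cis_surj (z / Cmod z)%C 0) as [u [_ Hu]].
  { rewrite Cmod_div, Cmod_R, Rabs_pos_eq by (lra || exact Hm'). field. lra. }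
  exists (RtoC (sqrt (Cmod z)) * cis (u / 2))%C.
  transitivity (RtoC (sqrt (Cmod z) * sqrt (Cmod z)) * (cis (u / 2) * cis (u / 2)))%C.
  { rewrite RtoC_mult. ring. }
  rewrite sqrt_sqrt by lra. rewrite <- cis_plus. replace (u / 2 + u / 2) with u by field.
  rewrite Hu. field. exact Hm'.
Qed.

Lemma Cmult_reg (k x y : C) : k <> RtoC 0 -> (k * x)%C = (k * y)%C -> x = y.
Proof.
  intros Hk H. transitivity (/ k * (k * x))%C. field. exact Hk. rewrite H. field. exact Hk.
Qed.

Lemma Cmod_sqr (z : C) : Cmod (z * z) = Cmod z ^ 2.
Proof. rewrite Cmod_mult. ring. Qed.

(* With [al^2 = a], [be^2 = - b], [ga^2 = c], [de^2 = - d], the number [X] below has modulus one,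
   and its real part is the cosine of the angle [p]. *)
Lemma pitot_cosine_aux (al be ga de : C) :
  (al * al + ga * ga = be * be + de * de)%C -> (al * al + ga * ga)%C <> RtoC 0 ->
  Cmod (al + Ci * ga) = Cmod (be - Ci * de) -> Cmod (al - Ci * ga) = Cmod (be + Ci * de) ->
  exists x : R, Rabs x <= 1 /\
    let s := (al * al + ga * ga)%C in let m := (al * al - ga * ga)%C in let n := (de * de - be * be)%C in
    (s * s * (1 - x * x) = m * m + n * n + 2 * m * n * x)%C.
Proof.
  intros Es Hs0 E1 E2.
  set (P := (al + Ci * ga)%C) in *. set (P' := (al - Ci * ga)%C) in *.
  set (R := (be + Ci * de)%C) in *. set (R' := (be - Ci * de)%C) in *.
  assert (ECi : (Ci * Ci)%C = (- (1))%C) by (apply C_ext; cbn; ring).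
  assert (EP : (P * P')%C = (al * al + ga * ga)%C).
  { unfold P, P'. transitivity (al * al - Ci * Ci * (ga * ga))%C. ring. rewrite ECi. ring. }
  assert (ER : (R * R')%C = (al * al + ga * ga)%C).
  { unfold R, R'. rewrite Es. transitivity (be * be - Ci * Ci * (de * de))%C. ring. rewrite ECi. ring. }
  set (s := (al * al + ga * ga)%C) in *.
  assert (HP : P <> RtoC 0) by (intros E; apply Hs0; rewrite <- EP, E; ring).
  assert (HP' : P' <> RtoC 0) by (intros E; apply Hs0; rewrite <- EP, E; ring).
  assert (HR : R <> RtoC 0) by (intros E; apply Hs0; rewrite <- ER, E; ring).
  assert (HR' : R' <> RtoC 0) by (intros E; apply Hs0; rewrite <- ER, E; ring).
  (* Because [P P' = R R' = s], the product [s^2 X] is the square of [P R]. The conjugate of the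
     unimodular [X] is its inverse, so [s^2 conj X] is the square of [P' R'], and [s^2 Re X] becomes
     a polynomial in the four roots. *)
  set (X := (P * R / (P' * R'))%C).
  assert (HX : Cmod X = 1).
  { unfold X. rewrite Cmod_div, !Cmod_mult, E1, E2 by (apply Cmult_neq_0; assumption).
    assert (0 < Cmod R) by (apply Cmod_gt_0, HR). assert (0 < Cmod R') by (apply Cmod_gt_0, HR').
    field. split; lra. }
  assert (HX1 : (s * s * X)%C = (P * R * (P * R))%C).
  { transitivity ((P * P') * (R * R') * X)%C. rewrite EP, ER. ring. unfold X. field. split; assumption. }
  assert (HXc : (X * Cconj X)%C = RtoC 1).
  { rewrite <- Cmod2_conj, HX. f_equal. ring. }
  assert (HX2 : (s * s * Cconj X)%C = (P' * R' * (P' * R'))%C).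
  { assert (HX0 : X <> RtoC 0) by (apply Cmod_gt_0; lra).
    apply (Cmult_reg X). exact HX0.
    transitivity (s * s * (X * Cconj X))%C. ring. rewrite HXc.
    transitivity ((P * P') * (R * R'))%C. rewrite EP, ER. ring. unfold X. field. split; assumption. }
  assert (E2' : RtoC 2 <> RtoC 0) by (apply RtoC_neq; lra).
  assert (HC : RtoC (Re X) = ((X + Cconj X) / 2)%C).
  { apply re_alt. }
  exists (Re X). split. { rewrite <- HX. apply re_le_Cmod. }
  cbv zeta.
  set (m := (al * al - ga * ga)%C). set (n := (de * de - be * be)%C).
  assert (HsC : (s * s * RtoC (Re X))%C = (- (m * n) - 4 * (al * be * ga * de))%C).
  { rewrite HC. transitivity ((s * s * X + s * s * Cconj X) / 2)%C. (field; exact E2').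
    rewrite HX1, HX2. apply (Cmult_reg 2). exact E2'.
    transitivity (P * R * (P * R) + P' * R' * (P' * R'))%C. (field; exact E2').
    unfold P, R, P', R', m, n. 
    replace (RtoC 4) with (2 * 2)%C by (rewrite <- RtoC_mult; f_equal; ring).
    transitivity (2 * ((al * al + Ci * Ci * (ga * ga)) * (be * be + Ci * Ci * (de * de)) + 4 * (Ci * Ci) * (al * be * ga * de)))%C.
    replace (RtoC 4) with (2 * 2)%C by (rewrite <- RtoC_mult; f_equal; ring).
    replace (RtoC 2) with (1 + 1)%C by (rewrite <- RtoC_plus; f_equal; ring). ring.
    rewrite ECi. replace (RtoC 4) with (2 * 2)%C by (rewrite <- RtoC_mult; f_equal; ring). ring. }
  (* After multiplication by [s^2] the cosine occurs only through [s^2 Re X], known from [HsC]. The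
     rest is an identity once [s^2 - m^2] and [s^2 - n^2] are written as products of the squared
     roots. *)
  apply (Cmult_reg (s * s)). apply Cmult_neq_0; exact Hs0.
  transitivity (s * s * (s * s) - (s * s * RtoC (Re X)) * (s * s * RtoC (Re X)))%C. ring.
  transitivity (s * s * (m * m + n * n) + 2 * m * n * (s * s * RtoC (Re X)))%C. 2: ring.
  rewrite HsC.
  assert (Hsm : (s * s - m * m)%C = (4 * (al * al) * (ga * ga))%C).
  { unfold s, m. replace (RtoC 4) with ((1 + 1) * (1 + 1))%C by (rewrite <- !RtoC_plus, <- RtoC_mult; f_equal; ring). ring. }
  assert (Hsn : (s * s - n * n)%C = (4 * (be * be) * (de * de))%C).
  { unfold n. rewrite Es. replace (RtoC 4) with ((1 + 1) * (1 + 1))%C by (rewrite <- !RtoC_plus, <- RtoC_mult; f_equal; ring). ring. }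
  transitivity ((s * s - m * m) * (s * s - n * n) + s * s * (m * m + n * n) - m * n * (m * n)
    - (- (m * n) - 4 * (al * be * ga * de)) * (- (m * n) - 4 * (al * be * ga * de)))%C. ring.
  rewrite Hsm, Hsn.
  replace (RtoC 4) with ((1 + 1) * (1 + 1))%C by (rewrite <- !RtoC_plus, <- RtoC_mult; f_equal; ring).
  replace (RtoC 2) with (1 + 1)%C by (rewrite <- RtoC_plus; f_equal; ring). ring.
Qed.

Lemma Cmod_parallelogram (x y : C) :
  Cmod (x + Ci * y) ^ 2 + Cmod (x - Ci * y) ^ 2 = 2 * (Cmod (x * x) + Cmod (y * y)).
Proof. rewrite !Cmod_sqr, !Cmod2_alt. destruct x, y; cbn; ring. Qed.

(** If [a + c = 0] the sides form a parallelogram, by the Pitot condition a rhombus, and the cosine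
    is [- Re (a / b)]. Otherwise the moduli [x, x'] and [y, y'] have equal products, both [|a + c|],
    and by the parallelogram law and the Pitot condition equal sums of squares. So they agree as
    unordered pairs, and replacing [de] by [- de] puts them in the order that [pitot_cosine_aux]
    requires. *)
Lemma pitot_cosine (a b c d : C) :
  (a + b + c + d)%C = RtoC 0 -> Cmod a + Cmod c = Cmod b + Cmod d -> a <> RtoC 0 -> b <> RtoC 0 ->
  exists x : R, Rabs x <= 1 /\
    ((a + c) * (a + c) * (1 - x * x) = (a - c) * (a - c) + (b - d) * (b - d) + 2 * (a - c) * (b - d) * x)%C.
Proof.
  intros Hsum Hp Ha Hb.
  assert (Hs : (a + c)%C = (- b - d)%C).
  { transitivity ((a + b + c + d) - b - d)%C. ring. rewrite Hsum. ring. }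
  destruct (Ceq_dec (a + c) 0) as [Hs0|Hs0].
  - assert (Ec : c = (- a)%C). { transitivity ((a + c) - a)%C. ring. rewrite Hs0. ring. }
    assert (Ed : d = (- b)%C). { transitivity ((- (- b - d)) - b)%C. ring. rewrite <- Hs, Hs0. ring. }
    subst c d. rewrite !Cmod_opp in Hp.
    assert (Hm : 0 < Cmod b) by (apply Cmod_gt_0, Hb).
    set (r := (a / b)%C).
    assert (Hr : Cmod r = 1). { unfold r. rewrite Cmod_div by exact Hb. replace (Cmod a) with (Cmod b) by lra. field. lra. }
    assert (Hrc : (r * Cconj r)%C = RtoC 1). { rewrite <- Cmod2_conj, Hr. f_equal. ring. }
    assert (E2' : RtoC 2 <> RtoC 0) by (apply RtoC_neq; lra).
    exists (- Re r). split. { rewrite Rabs_Ropp, <- Hr. apply re_le_Cmod. }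
    rewrite RtoC_opp. replace (RtoC (Re r)) with ((r + Cconj r) / 2)%C by (symmetry; apply re_alt).
    replace a with (r * b)%C by (unfold r; field; exact Hb).
    transitivity (RtoC 0). ring.
    transitivity ((1 + 1) * (1 + 1) * b * b * (1 - r * Cconj r))%C. rewrite Hrc. ring.
    replace (RtoC 2) with (1 + 1)%C in * by (rewrite <- RtoC_plus; f_equal; ring). (field; exact E2').
  - destruct (Csqrt_exists a) as [al Hal]. destruct (Csqrt_exists (- b)) as [be Hbe].
    destruct (Csqrt_exists c) as [ga Hga]. destruct (Csqrt_exists (- d)) as [de Hde].
    assert (Es : (al * al + ga * ga = be * be + de * de)%C) by (rewrite Hal, Hga, Hbe, Hde, Hs; ring).
    assert (Hs0' : (al * al + ga * ga)%C <> RtoC 0) by (rewrite Hal, Hga; exact Hs0).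
    assert (ECi : (Ci * Ci)%C = (- (1))%C) by (apply C_ext; cbn; ring).
    assert (S1 := Cmod_parallelogram al ga). assert (S2 := Cmod_parallelogram be de).
    rewrite Hal, Hga in S1. rewrite Hbe, Hde, !Cmod_opp in S2.
    assert (Q : Cmod (al + Ci * ga) * Cmod (al - Ci * ga) = Cmod (be + Ci * de) * Cmod (be - Ci * de)).
    { rewrite <- !Cmod_mult. f_equal.
      transitivity (al * al - Ci * Ci * (ga * ga))%C. ring. rewrite ECi.
      transitivity (al * al + ga * ga)%C. ring. rewrite Es.
      transitivity (be * be - Ci * Ci * (de * de))%C. rewrite ECi. ring. ring. }
    set (x := Cmod (al + Ci * ga)) in *. set (x' := Cmod (al - Ci * ga)) in *.
    set (y := Cmod (be + Ci * de)) in *. set (y' := Cmod (be - Ci * de)) in *.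
    assert (Hx : 0 <= x) by apply Cmod_ge_0. assert (Hx' : 0 <= x') by apply Cmod_ge_0.
    assert (Hy : 0 <= y) by apply Cmod_ge_0. assert (Hy' : 0 <= y') by apply Cmod_ge_0.
    assert (Hsq : x ^ 2 + x' ^ 2 = y ^ 2 + y' ^ 2) by lra.
    assert (Hadd : x + x' = y + y') by (apply Rsqr_inj; unfold Rsqr; nra).
    assert (Hprod : (x - y) * (x - y') = 0) by nra.
    destruct (Rmult_integral _ _ Hprod) as [Hxy|Hxy].
    + destruct (pitot_cosine_aux al be ga (- de)) as [C [HC1 HC2]].
      * rewrite Es. ring.
      * exact Hs0'.
      * fold x. replace (be - Ci * - de)%C with (be + Ci * de)%C by ring. fold y. lra.
      * fold x'. replace (be + Ci * - de)%C with (be - Ci * de)%C by ring. fold y'. lra.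
      * exists C. split. exact HC1. cbv zeta in HC2. rewrite Hal, Hga in HC2.
        replace (- de * - de - be * be)%C with (b - d)%C in HC2. exact HC2.
        transitivity (- (be * be) + de * de)%C. rewrite Hbe, Hde. ring. ring.
    + destruct (pitot_cosine_aux al be ga de) as [C [HC1 HC2]].
      * exact Es.
      * exact Hs0'.
      * fold x y'. lra.
      * fold x' y. lra.
      * exists C. split. exact HC1. cbv zeta in HC2. rewrite Hal, Hga in HC2.
        replace (de * de - be * be)%C with (b - d)%C in HC2. exact HC2.
        rewrite Hbe, Hde. ring.
Qed.

(** A cosine of [1] or [- 1] would make the equation a vanishing square, with [a - c] and [b - d]
    opposite or equal; the positive area excludes this. *)
Lemma pitot_angle (a b c d : C) :
  (a + b + c + d)%C = RtoC 0 -> Cmod a + Cmod c = Cmod b + Cmod d -> a <> RtoC 0 -> b <> RtoC 0 ->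
  0 < Im (Cconj (a - c) * (b - d)) ->
  exists p : R, 0 < p < PI /\
    ((a + c) * (a + c) * (1 - cos p * cos p) =
     (a - c) * (a - c) + (b - d) * (b - d) + 2 * (a - c) * (b - d) * cos p)%C.
Proof.
  intros Hsum Hp Ha Hb Harea.
  destruct (pitot_cosine a b c d Hsum Hp Ha Hb) as [x [Hx E]].
  apply Rabs_le_between in Hx.
  assert (Hsq0 : forall w : C, (w * w)%C = RtoC 0 -> w = RtoC 0).
  { intros w H. apply Cmod_eq_0. assert (H1 := Cmod_sqr w). rewrite H, Cmod_0 in H1.
    assert (H2 := Cmod_ge_0 w). nra. }
  assert (Hx1 : x <> 1).
  { intros ->. assert (Hz : ((a - c) + (b - d))%C = RtoC 0).
    { apply Hsq0. transitivity ((a - c) * (a - c) + (b - d) * (b - d) + 2 * (a - c) * (b - d) * 1)%C.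
      replace (RtoC 2) with (1 + 1)%C by (rewrite <- RtoC_plus; f_equal; ring). ring. rewrite <- E. ring. }
    revert Harea. replace (b - d)%C with (- (a - c))%C.
    destruct (a - c)%C; cbn. lra. transitivity (- (a - c) + (a - c + (b - d)))%C. rewrite Hz. ring. ring. }
  assert (Hx2 : x <> -1).
  { intros ->. assert (Hz : ((a - c) - (b - d))%C = RtoC 0).
    { apply Hsq0. transitivity ((a - c) * (a - c) + (b - d) * (b - d) + 2 * (a - c) * (b - d) * RtoC (-1))%C.
      replace (RtoC 2) with (1 + 1)%C by (rewrite <- RtoC_plus; f_equal; ring).
      replace (RtoC (-1)) with (- (1))%C by (rewrite <- RtoC_opp; f_equal; ring). ring. rewrite <- E.
      replace (RtoC (-1)) with (- (1))%C by (rewrite <- RtoC_opp; f_equal; ring). ring. }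
    revert Harea. replace (b - d)%C with (a - c)%C.
    destruct (a - c)%C; cbn. lra. transitivity (a - c - (a - c - (b - d)))%C. rewrite Hz. ring. ring. }
  assert (Hx3 : -1 < x < 1) by (destruct Hx as [[H|H] [H'|H']]; lra || (exfalso; congruence)).
  exists (acos x). split.
  - apply acos_bound_lt. lra.
  - rewrite cos_acos by lra. exact E.
Qed.

(* [mu + nu z] is a square root of the numerator of [h'], which is a perfect square
   exactly when [p] satisfies the equation of [pitot_angle]. *)
Lemma weierstrass_square_root (a b c d : C) (p : R) :
  (a + b + c + d)%C = RtoC 0 -> 0 < p < PI -> 0 < Im (Cconj (a - c) * (b - d)) ->
  ((a + c) * (a + c) * (1 - cos p * cos p) =
     (a - c) * (a - c) + (b - d) * (b - d) + 2 * (a - c) * (b - d) * cos p)%C ->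
  exists mu nu : C, let e := cis p in
    Cmod nu < Cmod mu /\
    ((mu + nu) * (mu + nu) = 2 * a * (e * e - 1))%C /\
    ((mu - nu) * (mu - nu) = - (2 * c * (e * e - 1)))%C /\
    ((mu + nu * e) * (mu + nu * e) = - (2 * b * e * (e * e - 1)))%C /\
    ((mu - nu * e) * (mu - nu * e) = 2 * d * e * (e * e - 1))%C.
Proof.
  intros Hsum Hp Harea Hdisc. set (e := cis p). set (m := (a - c)%C) in *. set (n := (b - d)%C) in *.
  set (s := (a + c)%C) in *.
  assert (Es : s = (- b - d)%C).
  { unfold s. transitivity ((a + b + c + d) - b - d)%C. ring. rewrite Hsum. ring. }
  assert (Hsin : 0 < sin p) by (apply sin_gt_0; lra).
  assert (Hcs := sin2_cos2 p). unfold Rsqr in Hcs.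
  (* Coefficients of the numerator of [a / (1 - z) + b / (e - z) - c / (1 + z) - d / (e + z)] over
     [(1 - z^2) (e^2 - z^2)]. The cubic term is absent because the jumps sum to zero. *)
  set (A0 := (e * (m * e + n))%C). set (A1 := (s * (e * e - 1))%C). set (A2 := (- (m + n * e))%C).
  assert (He1 : (e * e - 1)%C = (2 * Ci * sin p * e)%C).
  { unfold e, cis. apply C_ext; cbn; [|ring]. nra. }
  assert (He2 : (e * e + 1)%C = (2 * cos p * e)%C).
  { unfold e, cis. apply C_ext; cbn; [|ring]. nra. }
  assert (Hs2 : RtoC (sin p * sin p) = (1 - cos p * cos p)%C).
  { rewrite <- RtoC_mult, <- RtoC_minus. f_equal. lra. }
  assert (ECi : (Ci * Ci)%C = (- (1))%C) by (apply C_ext; cbn; ring).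
  assert (E4 : RtoC 4 = (2 * 2)%C) by (rewrite <- RtoC_mult; f_equal; ring).
  assert (Hd : (A1 * A1)%C = (4 * A0 * A2)%C).
  { unfold A1, A0, A2. rewrite He1.
    transitivity (4 * (Ci * Ci) * (e * e) * (s * s * RtoC (sin p * sin p)))%C.
    { rewrite E4, RtoC_mult. ring. }
    rewrite ECi, Hs2, Hdisc.
    transitivity (- 4 * e * ((m * m + n * n) * e + m * n * (2 * cos p * e)))%C. ring.
    rewrite <- He2. ring. }
  (* [|A0|^2 - |A2|^2 = 4 sin p Im (conj m n)]. As [mu^2 = A0] and [nu^2 = A2], this is where the
     orientation of [Q] puts the zero of [mu + nu z] outside the closed disk. *)
  assert (HA : Cmod A2 < Cmod A0).
  { unfold A2, A0. rewrite Cmod_opp, Cmod_mult. unfold e at 2. rewrite Cmod_cis, Rmult_1_l.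
    apply Rsqr_incrst_0; try apply Cmod_ge_0. unfold Rsqr.
    assert (Q1 := Cmod2_alt (m + n * e)). assert (Q2 := Cmod2_alt (m * e + n)).
    assert (Hdiff : Re (m * e + n) ^ 2 + Im (m * e + n) ^ 2 - (Re (m + n * e) ^ 2 + Im (m + n * e) ^ 2) =
      4 * sin p * Im (Cconj m * n) + (Re m ^ 2 + Im m ^ 2 - Re n ^ 2 - Im n ^ 2) * (sin p * sin p + cos p * cos p - 1)).
    { unfold e, cis. destruct m, n. cbn. ring. }
    rewrite Hcs in Hdiff. nra. }
  assert (HA0 : A0 <> RtoC 0).
  { apply Cmod_gt_0. assert (H := Cmod_ge_0 A2). lra. }
  destruct (Csqrt_exists A0) as [mu Hmu].
  assert (Hmu0 : mu <> RtoC 0) by (intros E; apply HA0; rewrite <- Hmu, E; ring).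
  set (nu := (A1 / (2 * mu))%C).
  assert (H2 : RtoC 2 <> RtoC 0) by (apply RtoC_neq; lra).
  assert (Hnu1 : (2 * mu * nu)%C = A1).
  { unfold nu. field. exact Hmu0. }
  assert (Hnu2 : (nu * nu)%C = A2).
  { apply (Cmult_reg (4 * A0)). apply Cmult_neq_0. apply RtoC_neq; lra. exact HA0.
    rewrite <- Hd, <- Hnu1, <- Hmu, E4. ring. }
  exists mu, nu. cbv zeta. fold e.
  assert (Hq : forall t : C, ((mu + nu * t) * (mu + nu * t) = A0 + A1 * t + A2 * (t * t))%C).
  { intros t. rewrite <- Hmu, <- Hnu1, <- Hnu2. replace (RtoC 2) with (1 + 1)%C by (rewrite <- RtoC_plus; f_equal; ring). ring. }
  assert (E2 : RtoC 2 = (1 + 1)%C) by (rewrite <- RtoC_plus; f_equal; ring).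
  repeat split.
  - assert (Q := Cmod_sqr mu). assert (Q' := Cmod_sqr nu). rewrite Hmu in Q. rewrite Hnu2 in Q'.
    assert (P1 := Cmod_ge_0 mu). assert (P2 := Cmod_ge_0 nu). nra.
  - transitivity ((mu + nu * 1) * (mu + nu * 1))%C. ring. rewrite Hq. unfold A0, A1, A2, s, m, n. rewrite E2. ring.
  - transitivity ((mu + nu * (- (1))) * (mu + nu * (- (1))))%C. ring. rewrite Hq. unfold A0, A1, A2, s, m, n. rewrite E2. ring.
  - rewrite Hq. unfold A0, A1, A2, m, n. rewrite Es, E2. ring.
  - transitivity ((mu + nu * (- e)) * (mu + nu * (- e)))%C. ring. rewrite Hq. unfold A0, A1, A2, m, n. rewrite Es, E2. ring.
Qed.

(** The reflected quotient alone is an automorphism of the disk; the unimodular factor [- i cis p]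
    makes [h' q^2] equal to [g']. That identity would allow either sign. The sign chosen makes the
    height tend to plus infinity at the jumps [1] and [- 1], which lie over the sides [b3 b4] and
    [b1 b2]. *)
Definition gauss_coordinate (mu nu : C) (p : R) (z : C) : C :=
  (- Ci * cis p * (Cconj mu * z + Cconj nu) / (mu + nu * z))%C.

Definition gauss_coordinate_inv (mu nu : C) (p : R) (w : C) : C :=
  ((mu * w + Ci * cis p * Cconj nu) / (- Ci * cis p * Cconj mu - nu * w))%C.

Section GaussCoordinate.
Variables (mu nu : C) (p : R).
Let e := cis p.
Hypothesis Hlt : Cmod nu < Cmod mu.

Lemma affine_neq_0 (z : C) : Cmod z <= 1 -> (mu + nu * z)%C <> RtoC 0.
Proof.
  intros Hz E. assert (H : mu = (- (nu * z))%C). { transitivity ((mu + nu * z) - nu * z)%C. ring. rewrite E. ring. }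
  assert (H1 : Cmod mu <= Cmod nu). { rewrite H, Cmod_opp, Cmod_mult. assert (H0 := Cmod_ge_0 nu). assert (H0' := Cmod_ge_0 z). nra. }
  lra.
Qed.

Lemma gauss_coordinate_disk (z : C) : Cmod z < 1 -> Cmod (gauss_coordinate mu nu p z) < 1.
Proof.
  intros Hz. assert (Hm := affine_neq_0 z (Rlt_le _ _ Hz)). unfold gauss_coordinate.
  rewrite Cmod_div by exact Hm. rewrite !Cmod_mult, Cmod_opp, Cmod_Ci, Cmod_cis, !Rmult_1_l.
  assert (Hp0 : 0 < Cmod (mu + nu * z)) by (apply Cmod_gt_0, Hm).
  apply Rlt_div_l. exact Hp0. rewrite Rmult_1_l.
  apply Rsqr_incrst_0; try apply Cmod_ge_0. unfold Rsqr.
  assert (Q1 := Cmod2_alt (Cconj mu * z + Cconj nu)). assert (Q2 := Cmod2_alt (mu + nu * z)).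
  assert (Q3 := Cmod2_alt mu). assert (Q4 := Cmod2_alt nu). assert (Q5 := Cmod2_alt z).
  assert (Hdiff : Re (mu + nu * z) ^ 2 + Im (mu + nu * z) ^ 2 -
     (Re (Cconj mu * z + Cconj nu) ^ 2 + Im (Cconj mu * z + Cconj nu) ^ 2) =
     (Re mu ^ 2 + Im mu ^ 2 - (Re nu ^ 2 + Im nu ^ 2)) * (1 - (Re z ^ 2 + Im z ^ 2))).
  { destruct mu, nu, z; cbn; ring. }
  rewrite <- Q1, <- Q2, <- Q3, <- Q4, <- Q5 in Hdiff.
  assert (P1 := Cmod_ge_0 mu). assert (P2 := Cmod_ge_0 nu). assert (P3 := Cmod_ge_0 z).
  assert (0 < (Cmod mu ^ 2 - Cmod nu ^ 2) * (1 - Cmod z ^ 2)) by (apply Rmult_lt_0_compat; nra).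
  lra.
Qed.

Lemma gauss_inv_denominator (w : C) : Cmod w < 1 -> (- Ci * e * Cconj mu - nu * w)%C <> RtoC 0.
Proof.
  intros Hw E. assert (H : (- Ci * e * Cconj mu)%C = (nu * w)%C).
  { transitivity ((- Ci * e * Cconj mu - nu * w) + nu * w)%C. ring. rewrite E. ring. }
  assert (H1 : Cmod mu = Cmod nu * Cmod w).
  { rewrite <- (Cmod_mult nu), <- H, !Cmod_mult, Cmod_opp, Cmod_Ci, Cmod_conj. unfold e. rewrite Cmod_cis. ring. }
  assert (P1 := Cmod_ge_0 nu). assert (P2 := Cmod_ge_0 w). nra.
Qed.

Lemma gauss_coordinate_inv_disk (w : C) : Cmod w < 1 -> Cmod (gauss_coordinate_inv mu nu p w) < 1.
Proof.
  intros Hw. assert (Hm := gauss_inv_denominator w Hw). unfold gauss_coordinate_inv. fold e.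
  rewrite Cmod_div by exact Hm.
  assert (Hp0 : 0 < Cmod (- Ci * e * Cconj mu - nu * w)) by (apply Cmod_gt_0, Hm).
  apply Rlt_div_l. exact Hp0. rewrite Rmult_1_l.
  apply Rsqr_incrst_0; try apply Cmod_ge_0. unfold Rsqr.
  assert (Q1 := Cmod2_alt (mu * w + Ci * e * Cconj nu)). assert (Q2 := Cmod2_alt (- Ci * e * Cconj mu - nu * w)).
  assert (Q3 := Cmod2_alt mu). assert (Q4 := Cmod2_alt nu). assert (Q5 := Cmod2_alt w).
  assert (Hcs := sin2_cos2 p). unfold Rsqr in Hcs.
  assert (Hdiff : Re (- Ci * e * Cconj mu - nu * w) ^ 2 + Im (- Ci * e * Cconj mu - nu * w) ^ 2 -
     (Re (mu * w + Ci * e * Cconj nu) ^ 2 + Im (mu * w + Ci * e * Cconj nu) ^ 2) =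
     (Re mu ^ 2 + Im mu ^ 2 - (Re nu ^ 2 + Im nu ^ 2)) * (sin p * sin p + cos p * cos p - (Re w ^ 2 + Im w ^ 2))).
  { unfold e, cis. destruct mu, nu, w; cbn; ring. }
  rewrite Hcs in Hdiff. rewrite <- Q1, <- Q2, <- Q3, <- Q4, <- Q5 in Hdiff.
  assert (P1 := Cmod_ge_0 mu). assert (P2 := Cmod_ge_0 nu). assert (P3 := Cmod_ge_0 w).
  assert (0 < (Cmod mu ^ 2 - Cmod nu ^ 2) * (1 - Cmod w ^ 2)) by (apply Rmult_lt_0_compat; nra).
  lra.
Qed.

Lemma gauss_mobius_det : (Ci * e * (Cconj nu * nu - mu * Cconj mu))%C <> RtoC 0.
Proof.
  rewrite (Cmult_comm (Cconj nu)), <- !Cmod2_conj, <- RtoC_minus.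
  assert (P1 := Cmod_ge_0 mu). assert (P2 := Cmod_ge_0 nu).
  repeat apply Cmult_neq_0. intros H; injection H; lra. apply cis_neq_0. apply RtoC_neq. nra.
Qed.

Lemma gauss_coordinate_K (z : C) : Cmod z < 1 -> gauss_coordinate_inv mu nu p (gauss_coordinate mu nu p z) = z.
Proof.
  intros Hz. assert (Hm := affine_neq_0 z (Rlt_le _ _ Hz)).
  assert (Hw := gauss_coordinate_disk z Hz). assert (Hd' := gauss_inv_denominator _ Hw).
  assert (Hdet := gauss_mobius_det).
  unfold gauss_coordinate_inv. fold e.
  apply (Cmult_reg (- Ci * e * Cconj mu - nu * gauss_coordinate mu nu p z)). exact Hd'.
  transitivity (mu * gauss_coordinate mu nu p z + Ci * e * Cconj nu)%C. field. exact Hd'.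
  unfold gauss_coordinate. fold e. field. exact Hm.
Qed.

Lemma gauss_coordinate_inv_K (w : C) : Cmod w < 1 -> gauss_coordinate mu nu p (gauss_coordinate_inv mu nu p w) = w.
Proof.
  intros Hw. assert (Hz := gauss_coordinate_inv_disk w Hw).
  assert (Hm := affine_neq_0 _ (Rlt_le _ _ Hz)). assert (Hd' := gauss_inv_denominator _ Hw).
  unfold gauss_coordinate. fold e.
  apply (Cmult_reg (mu + nu * gauss_coordinate_inv mu nu p w)). exact Hm.
  transitivity (- Ci * e * (Cconj mu * gauss_coordinate_inv mu nu p w + Cconj nu))%C. field. exact Hm.
  unfold gauss_coordinate_inv. fold e. field. exact Hd'.
Qed.

Lemma gauss_coordinate_mobius : mobius_disk_automorphism (gauss_coordinate mu nu p).
Proof.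
  split; [|split].
  - exists (- Ci * e * Cconj mu)%C, (- Ci * e * Cconj nu)%C, nu, mu. split.
    + intros E. apply gauss_mobius_det. rewrite <- E. ring.
    + intros z Hz. split. rewrite Cplus_comm. apply affine_neq_0. apply Rlt_le, Hz.
      unfold gauss_coordinate. fold e. f_equal; ring.
  - exact gauss_coordinate_disk.
  - intros w Hw. exists (gauss_coordinate_inv mu nu p w). split.
    + split. apply gauss_coordinate_inv_disk, Hw. apply gauss_coordinate_inv_K, Hw.
    + intros z [Hz <-]. apply gauss_coordinate_K, Hz.
Qed.
End GaussCoordinate.

Section WeierstrassData.
Variables (a b c d mu nu : C) (p : R).
Hypothesis Hp : 0 < p < PI.
Let e := cis p.
Hypothesis Hlt : Cmod nu < Cmod mu.
Hypothesis Ha : ((mu + nu) * (mu + nu) = 2 * a * (e * e - 1))%C.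
Hypothesis Hc : ((mu - nu) * (mu - nu) = - (2 * c * (e * e - 1)))%C.
Hypothesis Hb : ((mu + nu * e) * (mu + nu * e) = - (2 * b * e * (e * e - 1)))%C.
Hypothesis Hd : ((mu - nu * e) * (mu - nu * e) = 2 * d * e * (e * e - 1))%C.

Lemma jump_denominator : (e * e - 1)%C <> RtoC 0.
Proof.
  intros E. assert (Hsin : 0 < sin p) by (apply sin_gt_0; lra).
  assert (He1 : (e * e - 1)%C = (2 * Ci * sin p * e)%C).
  { assert (Hcs := sin2_cos2 p). unfold Rsqr in Hcs. unfold e, cis. apply C_ext; cbn; [|ring]. nra. }
  rewrite E in He1. symmetry in He1. revert He1. repeat apply Cmult_neq_0.
  - apply RtoC_neq; lra.
  - intros H; injection H; lra.
  - apply RtoC_neq; lra.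
  - apply cis_neq_0.
Qed.

Lemma jump_denominator_sin : (e * e - 1)%C = (2 * Ci * sin p * e)%C.
Proof.
  assert (Hcs := sin2_cos2 p). unfold Rsqr in Hcs. unfold e, cis. apply C_ext; cbn; [|ring]. nra.
Qed.

Lemma disk_poles (z : C) : Cmod z < 1 ->
  (1 - z)%C <> RtoC 0 /\ (1 + z)%C <> RtoC 0 /\ (e - z)%C <> RtoC 0 /\ (e + z)%C <> RtoC 0 /\
  (1 - z * z)%C <> RtoC 0 /\ (e * e - z * z)%C <> RtoC 0.
Proof.
  intros Hz. assert (Hm : forall v w : C, Cmod v = 1 -> Cmod w < 1 -> (v - w)%C <> RtoC 0).
  { intros v w Hv Hw E. replace w with (v - (v - w))%C in Hw by ring. rewrite E in Hw.
    replace (v - 0)%C with v in Hw by ring. lra. }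
  assert (He : Cmod e = 1) by apply Cmod_cis. assert (Hz' : Cmod (- z) < 1) by (rewrite Cmod_opp; exact Hz).
  assert (D1 : (1 - z)%C <> RtoC 0) by (apply Hm; [apply Cmod_1 | exact Hz]).
  assert (D2 : (1 + z)%C <> RtoC 0).
  { replace (1 + z)%C with (1 - - z)%C by ring. apply Hm; [apply Cmod_1 | exact Hz']. }
  assert (D3 : (e - z)%C <> RtoC 0) by (apply Hm; assumption).
  assert (D4 : (e + z)%C <> RtoC 0).
  { replace (e + z)%C with (e - - z)%C by ring. apply Hm; assumption. }
  repeat split; trivial.
  - replace (1 - z * z)%C with ((1 - z) * (1 + z))%C by ring. apply Cmult_neq_0; assumption.
  - replace (e * e - z * z)%C with ((e - z) * (e + z))%C by ring. apply Cmult_neq_0; assumption.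
Qed.

(* Lagrange interpolation of a product of two affine functions at the four points [1, e, -1, -e]. *)
Lemma cauchy_sum_interpolation (j1 j2 j3 j4 m n m' n' z : C) : Cmod z < 1 ->
  (j1 * (2 * (e * e - 1)) = (m + n) * (m' + n'))%C ->
  (j2 * (2 * e * (e * e - 1)) = - ((m + n * e) * (m' + n' * e)))%C ->
  (j3 * (2 * (e * e - 1)) = - ((m - n) * (m' - n')))%C ->
  (j4 * (2 * e * (e * e - 1)) = (m - n * e) * (m' - n' * e))%C ->
  cauchy_sum 0 p j1 j2 j3 j4 z =
    (- Ci / RtoC (2 * PI) * ((m + n * z) * (m' + n' * z) / ((1 - z * z) * (e * e - z * z))))%C.
Proof.
  intros Hz H1 H2 H3 H4. destruct (disk_poles z Hz) as [D1 [D2 [D3 [D4 [D5 D6]]]]].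
  assert (De := jump_denominator). assert (De0 : e <> RtoC 0) by apply cis_neq_0.
  assert (E2 : RtoC 2 <> RtoC 0) by (apply RtoC_neq; lra).
  assert (F1 : j1 = ((m + n) * (m' + n') / (2 * (e * e - 1)))%C).
  { rewrite <- H1. field. exact De. }
  assert (F2 : j2 = (- ((m + n * e) * (m' + n' * e)) / (2 * e * (e * e - 1)))%C).
  { rewrite <- H2. field. split; assumption. }
  assert (F3 : j3 = (- ((m - n) * (m' - n')) / (2 * (e * e - 1)))%C).
  { rewrite <- H3. field. exact De. }
  assert (F4 : j4 = ((m - n * e) * (m' - n' * e) / (2 * e * (e * e - 1)))%C).
  { rewrite <- H4. field. split; assumption. }
  unfold cauchy_sum. rewrite !Rplus_0_l.
  replace (cis 0) with (RtoC 1) by (symmetry; apply cis_0).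
  replace (cis PI) with (- (1))%C by (apply C_ext; unfold cis; cbn; [rewrite cos_PI | rewrite sin_PI]; ring).
  replace (PI + p) with (p + PI) by ring. rewrite cis_PI. fold e.
  f_equal. rewrite F1, F2, F3, F4. clear F1 F2 F3 F4 H1 H2 H3 H4.
  assert (D2' : (- (1) - z)%C <> RtoC 0). { intros E. apply D2. transitivity (- (- (1) - z))%C. ring. rewrite E. ring. }
  assert (D4' : (- e - z)%C <> RtoC 0). { intros E. apply D4. transitivity (- (- e - z))%C. ring. rewrite E. ring. }
  field. repeat split; try assumption. intros E. apply D2'. rewrite <- E. apply C_ext; cbn; ring.
Qed.

Lemma cauchy_sum_h (z : C) : Cmod z < 1 ->
  cauchy_sum 0 p a b c d z =
    (- Ci / RtoC (2 * PI) * ((mu + nu * z) * (mu + nu * z) / ((1 - z * z) * (e * e - z * z))))%C.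
Proof.
  intros Hz. apply cauchy_sum_interpolation; trivial.
  - rewrite Ha. ring.
  - rewrite Hb. ring.
  - rewrite Hc. ring.
  - rewrite Hd. ring.
Qed.

Lemma conj_e : (e * Cconj e)%C = RtoC 1.
Proof. unfold e. rewrite cis_conj. apply cis_opp_mult. Qed.

(** Conjugating the four relations and using [conj e = 1 / e] gives interpolation data of the same
    kind for the reflected polynomial. The sign in [e^2 conj (e^2 - 1) = - (e^2 - 1)] is absorbed by
    [Ci^2 = - 1]. *)
Lemma cauchy_sum_g (z : C) : Cmod z < 1 ->
  cauchy_sum 0 p (Cconj a) (Cconj b) (Cconj c) (Cconj d) z =
    (- Ci / RtoC (2 * PI) * ((Ci * e * Cconj nu + Ci * e * Cconj mu * z) * (Ci * e * Cconj nu + Ci * e * Cconj mu * z) /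
      ((1 - z * z) * (e * e - z * z))))%C.
Proof.
  intros Hz. assert (He := conj_e).
  assert (ECi : (Ci * Ci)%C = (- (1))%C) by (apply C_ext; cbn; ring).
  assert (K : forall x y, x = y -> Cconj x = Cconj y) by (intros x y ->; reflexivity).
  assert (C2 : Cconj 2 = RtoC 2) by (apply C_ext; cbn; ring).
  assert (C1 : Cconj 1 = RtoC 1) by (apply C_ext; cbn; ring).
  assert (Ha' := K _ _ Ha). assert (Hb' := K _ _ Hb). assert (Hc' := K _ _ Hc). assert (Hd' := K _ _ Hd).
  repeat (rewrite Copp_conj in * || rewrite Cmult_conj in * || rewrite Cminus_conj in * ||
    rewrite Cplus_conj in * || rewrite C1 in * || rewrite C2 in * ).
  set (e' := Cconj e) in *. set (m' := Cconj mu) in *. set (n' := Cconj nu) in *.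
  assert (H1 : (e * e * (e' * e' - 1))%C = (- (e * e - 1))%C).
  { transitivity ((e * e') * (e * e') - e * e)%C. ring. rewrite He. ring. }
  apply cauchy_sum_interpolation; trivial.
  - transitivity (- (2 * Cconj a * (- (e * e - 1))))%C. ring. rewrite <- H1.
    transitivity (- (e * e) * (2 * Cconj a * (e' * e' - 1)))%C. ring. rewrite <- Ha'.
    transitivity (Ci * Ci * (e * e) * ((m' + n') * (m' + n')))%C. rewrite ECi. ring. ring.
  - transitivity (- (2 * Cconj b * e * (- (e * e - 1))))%C. ring. rewrite <- H1.
    transitivity (- (2 * Cconj b * e * (e * e * (e' * e' - 1)) * (e * e')))%C. rewrite He. ring.
    transitivity ((e * e * e * e) * (- (2 * Cconj b * e' * (e' * e' - 1))))%C. ring. rewrite <- Hb'.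
    transitivity ((e * e) * ((m' * e + n' * (e * e')) * (m' * e + n' * (e * e'))))%C. ring. rewrite He.
    transitivity (- (Ci * Ci) * (e * e) * ((m' * e + n' * 1) * (m' * e + n' * 1)))%C. rewrite ECi. ring. ring.
  - transitivity (- (2 * Cconj c * (- (e * e - 1))))%C. ring. rewrite <- H1.
    transitivity ((e * e) * (- (2 * Cconj c * (e' * e' - 1))))%C. ring. rewrite <- Hc'.
    transitivity (- (Ci * Ci) * (e * e) * ((m' - n') * (m' - n')))%C. rewrite ECi. ring. ring.
  - transitivity (- (2 * Cconj d * e * (- (e * e - 1))))%C. ring. rewrite <- H1.
    transitivity (- (2 * Cconj d * e * (e * e * (e' * e' - 1)) * (e * e')))%C. rewrite He. ring.
    transitivity (- (e * e * e * e) * (2 * Cconj d * e' * (e' * e' - 1)))%C. ring. rewrite <- Hd'.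
    transitivity (- (e * e) * ((m' * e - n' * (e * e')) * (m' * e - n' * (e * e'))))%C. ring. rewrite He.
    transitivity (Ci * Ci * (e * e) * ((m' * e - n' * 1) * (m' * e - n' * 1)))%C. rewrite ECi. ring. ring.
Qed.

Lemma cauchy_sum_h_neq_0 (z : C) : Cmod z < 1 -> cauchy_sum 0 p a b c d z <> RtoC 0.
Proof.
  intros Hz. rewrite cauchy_sum_h by exact Hz. destruct (disk_poles z Hz) as [D1 [D2 [D3 [D4 [D5 D6]]]]].
  assert (Hm := affine_neq_0 mu nu Hlt z (Rlt_le _ _ Hz)). assert (Hpi := PI_RGT_0).
  assert (Hinv : forall x, x <> RtoC 0 -> (/ x)%C <> RtoC 0).
  { intros x Hx E. assert (H : (x * / x)%C = RtoC 1) by (field; exact Hx). rewrite E in H.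
    replace (x * 0)%C with (RtoC 0) in H by ring. injection H. lra. }
  unfold Cdiv. repeat apply Cmult_neq_0; try assumption.
  - intros H. injection H. lra.
  - apply Hinv, RtoC_neq. lra.
  - apply Hinv, Cmult_neq_0; assumption.
Qed.

Lemma gauss_coordinate_sqr (z : C) : Cmod z < 1 ->
  (cauchy_sum 0 p a b c d z * (gauss_coordinate mu nu p z * gauss_coordinate mu nu p z))%C =
  cauchy_sum 0 p (Cconj a) (Cconj b) (Cconj c) (Cconj d) z.
Proof.
  intros Hz. rewrite cauchy_sum_h, cauchy_sum_g by exact Hz. destruct (disk_poles z Hz) as [D1 [D2 [D3 [D4 [D5 D6]]]]].
  assert (Hm := affine_neq_0 mu nu Hlt z (Rlt_le _ _ Hz)). assert (Hpi := PI_RGT_0).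
  assert (D7 : RtoC (2 * PI) <> RtoC 0) by (apply RtoC_neq; lra).
  unfold gauss_coordinate. fold e. field. repeat split; assumption.
Qed.

(* The weights of the logarithmic poles of the height function. *)
Definition height_weight (x : C) : R := Cmod x ^ 2 / (4 * sin p).

(** At a pole [zeta] on the circle, [conj mu zeta + conj nu = zeta conj (mu + nu zeta)]. Thus the
    numerator of [h' q] is there a multiple of [|mu + nu zeta|^2], and the remaining factors combine
    to the real number [1 / (4 sin p)] with alternating sign. Real weights turn the height into a
    sum of logarithms of moduli, free of angular terms. *)
Lemma cauchy_sum_height (z : C) : Cmod z < 1 ->
  (cauchy_sum 0 p a b c d z * gauss_coordinate mu nu p z)%C =
  cauchy_sum 0 p (RtoC (- height_weight (mu + nu))) (RtoC (height_weight (mu + nu * e)))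
    (RtoC (- height_weight (mu - nu))) (RtoC (height_weight (mu - nu * e))) z.
Proof.
  intros Hz. assert (He := conj_e). assert (De := jump_denominator_sin).
  assert (Hsin : 0 < sin p) by (apply sin_gt_0; lra).
  assert (Hsin' : RtoC (sin p) <> RtoC 0) by (apply RtoC_neq; lra).
  assert (ECi : (Ci * Ci)%C = (- (1))%C) by (apply C_ext; cbn; ring).
  assert (E4 : RtoC 4 = (2 * 2)%C) by (rewrite <- RtoC_mult; f_equal; ring).
  assert (Hw : forall x, (RtoC (height_weight x) * (4 * sin p))%C = (x * Cconj x)%C).
  { intros x. rewrite <- Cmod2_conj, <- !RtoC_mult. f_equal. unfold height_weight. field. lra. }
  rewrite (cauchy_sum_interpolation (RtoC (- height_weight (mu + nu))) _ _ _ mu nu (- Ci * e * Cconj nu) (- Ci * e * Cconj mu)); trivial.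
  - rewrite cauchy_sum_h by exact Hz. destruct (disk_poles z Hz) as [D1 [D2 [D3 [D4 [D5 D6]]]]].
    assert (Hm := affine_neq_0 mu nu Hlt z (Rlt_le _ _ Hz)). assert (Hpi := PI_RGT_0).
    assert (D7 : RtoC (2 * PI) <> RtoC 0) by (apply RtoC_neq; lra).
    unfold gauss_coordinate. fold e. field. repeat split; assumption.
  - rewrite De, RtoC_opp. transitivity (- (RtoC (height_weight (mu + nu)) * (4 * sin p)) * (Ci * e))%C.
    rewrite E4; ring. rewrite Hw, Cplus_conj. ring.
  - rewrite De. transitivity ((RtoC (height_weight (mu + nu * e)) * (4 * sin p)) * (Ci * e * e))%C.
    rewrite E4; ring. rewrite Hw, Cplus_conj, Cmult_conj.
    transitivity (Ci * e * ((mu + nu * e) * (Cconj mu * e + Cconj nu * (e * Cconj e))))%C. ring. rewrite He. ring.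
  - rewrite De, RtoC_opp. transitivity (- (RtoC (height_weight (mu - nu)) * (4 * sin p)) * (Ci * e))%C.
    rewrite E4; ring. rewrite Hw, Cminus_conj. ring.
  - rewrite De. transitivity ((RtoC (height_weight (mu - nu * e)) * (4 * sin p)) * (Ci * e * e))%C.
    rewrite E4; ring. rewrite Hw, Cminus_conj, Cmult_conj.
    transitivity (Ci * e * ((mu - nu * e) * (Cconj mu * e - Cconj nu * (e * Cconj e))))%C. ring. rewrite He. ring.
Qed.

Lemma height_weight_pos (x : C) : Cmod x <= 1 -> 0 < height_weight (mu + nu * x).
Proof.
  intros Hx. assert (Hsin : 0 < sin p) by (apply sin_gt_0; lra).
  apply Rdiv_lt_0_compat. apply pow_lt, Cmod_gt_0, affine_neq_0; assumption. lra.
Qed.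

End WeierstrassData.

(** * Minimal graphs *)

Lemma locally_horizontal (w : C) (P : C -> Prop) : @locally C_UniformSpace w P ->
  locally (Re w) (fun t => P (t, Im w)).
Proof.
  intros [d Hd]. exists d. intros t Ht. apply Hd. split. exact Ht. apply ball_center.
Qed.

Lemma locally_vertical (w : C) (P : C -> Prop) : @locally C_UniformSpace w P ->
  locally (Im w) (fun t => P (Re w, t)).
Proof.
  intros [d Hd]. exists d. intros t Ht. apply Hd. split. apply ball_center. exact Ht.
Qed.

Lemma D1_ext_loc (u v : C -> R) (w : C) :
  @locally C_UniformSpace w (fun z => u z = v z) -> D1 u w = D1 v w.
Proof. intros H. apply Derive_ext_loc. apply (locally_horizontal w _ H). Qed.

Lemma D2_ext_loc (u v : C -> R) (w : C) :
  @locally C_UniformSpace w (fun z => u z = v z) -> D2 u w = D2 v w.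
Proof. intros H. apply Derive_ext_loc. apply (locally_vertical w _ H). Qed.

Lemma D_wirt (f : C -> C) (w a b : C) : wirt f w a b ->
  D1 (fun z => Re (f z)) w = Re (a + b) /\ D1 (fun z => Im (f z)) w = Im (a + b) /\
  D2 (fun z => Re (f z)) w = Re (Ci * (a - b)) /\ D2 (fun z => Im (f z)) w = Im (Ci * (a - b)).
Proof.
  intros H. destruct (wirt_partials f w a b H) as [[H1 H2] [H3 H4]].
  repeat split; apply is_derive_unique; assumption.
Qed.

(** The Laplacian is four times the mixed Wirtinger derivative, which vanishes when [f_z] has no
    antiholomorphic and [f_zbar] no holomorphic derivative. *)
Lemma laplacian_wirt (f A B : C -> C) (z a b : C) :
  @locally C_UniformSpace z (fun w => wirt f w (A w) (B w)) -> wirt A z a 0 -> wirt B z 0 b ->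
  laplacian (fun w => Re (f w)) z = 0 /\ laplacian (fun w => Im (f w)) z = 0.
Proof.
  intros Hf HA HB.
  destruct (D_wirt _ _ _ _ (wirt_plus _ _ _ _ _ _ _ HA HB)) as [P1 [P2 [_ _]]].
  destruct (D_wirt _ _ _ _ (wirt_scal Ci _ _ _ _ (wirt_minus _ _ _ _ _ _ _ HA HB))) as [_ [_ [P3 P4]]].
  unfold laplacian. split.
  - rewrite (D1_ext_loc _ (fun w => Re (A w + B w))), (D2_ext_loc (D2 _) (fun w => Re (Ci * (A w - B w)))).
    + rewrite P1, P3. destruct a, b; cbn; ring.
    + revert Hf. apply filter_imp. intros w Hw. apply (D_wirt _ _ _ _ Hw).
    + revert Hf. apply filter_imp. intros w Hw. apply (D_wirt _ _ _ _ Hw).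
  - rewrite (D1_ext_loc _ (fun w => Im (A w + B w))), (D2_ext_loc (D2 _) (fun w => Im (Ci * (A w - B w)))).
    + rewrite P2, P4. destruct a, b; cbn; ring.
    + revert Hf. apply filter_imp. intros w Hw. apply (D_wirt _ _ _ _ Hw).
    + revert Hf. apply filter_imp. intros w Hw. apply (D_wirt _ _ _ _ Hw).
Qed.

Lemma jacobian_wirt (f : C -> C) (z a b : C) : wirt f z a b -> jacobian f z = Cmod a ^ 2 - Cmod b ^ 2.
Proof.
  intros H. destruct (D_wirt f z a b H) as [P1 [P2 [P3 P4]]]. unfold jacobian.
  rewrite P1, P2, P3, P4, !Cmod2_alt. destruct a, b; cbn; ring.
Qed.

Lemma D1_Re (w : C) : D1 Re w = 1.
Proof. apply (is_derive_unique (fun t => t)). apply (is_derive_id (K := R_AbsRing)). Qed.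
Lemma D2_Re (w : C) : D2 Re w = 0.
Proof. apply (Derive_const (Re w)). Qed.
Lemma D1_Im (w : C) : D1 Im w = 0.
Proof. apply (Derive_const (Im w)). Qed.
Lemma D2_Im (w : C) : D2 Im w = 1.
Proof. apply (is_derive_unique (fun t => t)). apply (is_derive_id (K := R_AbsRing)). Qed.
Lemma D1_const (c : R) (w : C) : D1 (fun _ => c) w = 0.
Proof. apply (Derive_const c). Qed.
Lemma D2_const (c : R) (w : C) : D2 (fun _ => c) w = 0.
Proof. apply (Derive_const c). Qed.

Lemma partial_u_graph (phi : C -> R) (w : C) : partial_u (graph_param phi) w = (1, 0, D1 phi w).
Proof. unfold partial_u, graph_param; cbn. f_equal. f_equal. apply D1_Re. apply D1_Im. Qed.

Lemma partial_v_graph (phi : C -> R) (w : C) : partial_v (graph_param phi) w = (0, 1, D2 phi w).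
Proof. unfold partial_v, graph_param; cbn. f_equal. f_equal. apply D2_Re. apply D2_Im. Qed.

Lemma unit_normal_graph (phi : C -> R) (w : C) :
  unit_normal (graph_param phi) w =
    scal3 (/ sqrt (1 + D1 phi w ^ 2 + D2 phi w ^ 2)) (- D1 phi w, - D2 phi w, 1).
Proof.
  unfold unit_normal. rewrite partial_u_graph, partial_v_graph.
  assert (E : cross3 (1, 0, D1 phi w) (0, 1, D2 phi w) = (- D1 phi w, - D2 phi w, 1)).
  { unfold cross3; cbn. f_equal; [f_equal|]; ring. }
  rewrite E. unfold norm3. f_equal. f_equal. f_equal. unfold dot3; cbn. ring.
Qed.

Lemma mean_curvature_graph (phi : C -> R) (w : C) :
  (1 + D2 phi w ^ 2) * D1 (D1 phi) w - 2 * (D1 phi w * D2 phi w) * D2 (D1 phi) w +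
    (1 + D1 phi w ^ 2) * D2 (D2 phi) w = 0 ->
  mean_curvature (graph_param phi) w = 0.
Proof.
  intros H. unfold mean_curvature.
  assert (Eu : partial_u (graph_param phi) = fun w => (1, 0, D1 phi w))
    by (apply functional_extensionality, partial_u_graph).
  assert (Ev : partial_v (graph_param phi) = fun w => (0, 1, D2 phi w))
    by (apply functional_extensionality, partial_v_graph).
  rewrite Eu, Ev, unit_normal_graph.
  set (k := / sqrt (1 + D1 phi w ^ 2 + D2 phi w ^ 2)).
  unfold partial_u, partial_v, dot3, scal3; cbn [cx cy cz fst snd].
  unfold cx, cy, cz; cbn [fst snd].
  rewrite !D1_const, !D2_const.
  change (D1 (fun v => D1 phi v) w) with (D1 (D1 phi) w).
  change (D2 (fun v => D1 phi v) w) with (D2 (D1 phi) w).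
  change (D2 (fun v => D2 phi v) w) with (D2 (D2 phi) w).
  set (pu := D1 phi w) in *. set (pv := D2 phi w) in *.
  set (puu := D1 (D1 phi) w) in *. set (puv := D2 (D1 phi) w) in *. set (pvv := D2 (D2 phi) w) in *.
  replace (_ / _) with (k * ((1 + pv ^ 2) * puu - 2 * (pu * pv) * puv + (1 + pu ^ 2) * pvv) *
    / (2 * ((1 * 1 + 0 * 0 + pu * pu) * (0 * 0 + 1 * 1 + pv * pv) - (1 * 0 + 0 * 1 + pu * pv) ^ 2))).
  - rewrite H. ring.
  - unfold Rdiv. f_equal. ring.
Qed.

Lemma Cmod_sqr_lt (q : C) : Cmod q < 1 -> Re q ^ 2 + Im q ^ 2 < 1.
Proof. intros H. assert (H1 := Cmod2_alt q). assert (H0 := Cmod_ge_0 q). nra. Qed.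

Lemma hemisphere_point_coord (q : C) :
  hemisphere_point q = (- (2 * Im q) / (1 + (Re q ^ 2 + Im q ^ 2)), - (2 * Re q) / (1 + (Re q ^ 2 + Im q ^ 2)),
    (1 - (Re q ^ 2 + Im q ^ 2)) / (1 + (Re q ^ 2 + Im q ^ 2))).
Proof.
  unfold hemisphere_point, inv_stereographic. rewrite Cmod2_alt.
  assert (E1 : Re (- (Ci * Cconj q)) = - Im q) by (destruct q; cbn; ring).
  assert (E2 : Im (- (Ci * Cconj q)) = - Re q) by (destruct q; cbn; ring).
  rewrite E1, E2. unfold scal3, cx, cy, cz; cbn [fst snd].
  replace ((- Im q) ^ 2 + (- Re q) ^ 2) with (Re q ^ 2 + Im q ^ 2) by ring.
  unfold Rdiv. f_equal; [f_equal|]; ring.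
Qed.

Lemma unit_normal_hemisphere (phi : C -> R) (w q : C) : Cmod q < 1 ->
  D1 phi w = 2 * Im q / (1 - (Re q ^ 2 + Im q ^ 2)) -> D2 phi w = 2 * Re q / (1 - (Re q ^ 2 + Im q ^ 2)) ->
  unit_normal (graph_param phi) w = hemisphere_point q.
Proof.
  intros Hq E1 E2. rewrite unit_normal_graph, E1, E2, hemisphere_point_coord.
  assert (Hlt := Cmod_sqr_lt q Hq). set (x := Re q) in *. set (y := Im q) in *.
  assert (Hx : 0 <= x ^ 2) by apply pow2_ge_0. assert (Hy : 0 <= y ^ 2) by apply pow2_ge_0.
  assert (Es : sqrt (1 + (2 * y / (1 - (x ^ 2 + y ^ 2))) ^ 2 + (2 * x / (1 - (x ^ 2 + y ^ 2))) ^ 2) =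
    (1 + (x ^ 2 + y ^ 2)) / (1 - (x ^ 2 + y ^ 2))).
  { rewrite <- (sqrt_pow2 ((1 + (x ^ 2 + y ^ 2)) / (1 - (x ^ 2 + y ^ 2)))).
    - f_equal. field. lra.
    - apply Rdiv_le_0_compat; lra. }
  rewrite Es. unfold scal3, cx, cy, cz; cbn [fst snd].
  f_equal; [f_equal|]; field; lra.
Qed.

(* In terms of the Gauss coordinate [q], the gradient of a minimal graph is
   [(2 Im q, 2 Re q) / (1 - |q|^2)]; the minimal surface equation says that the
   [dw] and [conj dw] derivatives of [q] are related by [q_wbar = - conj q ^ 2 * q_w]. *)
Lemma minimal_graph_equation (phi : C -> R) (q : C -> C) (w r : C) :
  @locally C_UniformSpace w (fun v => Cmod (q v) < 1 /\
    D1 phi v = 2 * Im (q v) / (1 - (Re (q v) ^ 2 + Im (q v) ^ 2)) /\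
    D2 phi v = 2 * Re (q v) / (1 - (Re (q v) ^ 2 + Im (q v) ^ 2))) ->
  wirt q w r (- (Cconj (q w) * Cconj (q w) * r))%C ->
  mean_curvature (graph_param phi) w = 0.
Proof.
  intros Hloc Hq. apply mean_curvature_graph.
  destruct (locally_singleton _ _ Hloc) as [Hlt [E1 E2]].
  assert (Hlt' := Cmod_sqr_lt _ Hlt).
  destruct (wirt_partials _ _ _ _ Hq) as [[Q1 Q2] [Q3 Q4]].
  set (x1 := Re (r + _)) in Q1. set (y1 := Im (r + _)) in Q2.
  set (x2 := Re (Ci * _)) in Q3. set (y2 := Im (Ci * _)) in Q4.
  set (x := Re (q w)) in *. set (y := Im (q w)) in *.
  assert (HD : 1 - (x ^ 2 + y ^ 2) <> 0) by lra.
  set (D := 1 - (x ^ 2 + y ^ 2)) in *.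
  assert (Hquot : forall (X Y : R -> R) (t X' Y' : R), is_derive X t X' -> is_derive Y t Y' ->
    X t = x -> Y t = y ->
    is_derive (fun s => 2 * Y s / (1 - (X s ^ 2 + Y s ^ 2))) t
      ((2 * Y' * D + 2 * y * (2 * x * X' + 2 * y * Y')) / D ^ 2) /\
    is_derive (fun s => 2 * X s / (1 - (X s ^ 2 + Y s ^ 2))) t
      ((2 * X' * D + 2 * x * (2 * x * X' + 2 * y * Y')) / D ^ 2)).
  { intros X Y t X' Y' HX HY EX EY.
    assert (DX : Derive (fun s => X s) t = X') by (apply is_derive_unique, HX).
    assert (DY : Derive (fun s => Y s) t = Y') by (apply is_derive_unique, HY).
    split; auto_derive.
    - rewrite EX, EY. repeat split; try (eexists; eassumption). exact HD.
    - rewrite DX, DY, EX, EY. unfold D. field. exact HD.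
    - rewrite EX, EY. repeat split; try (eexists; eassumption). exact HD.
    - rewrite DX, DY, EX, EY. unfold D. field. exact HD. }
  assert (Ew1 : (Re w, Im w) = w) by (destruct w; reflexivity).
  assert (Huu : D1 (D1 phi) w = (2 * y1 * D + 2 * y * (2 * x * x1 + 2 * y * y1)) / D ^ 2).
  { rewrite (D1_ext_loc (D1 phi) (fun v => 2 * Im (q v) / (1 - (Re (q v) ^ 2 + Im (q v) ^ 2)))).
    - apply is_derive_unique. apply (Hquot _ _ _ _ _ Q1 Q2); [exact (f_equal (fun v => Re (q v)) Ew1) | exact (f_equal (fun v => Im (q v)) Ew1)].
    - revert Hloc. apply filter_imp. intros v Hv. apply Hv. }
  assert (Huv : D2 (D1 phi) w = (2 * y2 * D + 2 * y * (2 * x * x2 + 2 * y * y2)) / D ^ 2).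
  { rewrite (D2_ext_loc (D1 phi) (fun v => 2 * Im (q v) / (1 - (Re (q v) ^ 2 + Im (q v) ^ 2)))).
    - apply is_derive_unique. apply (Hquot _ _ _ _ _ Q3 Q4); [exact (f_equal (fun v => Re (q v)) Ew1) | exact (f_equal (fun v => Im (q v)) Ew1)].
    - revert Hloc. apply filter_imp. intros v Hv. apply Hv. }
  assert (Hvv : D2 (D2 phi) w = (2 * x2 * D + 2 * x * (2 * x * x2 + 2 * y * y2)) / D ^ 2).
  { rewrite (D2_ext_loc (D2 phi) (fun v => 2 * Re (q v) / (1 - (Re (q v) ^ 2 + Im (q v) ^ 2)))).
    - apply is_derive_unique. apply (Hquot _ _ _ _ _ Q3 Q4); [exact (f_equal (fun v => Re (q v)) Ew1) | exact (f_equal (fun v => Im (q v)) Ew1)].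
    - revert Hloc. apply filter_imp. intros v Hv. apply Hv. }
  rewrite Huu, Huv, Hvv, E1, E2. fold x y D.
  (* Components of [q_u = r - conj q^2 r] and [q_v = i (r + conj q^2 r)]; inserting them turns the
     minimal surface equation into a polynomial identity. *)
  assert (Ex1 : x1 = (1 - (x * x - y * y)) * Re r - 2 * x * y * Im r).
  { unfold x1, x, y. destruct (q w), r; cbn; ring. }
  assert (Ey1 : y1 = (1 - (x * x - y * y)) * Im r + 2 * x * y * Re r).
  { unfold y1, x, y. destruct (q w), r; cbn; ring. }
  assert (Ex2 : x2 = - ((1 + (x * x - y * y)) * Im r - 2 * x * y * Re r)).
  { unfold x2, x, y. destruct (q w), r; cbn; ring. }
  assert (Ey2 : y2 = (1 + (x * x - y * y)) * Re r + 2 * x * y * Im r).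
  { unfold y2, x, y. destruct (q w), r; cbn; ring. }
  rewrite Ex1, Ey1, Ex2, Ey2. field_simplify_eq. 2: exact HD. unfold D. ring.
Qed.

(** * Smoothness in space and coordinates on the hemisphere *)

Lemma smooth_on_open {V W : NormedModule R_AbsRing} (U : V -> Prop) (F : V -> W) :
  open U -> (forall k, class_Ck k U F) -> smooth_on U F.
Proof. intros HU HF x Hx. exists U, F. auto. Qed.

Lemma is_linear_cxy : @is_linear R_AbsRing R3_NormedModule C_R_NormedModule (fun P : R3 => (cx P, cy P)).
Proof.
  apply (is_linear_ext (U := R3_NormedModule) (V := C_R_NormedModule) (@fst (R * R) R)).
  - intros [[x y] z]. reflexivity.
  - apply (is_linear_fst (U := prod_NormedModule R_AbsRing R_NormedModule R_NormedModule) (V := R_NormedModule)).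
Qed.

Lemma class_Ck_cxy (k : nat) (U : R3 -> Prop) :
  @class_Ck R3_NormedModule C_R_NormedModule k U (fun P => (cx P, cy P)).
Proof. apply (class_Ck_linear (V := R3_NormedModule) (W := C_R_NormedModule)). apply is_linear_cxy. Qed.

Lemma class_Ck_cz (k : nat) (U : R3 -> Prop) : @class_Ck R3_NormedModule R_NormedModule k U cz.
Proof.
  apply (class_Ck_linear (V := R3_NormedModule) (W := R_NormedModule)).
  apply (is_linear_snd (U := prod_NormedModule R_AbsRing R_NormedModule R_NormedModule) (V := R_NormedModule)).
Qed.

Lemma class_Ck_R3 {V : NormedModule R_AbsRing} (k : nat) (U : V -> Prop) (X Y Z : V -> R) :
  @class_Ck V R_NormedModule k U X -> @class_Ck V R_NormedModule k U Y -> @class_Ck V R_NormedModule k U Z ->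
  @class_Ck V R3_NormedModule k U (fun x => (X x, Y x, Z x)).
Proof.
  intros HX HY HZ.
  apply (class_Ck_pair (W := prod_NormedModule R_AbsRing R_NormedModule R_NormedModule) (X := R_NormedModule)
    k U (fun x => (X x, Y x)) Z). 2: exact HZ.
  apply (class_Ck_pair (W := R_NormedModule) (X := R_NormedModule)); assumption.
Qed.

Lemma class_Ck_hemisphere {V : NormedModule R_AbsRing} (k : nat) (U : V -> Prop) (G : V -> C) :
  @class_Ck V C_R_NormedModule k U G ->
  @class_Ck V R3_NormedModule k U (fun x => hemisphere_point (G x)).
Proof.
  intros HG.
  assert (HGc := class_Ck_Cconj k U G HG).
  assert (HGG := class_Ck_Cmult k U _ _ HG HGc).
  assert (Hden := class_Ck_Cplus k U _ _ (class_Ck_Cconst k U (RtoC 1)) HGG).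
  assert (H0 : forall x, U x -> (1 + G x * Cconj (G x))%C <> RtoC 0).
  { intros x _. apply Re_pos_neq_0. destruct (G x) as [a b]; cbn. nra. }
  assert (HX := class_Ck_Re k U _ (class_Ck_Cdiv k U _ _ H0
    (class_Ck_Cscal k U Ci _ (class_Ck_Cminus k U _ _ HG HGc)) Hden)).
  assert (HY := class_Ck_Re k U _ (class_Ck_Cdiv k U _ _ H0
    (class_Ck_Cscal k U (- (1))%C _ (class_Ck_Cplus k U _ _ HG HGc)) Hden)).
  assert (HZ := class_Ck_Re k U _ (class_Ck_Cdiv k U _ _ H0
    (class_Ck_Cminus k U _ _ (class_Ck_Cconst k U (RtoC 1)) HGG) Hden)).
  refine (eq_ind _ (@class_Ck V R3_NormedModule k U) (class_Ck_R3 k U _ _ _ HX HY HZ) _ _).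
  apply functional_extensionality. intros x. rewrite hemisphere_point_coord.
  clear. destruct (G x) as [a b]. cbn.
  assert (Hd : 1 + (a * (a * 1) + b * (b * 1)) <> 0) by nra.
  f_equal; [f_equal|]; field; repeat split; nra.
Qed.

Definition hemisphere_coordinate (N : R3) : C := (- cy N / (1 + cz N), - cx N / (1 + cz N)).

(** Smoothness on the hemisphere means extension to open sets of space. This is a neighbourhood of
    the open upper hemisphere on which the stereographic coordinate is defined and still lands in
    the disk. *)
Definition hemisphere_domain (N : R3) : Prop := 0 < 1 + cz N /\ 0 < (1 + cz N) ^ 2 - cx N ^ 2 - cy N ^ 2.

Lemma class_Ck_cxcy (k : nat) (U : R3 -> Prop) :
  @class_Ck R3_NormedModule R_NormedModule k U cx /\ @class_Ck R3_NormedModule R_NormedModule k U cy.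
Proof.
  split.
  - exact (class_Ck_Re k U _ (class_Ck_cxy k U)).
  - exact (class_Ck_Im k U _ (class_Ck_cxy k U)).
Qed.

Lemma open_hemisphere_domain : @open R3_NormedModule hemisphere_domain.
Proof.
  destruct (class_Ck_cxcy 0 (fun _ => True)) as [Hx Hy]. assert (Hz := class_Ck_cz 0 (fun _ => True)).
  assert (H1 : forall N : R3_NormedModule, @continuous R3_NormedModule R_UniformSpace (fun N => 1 + cz N) N).
  { intros N. apply (continuous_plus (U := R3_NormedModule) (V := R_NormedModule)). apply continuous_const. apply Hz, I. }
  assert (Hsq : forall (u : R3 -> R) N, @continuous R3_NormedModule R_UniformSpace u N ->
    @continuous R3_NormedModule R_UniformSpace (fun N => u N ^ 2) N).
  { intros u N Hu. apply (continuous_ext (T := R3_NormedModule) (U := R_UniformSpace) (fun N => u N * u N) (fun N => u N ^ 2)).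
    intros y. match goal with |- @eq _ ?a ?b => change (@eq R a b) end. ring. apply (continuous_mult (U := R3_NormedModule) (K := R_AbsRing)); exact Hu. }
  assert (H2 : forall N : R3_NormedModule, @continuous R3_NormedModule R_UniformSpace
    (fun N => (1 + cz N) ^ 2 - cx N ^ 2 - cy N ^ 2) N).
  { intros N. repeat apply (continuous_minus (U := R3_NormedModule) (V := R_NormedModule)); apply Hsq.
    apply H1. apply Hx, I. apply Hy, I. }
  apply (open_and (T := R3_NormedModule)).
  - apply (open_comp (fun N => 1 + cz N) (fun y => 0 < y)). intros N _. apply H1. apply open_gt.
  - apply (open_comp (fun N => (1 + cz N) ^ 2 - cx N ^ 2 - cy N ^ 2) (fun y => 0 < y)). intros N _. apply H2. apply open_gt.
Qed.

Lemma class_Ck_hemisphere_coordinate (k : nat) :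
  @class_Ck R3_NormedModule C_R_NormedModule k hemisphere_domain hemisphere_coordinate.
Proof.
  destruct (class_Ck_cxcy k hemisphere_domain) as [Hx Hy]. assert (Hz := class_Ck_cz k hemisphere_domain).
  assert (Hden := class_Ck_Cplus k _ _ _ (class_Ck_Cconst k _ (RtoC 1)) (class_Ck_RtoC k _ _ Hz)).
  assert (H0 : forall N, hemisphere_domain N -> (1 + RtoC (cz N))%C <> RtoC 0).
  { intros N [HN _]. apply Re_pos_neq_0. cbn. exact HN. }
  assert (H := class_Ck_Cdiv k _ _ _ H0 (class_Ck_Cplus k _ _ _
    (class_Ck_Cscal k _ (- (1))%C _ (class_Ck_RtoC k _ _ Hy))
    (class_Ck_Cscal k _ (- Ci)%C _ (class_Ck_RtoC k _ _ Hx))) Hden).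
  refine (class_Ck_ext k _ _ _ open_hemisphere_domain _ H).
  intros N [HN _]. unfold hemisphere_coordinate. apply C_ext; cbn; field; repeat split; nra.
Qed.

Lemma hemisphere_domain_disk (N : R3) : hemisphere_domain N -> disk (hemisphere_coordinate N).
Proof.
  intros [H1 H2]. unfold disk. assert (H := Cmod2_alt (hemisphere_coordinate N)).
  assert (H0 := Cmod_ge_0 (hemisphere_coordinate N)).
  assert (Hlt : Re (hemisphere_coordinate N) ^ 2 + Im (hemisphere_coordinate N) ^ 2 < 1); [|nra].
  unfold hemisphere_coordinate; cbn [Re Im fst snd].
  replace ((- cy N / (1 + cz N)) ^ 2 + (- cx N / (1 + cz N)) ^ 2)
    with ((cx N ^ 2 + cy N ^ 2) / (1 + cz N) ^ 2) by (field; lra).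
  apply Rlt_div_l. apply Rlt_gt, pow_lt, H1. lra.
Qed.

Lemma upper_hemisphere_domain (N : R3) : upper_hemisphere N -> hemisphere_domain N.
Proof. unfold upper_hemisphere, hemisphere_domain, dot3. intros [H1 H2]. split; nra. Qed.

Lemma hemisphere_coordinate_point (q : C) : hemisphere_coordinate (hemisphere_point q) = q.
Proof.
  rewrite hemisphere_point_coord. unfold hemisphere_coordinate, cx, cy, cz; cbn [fst snd].
  assert (H1 := pow2_ge_0 (Re q)). assert (H2 := pow2_ge_0 (Im q)).
  assert (E : 1 + (1 - (Re q ^ 2 + Im q ^ 2)) / (1 + (Re q ^ 2 + Im q ^ 2)) = 2 / (1 + (Re q ^ 2 + Im q ^ 2))) by (field; lra).
  rewrite E. apply C_ext; cbn [Re Im fst snd]; unfold Re, Im in *; field; lra.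
Qed.

Lemma hemisphere_point_coordinate (N : R3) : upper_hemisphere N -> hemisphere_point (hemisphere_coordinate N) = N.
Proof.
  intros [H1 H2]. rewrite hemisphere_point_coord. destruct N as [[x y] z].
  unfold hemisphere_coordinate, dot3, cx, cy, cz in *; cbn [fst snd Re Im] in *.
  assert (E : (- y / (1 + z)) ^ 2 + (- x / (1 + z)) ^ 2 = (1 - z) / (1 + z)).
  { replace ((- y / (1 + z)) ^ 2 + (- x / (1 + z)) ^ 2) with ((x * x + y * y) / (1 + z) ^ 2) by (field; lra).
    replace (x * x + y * y) with ((1 - z) * (1 + z)) by nra. field. lra. }
  unfold Re, Im; cbn [fst snd]. rewrite E. f_equal; [f_equal|]; field; lra.
Qed.

Lemma hemisphere_point_upper (q : C) : disk q -> upper_hemisphere (hemisphere_point q).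
Proof.
  intros Hq. assert (Hlt := Cmod_sqr_lt q Hq). rewrite hemisphere_point_coord.
  assert (H1 := pow2_ge_0 (Re q)). assert (H2 := pow2_ge_0 (Im q)).
  split; unfold dot3, cx, cy, cz; cbn [fst snd].
  - field. lra.
  - apply Rdiv_lt_0_compat; lra.
Qed.

Lemma open_disk : @open C_UniformSpace disk.
Proof.
  apply (open_comp (T := C_UniformSpace) (U := R_UniformSpace) Cmod (fun y => y < 1)). 2: apply open_lt.
  intros z _. apply (filterlim_norm (V := C_NormedModule)).
Qed.

(** * The graph given by Weierstrass data over a univalent harmonic map *)

Section WeierstrassGraph.
Variables (Q : C -> Prop) (f finv H q q' qinv K : C -> C).
Hypothesis HQ : @open C_UniformSpace Q.
Hypothesis Hf : forall z, disk z -> Q (f z) /\ finv (f z) = z.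
Hypothesis Hfinv : forall w, Q w -> disk (finv w) /\ f (finv w) = w.
Hypothesis Hcont : forall w, Q w -> continuous finv w.
Hypothesis Hfw : forall z, disk z -> wirt f z (H z) (Cconj (H z * (q z * q z))).
Hypothesis HH : forall z, disk z -> H z <> RtoC 0.
Hypothesis Hq : forall z, disk z -> disk (q z) /\ qinv (q z) = z.
Hypothesis Hqinv : forall w, disk w -> disk (qinv w) /\ q (qinv w) = w.
Hypothesis HqW : forall z, disk z -> wirt q z (q' z) 0.
Hypothesis HK : forall z, disk z -> wirt K z (H z * q z) 0.
Hypothesis HCH : forall k, @class_Ck C_R_NormedModule C_R_NormedModule k disk H.
Hypothesis HCq : forall k, @class_Ck C_R_NormedModule C_R_NormedModule k disk q.
Hypothesis HCqinv : forall k, @class_Ck C_R_NormedModule C_R_NormedModule k disk qinv.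

Variable T : C -> R.
Hypothesis HT : forall z, disk z -> T z = 2 * Im (K z).
Let fd w := T (finv w).

Lemma dilatation_lt (z : C) : disk z -> Cmod (Cconj (H z * (q z * q z))) < Cmod (H z).
Proof.
  intros Hz. rewrite Cmod_conj, !Cmod_mult. assert (H0 : 0 < Cmod (H z)) by (apply Cmod_gt_0, HH, Hz).
  assert (H1 := Cmod_ge_0 (q z)). assert (H2 : Cmod (q z) < 1) by (apply Hq, Hz).
  assert (H3 : Cmod (q z) * Cmod (q z) < 1) by nra.
  apply Rlt_le_trans with (Cmod (H z) * 1); [apply Rmult_lt_compat_l; assumption | lra].
Qed.

Lemma class_Ck_dilatation (k : nat) :
  @class_Ck C_R_NormedModule C_R_NormedModule k disk (fun z => Cconj (H z * (q z * q z))).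
Proof. apply class_Ck_Cconj. repeat apply class_Ck_Cmult; auto. Qed.

Lemma class_Ck_f (k : nat) : @class_Ck C_R_NormedModule C_R_NormedModule k disk f.
Proof.
  apply class_Ck_pred. apply (class_Ck_wirt k disk f H (fun z => Cconj (H z * (q z * q z)))).
  exact Hfw. apply HCH. apply class_Ck_dilatation.
Qed.

Lemma class_Ck_finv (k : nat) : @class_Ck C_R_NormedModule C_R_NormedModule k Q finv.
Proof.
  apply (class_Ck_inverse k disk Q f finv H (fun z => Cconj (H z * (q z * q z)))); auto.
  - intros z Hz. split. apply Hfw, Hz. apply dilatation_lt, Hz.
  - apply class_Ck_dilatation.
Qed.

Lemma class_Ck_K (k : nat) : @class_Ck C_R_NormedModule C_R_NormedModule k disk K.
Proof.
  apply class_Ck_pred. apply (class_Ck_wirt k disk K (fun z => H z * q z)%C (fun _ => RtoC 0)).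
  exact HK. apply class_Ck_Cmult; auto. apply class_Ck_Cconst.
Qed.

Lemma class_Ck_T (k : nat) : @class_Ck C_R_NormedModule R_NormedModule k disk T.
Proof.
  refine (class_Ck_ext (V := C_R_NormedModule) (W := R_NormedModule) k disk _ T open_disk _
    (class_Ck_Im k disk _ (class_Ck_Cscal k disk (RtoC 2) _ (class_Ck_K k)))).
  intros z Hz. rewrite HT by exact Hz. destruct (K z). cbn. ring.
Qed.

Lemma class_Ck_fd (k : nat) : @class_Ck C_R_NormedModule R_NormedModule k Q fd.
Proof.
  apply (class_Ck_comp (V := C_R_NormedModule) (W := R_NormedModule) k Q disk finv T).
  intros w Hw. apply Hfinv, Hw. apply class_Ck_finv. apply class_Ck_T.
Qed.

Let den z := RtoC (1 - Cmod (q z) ^ 4).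

Lemma den_neq_0 (z : C) : disk z -> den z <> RtoC 0.
Proof.
  intros Hz. apply RtoC_neq. assert (H1 := Cmod_ge_0 (q z)). assert (H2 : Cmod (q z) < 1) by (apply Hq, Hz).
  assert (Cmod (q z) ^ 2 < 1) by nra. assert (0 <= Cmod (q z) ^ 2) by apply pow2_ge_0.
  replace (Cmod (q z) ^ 4) with (Cmod (q z) ^ 2 * Cmod (q z) ^ 2) by ring. nra.
Qed.

(** The Jacobian of [f] is [|H|^2 den]. Once [conj H] is cancelled, the second derivative is
    [- conj q^2] times the first, which is the relation required by [minimal_graph_equation]; a
    holomorphic function of [finv] inherits it. *)
Lemma wirt_finv (w : C) : Q w -> let z := finv w in
  wirt finv w (/ (H z * den z))%C (- (Cconj (q z) * Cconj (q z) / (H z * den z)))%C.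
Proof.
  intros Hw z. destruct (Hfinv w Hw) as [Hz Ez]. fold z in Hz.
  assert (H0 := HH z Hz). assert (Hd := den_neq_0 z Hz).
  assert (H0c : Cconj (H z) <> RtoC 0).
  { intros E. apply H0. rewrite <- (Cconj_conj (H z)), E. apply C_ext; cbn; ring. }
  assert (HD : RtoC (Cmod (H z) ^ 2 - Cmod (Cconj (H z * (q z * q z))) ^ 2) = (H z * Cconj (H z) * den z)%C).
  { unfold den. rewrite <- Cmod2_conj, <- RtoC_mult. f_equal. rewrite Cmod_conj, !Cmod_mult. ring. }
  eapply wirt_eq.
  - apply (wirt_inverse f finv w (H z) (Cconj (H z * (q z * q z)))).
    + apply Hcont, Hw.
    + apply (filter_imp Q). intros v Hv. apply Hfinv, Hv. apply HQ, Hw.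
    + apply Hfw, Hz.
    + apply dilatation_lt, Hz.
  - rewrite HD. field. repeat split; assumption.
  - rewrite HD, !Cmult_conj. field. repeat split; assumption.
Qed.

(** [H] cancels in [d (2 K) = (2 q / den) (dw - conj q^2 d conj w)]. Since
    [q conj q^2 = |q|^2 conj q], taking imaginary parts produces a factor [1 + |q|^2], which cancels
    against [den = (1 - |q|^2) (1 + |q|^2)]. *)
Lemma fd_gradient (w : C) : Q w -> let z := finv w in
  D1 fd w = 2 * Im (q z) / (1 - (Re (q z) ^ 2 + Im (q z) ^ 2)) /\
  D2 fd w = 2 * Re (q z) / (1 - (Re (q z) ^ 2 + Im (q z) ^ 2)).
Proof.
  intros Hw z. destruct (Hfinv w Hw) as [Hz Ez]. fold z in Hz.
  assert (H0 := HH z Hz). assert (Hd := den_neq_0 z Hz).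
  assert (HW := wirt_scal (RtoC 2) _ _ _ _ (wirt_comp finv K w _ _ _ _ (wirt_finv w Hw) (HK z Hz))).
  cbv zeta in HW. fold z in HW.
  destruct (D_wirt _ _ _ _ HW) as [_ [P1 [_ P2]]].
  assert (Hfd : @locally C_UniformSpace w (fun v => fd v = Im (2 * K (finv v)))).
  { apply (filter_imp Q). 2: apply HQ, Hw. intros v Hv. unfold fd. rewrite HT by apply Hfinv, Hv.
    destruct (K (finv v)). cbn. ring. }
  cbv beta in P1, P2.
  rewrite (D1_ext_loc fd (fun v => Im (2 * K (finv v))) w Hfd), (D2_ext_loc fd (fun v => Im (2 * K (finv v))) w Hfd).
  rewrite P1, P2.
  assert (Hlt : Cmod (q z) < 1) by (apply Hq, Hz). assert (Hlt' := Cmod_sqr_lt _ Hlt).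
  assert (Hm := Cmod2_alt (q z)).
  assert (Eden : den z = RtoC ((1 - (Re (q z) ^ 2 + Im (q z) ^ 2)) * (1 + (Re (q z) ^ 2 + Im (q z) ^ 2)))).
  { unfold den. f_equal. rewrite <- Hm. ring. }
  assert (S1 := pow2_ge_0 (Re (q z))). assert (S2 := pow2_ge_0 (Im (q z))).
  assert (E1 : (2 * (H z * q z * / (H z * den z) + 0 * Cconj (- (Cconj (q z) * Cconj (q z) / (H z * den z)))))%C =
    (2 * q z / den z)%C) by (field; split; assumption).
  assert (E2 : (2 * (H z * q z * - (Cconj (q z) * Cconj (q z) / (H z * den z)) + 0 * Cconj (/ (H z * den z))))%C =
    (- (2 * q z * Cconj (q z) * Cconj (q z) / den z))%C) by (field; split; assumption).
  rewrite E1, E2, Eden. clear - S1 S2 Hlt'.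
  set (D := (1 - (Re (q z) ^ 2 + Im (q z) ^ 2)) * (1 + (Re (q z) ^ 2 + Im (q z) ^ 2))).
  assert (HD : D <> 0) by (unfold D; apply Rmult_integral_contrapositive_currified; lra).
  assert (Hdiv : forall v, (v / RtoC D)%C = (RtoC (/ D) * v)%C).
  { intros v. rewrite RtoC_inv by exact HD. unfold Cdiv. ring. }
  rewrite !Hdiv. unfold D in *. clear Hdiv. destruct (q z) as [x y]. cbn in *.
  set (k := 1 - (x * (x * 1) + y * (y * 1))) in *. set (l := 1 + (x * (x * 1) + y * (y * 1))) in *.
  assert (Hk : k <> 0) by (unfold k; lra). assert (Hl : l <> 0) by (unfold l; lra).
  split; field_simplify_eq; try (split; assumption); unfold k, l; ring.
Qed.

Lemma fd_unit_normal (w : C) : Q w -> unit_normal (graph_param fd) w = hemisphere_point (q (finv w)).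
Proof.
  intros Hw. destruct (fd_gradient w Hw) as [E1 E2]. apply unit_normal_hemisphere.
  - apply Hq, Hfinv, Hw.
  - exact E1.
  - exact E2.
Qed.

Lemma fd_minimal (w : C) : Q w -> mean_curvature (graph_param fd) w = 0.
Proof.
  intros Hw. destruct (Hfinv w Hw) as [Hz Ez]. set (z := finv w) in *.
  assert (H0 := HH z Hz). assert (Hd := den_neq_0 z Hz).
  apply (minimal_graph_equation fd (fun v => q (finv v)) w (q' z * / (H z * den z))%C).
  - apply (filter_imp Q). 2: apply HQ, Hw. intros v Hv. split. apply Hq, Hfinv, Hv. apply fd_gradient, Hv.
  - eapply wirt_eq.
    + apply (wirt_comp finv q w _ _ (q' z) 0 (wirt_finv w Hw)). apply HqW, Hz.
    + cbv zeta. fold z. ring.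
    + cbv zeta. fold z. unfold Cdiv. ring.
Qed.

Definition weierstrass_surface (P : R3) : Prop := exists z, disk z /\ P = (Re (f z), Im (f z), T z).

Lemma weierstrass_surface_graph (P : R3) :
  weierstrass_surface P <-> exists w, Q w /\ P = graph_param fd w.
Proof.
  split.
  - intros [z [Hz ->]]. exists (f z). destruct (Hf z Hz) as [Hw Ez]. split. exact Hw.
    unfold graph_param, fd. rewrite Ez. reflexivity.
  - intros [w [Hw ->]]. exists (finv w). destruct (Hfinv w Hw) as [Hz Ez]. split. exact Hz.
    rewrite Ez. reflexivity.
Qed.

Lemma weierstrass_minimal_graph : minimal_graph Q fd weierstrass_surface.
Proof.
  split; [|split].
  - apply (smooth_on_open (V := C_R_NormedModule) (W := R_NormedModule)). exact HQ. apply class_Ck_fd.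
  - apply weierstrass_surface_graph.
  - apply fd_minimal.
Qed.

Lemma weierstrass_gauss_map (z : C) : disk z -> gauss_map fd (Re (f z), Im (f z), T z) = hemisphere_point (q z).
Proof.
  intros Hz. destruct (Hf z Hz) as [Hw Ez]. unfold gauss_map. cbn.
  replace (Re (f z), Im (f z)) with (f z) by (destruct (f z); reflexivity).
  rewrite fd_unit_normal by exact Hw. rewrite Ez. reflexivity.
Qed.

Lemma weierstrass_gauss_diffeomorphism : exists Ninv : R3 -> R3,
  @diffeomorphism R3_NormedModule R3_NormedModule weierstrass_surface upper_hemisphere (gauss_map fd) Ninv.
Proof.
  set (coord := fun N => qinv (hemisphere_coordinate N)).
  exists (fun N => (Re (f (coord N)), Im (f (coord N)), T (coord N))). repeat split.
  - destruct H0 as [z [Hz ->]]. rewrite weierstrass_gauss_map by exact Hz. apply hemisphere_point_upper, Hq, Hz.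
  - destruct H0 as [z [Hz ->]]. rewrite weierstrass_gauss_map by exact Hz. apply hemisphere_point_upper, Hq, Hz.
  - destruct H0 as [z [Hz ->]]. rewrite weierstrass_gauss_map by exact Hz. unfold coord.
    rewrite hemisphere_coordinate_point. rewrite (proj2 (Hq z Hz)). reflexivity.
  - exists (coord y). split. 2: reflexivity. apply Hqinv, hemisphere_domain_disk, upper_hemisphere_domain, H0.
  - assert (Hd : disk (hemisphere_coordinate y)) by (apply hemisphere_domain_disk, upper_hemisphere_domain, H0).
    rewrite weierstrass_gauss_map by (apply Hqinv, Hd). unfold coord. rewrite (proj2 (Hqinv _ Hd)).
    apply hemisphere_point_coordinate, H0.
  (* The Gauss map extends to the cylinder over [Q], independently of the height. *)
  - intros P HP. exists (fun P => Q (cx P, cy P)), (fun P => hemisphere_point (q (finv (cx P, cy P)))).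
    repeat split.
    + apply (open_comp (T := R3_NormedModule) (U := C_UniformSpace) (fun P => (cx P, cy P)) Q). 2: exact HQ.
      intros N _. exact (class_Ck_cxy 0 (fun _ => True) N I).
    + destruct HP as [z [Hz ->]]. cbn. replace (Re (f z), Im (f z)) with (f z) by (destruct (f z); reflexivity).
      apply Hf, Hz.
    + intros k. apply (class_Ck_hemisphere (V := R3_NormedModule)).
      apply (class_Ck_comp (V := R3_NormedModule) (W := C_R_NormedModule) k (fun P => Q (cx P, cy P)) disk (fun P => finv (cx P, cy P)) q).
      * intros x Hx. apply Hfinv, Hx.
      * apply (class_Ck_comp_linear (V := R3_NormedModule) (W := C_R_NormedModule) (X := C_R_NormedModule) k Q finv (fun P => (cx P, cy P))).
        apply is_linear_cxy. apply class_Ck_finv.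
      * apply HCq.
    + intros y Hy Hy'. unfold gauss_map. symmetry. apply fd_unit_normal, Hy'.
  - intros N HN. exists hemisphere_domain. eexists. split; [|split; [|split]].
    + exact open_hemisphere_domain.
    + apply upper_hemisphere_domain, HN.
    + intros k.
      assert (Hc : @class_Ck R3_NormedModule C_R_NormedModule k hemisphere_domain coord).
      { apply (class_Ck_comp (V := R3_NormedModule) (W := C_R_NormedModule) k hemisphere_domain disk hemisphere_coordinate qinv).
        apply hemisphere_domain_disk. apply class_Ck_hemisphere_coordinate. apply HCqinv. }
      assert (Hcd : forall N, hemisphere_domain N -> disk (coord N)).
      { intros N' HN'. apply Hqinv, hemisphere_domain_disk, HN'. }
      assert (Hcf := class_Ck_comp (V := R3_NormedModule) (W := C_R_NormedModule) k hemisphere_domain disk coord f Hcd Hc (class_Ck_f k)).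
      assert (HcT := class_Ck_comp (V := R3_NormedModule) (W := R_NormedModule) k hemisphere_domain disk coord T Hcd Hc (class_Ck_T k)).
      exact (class_Ck_R3 (V := R3_NormedModule) k hemisphere_domain _ _ _ (class_Ck_Re (V := R3_NormedModule) k _ _ Hcf) (class_Ck_Im (V := R3_NormedModule) k _ _ Hcf) HcT).
    + reflexivity.
Qed.

Lemma weierstrass_diffeomorphism : @diffeomorphism C_R_NormedModule C_R_NormedModule disk Q f finv.
Proof.
  repeat split.
  - apply Hf, H0.
  - apply Hf, H0.
  - apply Hfinv, H0.
  - apply Hfinv, H0.
  - apply (smooth_on_open (V := C_R_NormedModule) (W := C_R_NormedModule)). exact open_disk. apply class_Ck_f.
  - apply (smooth_on_open (V := C_R_NormedModule) (W := C_R_NormedModule)). exact HQ. apply class_Ck_finv.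
Qed.
End WeierstrassGraph.

(** * Asymptotics at the sides *)

Lemma quadrilateral_cycle (b1 b2 b3 b4 : C) : quadrilateral b1 b2 b3 b4 -> quadrilateral b2 b3 b4 b1.
Proof.
  intros [N2 [N3 [N4 [N1 [X1 [X2 HA]]]]]].
  assert (Hsym : forall a b z, closed_segment a b z -> closed_segment b a z).
  { intros a b z [t [Ht ->]]. exists (1 - t). split. lra.
    replace (1 - (1 - t)) with t by ring. ring. }
  repeat split; auto.
  - intros z [S1 S2]. apply (X1 z). auto.
  - replace (signed_area b2 b3 b4 b1) with (signed_area b1 b2 b3 b4). exact HA.
    unfold signed_area. destruct b1, b2, b3, b4; cbn; field.
Qed.

(** [orient b1 b2] vanishes on the side [b1 b2], but on [b2 b3] only at [b2] and on [b4 b1] only at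
    [b1], by non-collinearity; neither vertex lies on the open side. The opposite side is excluded
    by simplicity. *)
Lemma open_side_other_sides (b1 b2 b3 b4 z : C) : quadrilateral b1 b2 b3 b4 -> open_side b1 b2 z ->
  ~ closed_segment b2 b3 z /\ ~ closed_segment b3 b4 z /\ ~ closed_segment b4 b1 z.
Proof.
  intros [N2 [N3 [N4 [N1 [X1 [X2 HA]]]]]] [t [Ht Ez]]. unfold collinear in N2, N1.
  assert (Hlin : forall a b c d r, orient a b ((1 - r)%R * c + r * d)%C = (1 - r) * orient a b c + r * orient a b d).
  { intros a b c d r. unfold orient. destruct a, b, c, d; cbn; ring. }
  assert (Hdeg1 : forall a b, orient a b a = 0) by (intros a b; unfold orient; destruct a, b; cbn; ring).
  assert (Hdeg2 : forall a b, orient a b b = 0) by (intros a b; unfold orient; destruct a, b; cbn; ring).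
  assert (Hrot : forall a b c, orient a b c = orient b c a) by (intros a b c; unfold orient; destruct a, b, c; cbn; ring).
  change (orient b1 b2 b3 <> 0) in N2. change (orient b4 b1 b2 <> 0) in N1.
  repeat split.
  - intros [r [Hr Ez']].
    assert (E1 : orient b1 b2 z = 0) by (rewrite Ez, Hlin, Hdeg1, Hdeg2; ring).
    rewrite Ez', Hlin, Hdeg2 in E1.
    assert (Hr0 : r = 0). { destruct (Rmult_integral r (orient b1 b2 b3)) as [|E]; [lra|assumption|contradiction]. }
    assert (E2 : orient b2 b3 z = 0) by (rewrite Ez', Hlin, Hdeg1, Hdeg2; ring).
    rewrite Ez, Hlin, Hdeg1, <- Hrot in E2.
    destruct (Rmult_integral (1 - t) (orient b1 b2 b3)) as [|E]; [lra|lra|contradiction].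
  - intros H. apply (X1 z). split. exists t. split. lra. exact Ez. exact H.
  - intros [r [Hr Ez']].
    assert (E1 : orient b1 b2 z = 0) by (rewrite Ez, Hlin, Hdeg1, Hdeg2; ring).
    rewrite Ez', Hlin, Hdeg1, <- Hrot in E1.
    assert (Hr0 : 1 - r = 0). { destruct (Rmult_integral (1 - r) (orient b4 b1 b2)) as [|E]; [lra|assumption|contradiction]. }
    assert (E2 : orient b4 b1 z = 0) by (rewrite Ez', Hlin, Hdeg1, Hdeg2; ring).
    rewrite Ez, Hlin, Hdeg2 in E2.
    destruct (Rmult_integral t (orient b4 b1 b2)) as [|E]; [lra|lra|contradiction].
Qed.

(** A point of the open side has no preimage in the disk, and [cis (t + s)] is the only point of the
    circle whose cluster set can contain it. *)
Lemma step_extension_near_side (t s : R) (v1 v2 v3 v4 w0 : C) : 0 < s < PI ->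
  quadrilateral v1 v2 v3 v4 -> open_side v1 v2 w0 ->
  let f := step_extension t s v1 v2 v3 v4 in
  (forall z, Cmod z < 1 -> region v1 v2 v3 v4 (f z)) ->
  forall eps, 0 < eps -> exists d, 0 < d /\ forall z, Cmod z < 1 -> Cmod (f z - w0) < d -> Cmod (z - cis (t + s)) < eps.
Proof.
  intros Hs Hquad Hside f Hreg.
  destruct (open_side_other_sides _ _ _ _ _ Hquad Hside) as [S2 [S3 S4]].
  apply proper_inverse.
  - intros z Hz. eapply wirt_continuous. apply wirt_step_extension, Hz.
  - intros z Hz E. exfalso. destruct (Hreg z Hz) as [Hns _]. apply Hns. rewrite E. left.
    destruct Hside as [r [Hr Er]]. exists r. split. lra. exact Er.
  - intros z Hz Hne. destruct (cluster_in_other_sides t s v1 v2 v3 v4 z Hs Hz Hne) as [H|[H|H]].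
    + exists v2, v3. auto.
    + exists v3, v4. auto.
    + exists v4, v1. auto.
Qed.

Lemma Re_clog_at_limit (a M : R) : exists d, 0 < d /\
  forall z, Cmod z < 1 -> Cmod (z - cis a) < d -> Re (clog_at a z) < M.
Proof.
  exists (exp M). split. apply exp_pos. intros z Hz Hd.
  assert (Hne := disk_neq_cis z a Hz).
  assert (E : (1 - z * cis (- a))%C = (- cis (- a) * (z - cis a))%C).
  { transitivity (cis a * cis (- a) - z * cis (- a))%C. rewrite cis_opp_mult. reflexivity. ring. }
  assert (Hp : 0 < Cmod (z - cis a)).
  { apply Cmod_gt_0. intros E'. apply Hne. replace z with ((z - cis a) + cis a)%C by ring. rewrite E'. ring. }
  unfold clog_at, Clog; cbn [Re fst]. rewrite <- Cmod2_alt, E, Cmod_mult, Cmod_opp, Cmod_cis, Rmult_1_l.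
  replace (ln (Cmod (z - cis a) ^ 2) / 2) with (ln (Cmod (z - cis a))).
  - rewrite <- (ln_exp M). apply ln_increasing; assumption.
  - replace (Cmod (z - cis a) ^ 2) with (Cmod (z - cis a) * Cmod (z - cis a)) by ring.
    rewrite ln_mult by assumption. field.
Qed.

Lemma Re_clog_at_bounded (a b : R) : cis a <> cis b -> exists B d, 0 < B /\ 0 < d /\
  forall z, Cmod (z - cis a) < d -> Rabs (Re (clog_at b z)) < B.
Proof.
  intros Hne.
  assert (Hc : continuous (fun z => Re (clog_at b z)) (cis a)).
  { apply (continuous_comp (U := C_UniformSpace) (V := C_UniformSpace) (W := R_UniformSpace) (clog_at b) (@fst R R)).
    eapply wirt_continuous. apply wirt_clog_at. rewrite Cmod_cis; lra. exact Hne. apply continuous_fst. }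
  set (c := Re (clog_at b (cis a))) in *.
  destruct (proj1 (locally_Cmod _ _) (Hc (ball c (mkposreal 1 Rlt_0_1)) (locally_ball _ _))) as [d [Hd H]].
  exists (Rabs c + 1), d. assert (Hp := Rabs_pos c). split; [lra|split; [exact Hd|]].
  intros z Hz. specialize (H z Hz).
  assert (H' : Rabs (Re (clog_at b z) - c) < 1) by exact H.
  assert (Ht := Rabs_triang (Re (clog_at b z) - c) c).
  replace (Re (clog_at b z) - c + c) with (Re (clog_at b z)) in Ht by ring. lra.
Qed.

Lemma log_weights_limit (a1 a2 a3 a4 k1 k2 k3 k4 M : R) :
  cis a1 <> cis a2 -> cis a1 <> cis a3 -> cis a1 <> cis a4 -> k1 < 0 ->
  exists d, 0 < d /\ forall z, Cmod z < 1 -> Cmod (z - cis a1) < d ->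
    M < k1 * Re (clog_at a1 z) + k2 * Re (clog_at a2 z) + k3 * Re (clog_at a3 z) + k4 * Re (clog_at a4 z).
Proof.
  intros H2 H3 H4 Hk.
  destruct (Re_clog_at_bounded _ _ H2) as [B2 [d2 [HB2 [Hd2 P2]]]].
  destruct (Re_clog_at_bounded _ _ H3) as [B3 [d3 [HB3 [Hd3 P3]]]].
  destruct (Re_clog_at_bounded _ _ H4) as [B4 [d4 [HB4 [Hd4 P4]]]].
  set (B := Rabs k2 * B2 + Rabs k3 * B3 + Rabs k4 * B4).
  (* As [k1 < 0], pushing the logarithm below [(M + B) / k1] pushes its term above [M + B], while
     [B] bounds the other three terms. *)
  destruct (Re_clog_at_limit a1 ((M + B) / k1)) as [d1 [Hd1 P1]].
  exists (Rmin (Rmin d1 d2) (Rmin d3 d4)). split. repeat apply Rmin_pos; assumption.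
  intros z Hz Hd.
  assert (L1 := Rlt_le_trans _ _ _ Hd (Rmin_l _ _)). assert (L2 := Rlt_le_trans _ _ _ Hd (Rmin_r _ _)).
  assert (L11 := Rlt_le_trans _ _ _ L1 (Rmin_l _ _)). assert (L12 := Rlt_le_trans _ _ _ L1 (Rmin_r _ _)).
  assert (L21 := Rlt_le_trans _ _ _ L2 (Rmin_l _ _)). assert (L22 := Rlt_le_trans _ _ _ L2 (Rmin_r _ _)).
  specialize (P1 z Hz L11). specialize (P2 z L12). specialize (P3 z L21). specialize (P4 z L22).
  assert (Hlow : forall k x b, Rabs x < b -> - (Rabs k * b) <= k * x).
  { intros k x b Hx. assert (Hkx : Rabs (k * x) <= Rabs k * b).
    { rewrite Rabs_mult. apply Rmult_le_compat_l. apply Rabs_pos. lra. }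
    apply Rabs_le_between in Hkx. lra. }
  apply Hlow with (k := k2) in P2. apply Hlow with (k := k3) in P3. apply Hlow with (k := k4) in P4.
  assert (Hk1 : M + B < k1 * Re (clog_at a1 z)).
  { replace (M + B) with (k1 * ((M + B) / k1)) by (field; lra). nra. }
  unfold B in Hk1. lra.
Qed.

Lemma filterlim_p_infty_intro (Q : C -> Prop) (u : C -> R) (w0 : C) :
  (forall M, exists d, 0 < d /\ forall w, Q w -> Cmod (w - w0) < d -> M < u w) ->
  filterlim u (within Q (@locally C_UniformSpace w0)) (Rbar_locally p_infty).
Proof.
  intros H P [M HM]. destruct (H M) as [d [Hd H']].
  unfold filtermap, within. apply locally_Cmod. exists d. split. exact Hd.
  intros w Hw HQ. apply HM. apply H'; assumption.
Qed.

Lemma filterlim_m_infty_intro (Q : C -> Prop) (u : C -> R) (w0 : C) :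
  (forall M, exists d, 0 < d /\ forall w, Q w -> Cmod (w - w0) < d -> u w < M) ->
  filterlim u (within Q (@locally C_UniformSpace w0)) (Rbar_locally m_infty).
Proof.
  intros H P [M HM]. destruct (H M) as [d [Hd H']].
  unfold filtermap, within. apply locally_Cmod. exists d. split. exact Hd.
  intros w Hw HQ. apply HM. apply H'; assumption.
Qed.

Lemma cauchy_sum_cycle (t s : R) (j1 j2 j3 j4 z : C) :
  cauchy_sum (t + s) (PI - s) j2 j3 j4 j1 z = cauchy_sum t s j1 j2 j3 j4 z.
Proof.
  unfold cauchy_sum.
  replace (t + s + (PI - s)) with (t + PI) by ring.
  replace (t + s + PI) with (t + PI + s) by ring.
  replace (t + PI + s + (PI - s)) with (t + 2 * PI) by ring. rewrite (cis_2PI t). ring.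
Qed.

Lemma step_extension_quadrilateral (t s : R) (v1 v2 v3 v4 : C) : 0 < s < PI ->
  quadrilateral v1 v2 v3 v4 ->
  (forall z, Cmod z < 1 ->
    Cmod (cauchy_sum t s (Cconj (v1 - v4)) (Cconj (v2 - v1)) (Cconj (v3 - v2)) (Cconj (v4 - v3)) z) <
    Cmod (cauchy_sum t s (v1 - v4) (v2 - v1) (v3 - v2) (v4 - v3) z)) ->
  let f := step_extension t s v1 v2 v3 v4 in
  (forall z1 z2, Cmod z1 < 1 -> Cmod z2 < 1 -> f z1 = f z2 -> z1 = z2) /\
  (forall w, region v1 v2 v3 v4 w <-> exists z, Cmod z < 1 /\ f z = w) /\
  @open C_UniformSpace (region v1 v2 v3 v4).
Proof.
  intros Hs Hquad HJ f.
  destruct (quadrilateral_diagonal _ _ _ _ Hquad) as [[O1 O3]|[O2 O4]].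
  - apply step_extension_bijective; assumption.
  - destruct (step_extension_bijective (t + s) (PI - s) v2 v3 v4 v1) as [Hinj [Himg Hop]].
    + lra.
    + exact O2.
    + exact O4.
    + intros z Hz. rewrite !cauchy_sum_cycle. apply HJ, Hz.
    + assert (Hf : forall z, f z = step_extension (t + s) (PI - s) v2 v3 v4 v1 z) by (intros z; apply step_extension_cycle).
      split; [|split].
      * intros z1 z2 H1 H2 E. apply Hinj; trivial. rewrite <- !Hf. exact E.
      * intros w. rewrite region_cycle, Himg. split; intros [z Hz]; exists z; [rewrite Hf | rewrite <- Hf]; exact Hz.
      * apply (open_ext (T := C_UniformSpace) (region v2 v3 v4 v1)). intros w. symmetry. apply region_cycle. exact Hop.
Qed.

Lemma step_extension_inverse_continuous (t s : R) (v1 v2 v3 v4 : C) (g : C -> C) : 0 < s < PI ->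
  let f := step_extension t s v1 v2 v3 v4 in let Q := region v1 v2 v3 v4 in
  (forall z1 z2, Cmod z1 < 1 -> Cmod z2 < 1 -> f z1 = f z2 -> z1 = z2) ->
  @open C_UniformSpace Q -> (forall w, Q w -> Cmod (g w) < 1 /\ f (g w) = w) ->
  forall w, Q w -> continuous g w.
Proof.
  intros Hs f Q Hinj HQ Hg w Hw. destruct (Hg w Hw) as [Hz Ez].
  intros P HP. apply locally_Cmod in HP. destruct HP as [eps [He HP]].
  destruct (proper_inverse f (g w) w) with (eps := eps) as [d [Hd H]].
  - intros z Hz'. eapply wirt_continuous. apply wirt_step_extension, Hz'.
  - intros z Hz' E. apply Hinj; trivial. rewrite E, Ez. reflexivity.
  - intros z Hz' _. destruct (cluster_in_sides t s v1 v2 v3 v4 z Hs Hz') as [a [b [Hab Hcl]]].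
    exists a, b. split. intros Hseg. apply (proj1 Hw), Hab, Hseg. exact Hcl.
  - exact He.
  - assert (HL : @locally C_UniformSpace w (fun v => Cmod (v - w) < d)).
    { apply locally_Cmod. exists d. split. exact Hd. auto. }
    unfold filtermap. generalize (filter_and _ _ HL (HQ w Hw)). apply filter_imp.
    intros v [Hv HQv]. destruct (Hg v HQv) as [Hgv Ev]. apply HP, H. exact Hgv. rewrite Ev. exact Hv.
Qed.

(** * The height function and its logarithmic poles *)

Lemma integral_from_0_primitive (k K : C -> C) (z : C) :
  (forall w, disk w -> wirt K w (k w) 0 /\ continuous k w) -> K (RtoC 0) = RtoC 0 -> disk z ->
  integral_from_0 k z = K z.
Proof.
  intros HK HK0 Hz. unfold integral_from_0.
  assert (Hin : forall t, 0 <= t <= 1 -> disk (RtoC t * z)%C).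
  { intros t Ht. unfold disk in *. rewrite Cmod_mult, Cmod_R, Rabs_pos_eq by lra.
    assert (H := Cmod_ge_0 z). nra. }
  assert (Hline : forall t, @is_derive R_AbsRing C_R_NormedModule (fun t => RtoC t * z)%C t z).
  { intros t. apply is_derive_C. destruct z. split; cbn; auto_derive; trivial; ring. }
  apply (is_RInt_unique (V := C_R_CompleteNormedModule)).
  assert (H := is_RInt_derive (V := C_R_CompleteNormedModule) (fun t => K (RtoC t * z)%C) (fun t => (k (RtoC t * z) * z)%C) 0 1).
  rewrite Rmin_left, Rmax_right in H by lra.
  refine (eq_ind _ (fun v => @is_RInt C_R_NormedModule (fun t => (k (RtoC t * z) * z)%C) 0 1 v) (H _ _) _ _).
  - intros t Ht. assert (H1 := wirt_along K (fun t => RtoC t * z)%C t z _ _ (proj1 (HK _ (Hin t Ht))) (Hline t)).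
      replace (k (RtoC t * z) * z)%C with (k (RtoC t * z) * z + 0 * Cconj z)%C by ring. exact H1.
  - intros t Ht. apply (continuous_comp (U := R_UniformSpace) (V := C_UniformSpace) (W := C_UniformSpace)
        (fun t => k (RtoC t * z)%C) (fun v => v * z)%C).
      * apply (continuous_comp (U := R_UniformSpace) (V := C_UniformSpace) (W := C_UniformSpace) (fun t => RtoC t * z)%C k).
        apply (ex_derive_continuous (V := C_R_NormedModule)). eexists. apply Hline. apply HK, Hin, Ht.
      * eapply wirt_continuous. apply wirt_mult. apply wirt_id. apply wirt_const.
  - change (K (RtoC 1 * z) - K (RtoC 0 * z) = K z)%C.
    replace (RtoC 1 * z)%C with z by ring. replace (RtoC 0 * z)%C with (RtoC 0) by ring. rewrite HK0. ring.
Qed.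

Lemma class_Ck_cauchy_sum (t s : R) (j1 j2 j3 j4 : C) (k : nat) :
  @class_Ck C_R_NormedModule C_R_NormedModule k disk (cauchy_sum t s j1 j2 j3 j4).
Proof.
  assert (H : forall u j, @class_Ck C_R_NormedModule C_R_NormedModule k disk (fun z => j / (cis u - z))%C).
  { intros u j. apply class_Ck_Cdiv.
    - intros z Hz E. apply (disk_neq_cis z u Hz). replace z with (cis u - (cis u - z))%C by ring. rewrite E. ring.
    - apply class_Ck_Cconst.
    - apply class_Ck_Cminus. apply class_Ck_Cconst. apply class_Ck_Cid. }
  unfold cauchy_sum. apply class_Ck_Cscal. apply class_Ck_Cplus; [apply class_Ck_Cplus; [apply class_Ck_Cplus|]|]; apply H.
Qed.

Lemma wirt_cauchy_sum (t s : R) (j1 j2 j3 j4 z : C) : disk z ->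
  exists l, wirt (cauchy_sum t s j1 j2 j3 j4) z l 0.
Proof.
  intros Hz.
  assert (H : forall u j, exists l, wirt (fun z => j / (cis u - z))%C z l 0).
  { intros u j. eexists. eapply wirt_eq.
    - apply wirt_div. apply wirt_const. apply wirt_minus. apply wirt_const. apply wirt_id.
      intros E. apply (disk_neq_cis z u Hz). replace z with (cis u - (cis u - z))%C by ring. rewrite E. ring.
    - reflexivity.
    - unfold Cdiv. ring. }
  destruct (H t j1) as [l1 H1]. destruct (H (t + s) j2) as [l2 H2].
  destruct (H (t + PI) j3) as [l3 H3]. destruct (H (t + PI + s) j4) as [l4 H4].
  eexists. eapply wirt_eq.
  - unfold cauchy_sum. apply wirt_scal. apply wirt_plus; [apply wirt_plus; [apply wirt_plus|]|]; eassumption.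
  - reflexivity.
  - ring.
Qed.

Lemma class_Ck_mobius (a b c d : C) (k : nat) : (forall z, disk z -> (c * z + d)%C <> RtoC 0) ->
  @class_Ck C_R_NormedModule C_R_NormedModule k disk (fun z => (a * z + b) / (c * z + d))%C.
Proof.
  intros H. assert (Hl : forall u v, @class_Ck C_R_NormedModule C_R_NormedModule k disk (fun z => u * z + v)%C).
  { intros u v. apply class_Ck_Cplus. apply class_Ck_Cscal, class_Ck_Cid. apply class_Ck_Cconst. }
  apply class_Ck_Cdiv; auto.
Qed.

Lemma wirt_mobius (a b c d z : C) : (c * z + d)%C <> RtoC 0 ->
  wirt (fun z => (a * z + b) / (c * z + d))%C z ((a * d - b * c) / ((c * z + d) * (c * z + d)))%C 0.
Proof.
  intros H. assert (Hl : forall u v, wirt (fun z => u * z + v)%C z u 0).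
  { intros u v. eapply wirt_eq. apply wirt_plus. apply wirt_scal, wirt_id. apply wirt_const. ring. ring. }
  eapply wirt_eq. apply (wirt_div _ _ _ _ _ _ _ (Hl a b) (Hl c d) H).
  - field. exact H.
  - field. exact H.
Qed.

Lemma clog_at_0 (t : R) : clog_at t (RtoC 0) = RtoC 0.
Proof.
  unfold clog_at. replace (1 - 0 * cis (- t))%C with (RtoC 1) by ring. unfold Clog; cbn.
  replace (1 * (1 * 1) + 0 * (0 * 1)) with 1 by ring. rewrite ln_1.
  replace (0 / 1) with 0 by field. rewrite atan_0. apply C_ext; cbn; field.
Qed.

Lemma log_sum_at_0 (t s : R) (c j1 j2 j3 j4 : C) : log_sum t s c j1 j2 j3 j4 (RtoC 0) = c.
Proof. unfold log_sum. rewrite !clog_at_0. ring. Qed.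

Lemma Im_log_sum (t s k1 k2 k3 k4 : R) (z : C) :
  2 * Im (log_sum t s 0 (RtoC k1) (RtoC k2) (RtoC k3) (RtoC k4) z) =
  k1 / PI * Re (clog_at t z) + k2 / PI * Re (clog_at (t + s) z) +
  k3 / PI * Re (clog_at (t + PI) z) + k4 / PI * Re (clog_at (t + PI + s) z).
Proof.
  unfold log_sum. generalize (clog_at t z), (clog_at (t + s) z), (clog_at (t + PI) z), (clog_at (t + PI + s) z).
  intros l1 l2 l3 l4. assert (Hpi := PI_RGT_0).
  assert (E : (Ci / RtoC (2 * PI))%C = (RtoC (/ (2 * PI)) * Ci)%C).
  { rewrite RtoC_inv by lra. unfold Cdiv. ring. }
  rewrite E. replace (/ (2 * PI)) with (/ PI / 2) by (field; lra). unfold Rdiv. generalize (/ PI). intros k.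
  destruct l1, l2, l3, l4. cbn. field.
Qed.

Lemma blow_up_at_side (f g : C -> C) (Q : C -> Prop) (T : C -> R) (w0 zeta : C) (S : R -> Prop) :
  (forall w, Q w -> Cmod (g w) < 1 /\ f (g w) = w) ->
  (forall eps, 0 < eps -> exists d, 0 < d /\ forall z, Cmod z < 1 -> Cmod (f z - w0) < d -> Cmod (z - zeta) < eps) ->
  (exists d, 0 < d /\ forall z, Cmod z < 1 -> Cmod (z - zeta) < d -> S (T z)) ->
  exists d, 0 < d /\ forall w, Q w -> Cmod (w - w0) < d -> S (T (g w)).
Proof.
  intros Hg Hnear [e [He HT]]. destruct (Hnear e He) as [d [Hd H]]. exists d. split. exact Hd.
  intros w Hw Hww. destruct (Hg w Hw) as [H1 H2]. apply HT. exact H1. apply H. exact H1. rewrite H2. exact Hww.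
Qed.

(** The four differences are the jumps of the boundary function at the angles [0], [p], [PI],
    [PI + p], each a side of [Q]. Their combinations in the last clause are twice the bimedians, and
    bimedians span a parallelogram of the same area as [Q], hence a factor [4]. *)
Lemma pitot_jumps (b1 b2 b3 b4 : C) : pitot_quadrilateral b1 b2 b3 b4 ->
  ((b4 - b3) + (b1 - b4) + (b2 - b1) + (b3 - b2))%C = RtoC 0 /\
  Cmod (b4 - b3) + Cmod (b2 - b1) = Cmod (b1 - b4) + Cmod (b3 - b2) /\
  (b4 - b3)%C <> RtoC 0 /\ (b1 - b4)%C <> RtoC 0 /\
  0 < Im (Cconj ((b4 - b3) - (b2 - b1)) * ((b1 - b4) - (b3 - b2))).
Proof.
  intros [[N2 [N3 [N4 [N1 [_ [_ HA]]]]]] Hp].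
  assert (Hsym : forall x y, Cmod (x - y) = Cmod (y - x)).
  { intros x y. rewrite <- Cmod_opp. f_equal. ring. }
  repeat split.
  - ring.
  - rewrite (Hsym b4 b3), (Hsym b2 b1), (Hsym b1 b4), (Hsym b3 b2). lra.
  - intros E. apply N4. unfold collinear. rewrite E. cbn. ring.
  - intros E. apply N1. unfold collinear. rewrite E. cbn. ring.
  - replace (Im _) with (4 * signed_area b1 b2 b3 b4). lra.
    unfold signed_area. destruct b1, b2, b3, b4; cbn; field.
Qed.

Theorem theorem1p2 (b1 b2 b3 b4 : C) (hQ : pitot_quadrilateral b1 b2 b3 b4) :
  let Q := region b1 b2 b3 b4 in
  exists p : R, 0 < p < PI /\
  let f := poisson_extension (boundary_step b1 b2 b3 b4 p) in
  exists finv h g bp bq : C -> C,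
    @diffeomorphism C_R_NormedModule C_R_NormedModule disk Q f finv /\
    harmonic_on disk f /\
    sense_preserving_on disk f /\
    analytic_on disk h /\ analytic_on disk g /\ g (RtoC 0) = RtoC 0 /\
    (forall z, disk z -> f z = (h z + Cconj (g z))%C) /\
    mobius_disk_automorphism bq /\
    (forall z, disk z -> C_derive h z <> RtoC 0 /\
                         (bq z ^ 2)%C = (C_derive g z / C_derive h z)%C) /\
    (forall z, disk z -> bp z = C_derive h z) /\
    let T := fun z : C =>
      2 * Im (integral_from_0 (fun s => (bp s * bq s)%C) z) in
    let Sigma := fun P : R3 =>
      exists z, disk z /\ P = (Re (f z), Im (f z), T z) in
    let fd := fun w : C => T (finv w) in
    minimal_graph Q fd Sigma /\
    (forall z, disk z ->
       gauss_map fd (Re (f z), Im (f z), T z) = hemisphere_point (bq z)) /\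
    (exists Ninv : R3 -> R3,
       @diffeomorphism R3_NormedModule R3_NormedModule
         Sigma upper_hemisphere (gauss_map fd) Ninv) /\
    (forall zeta, open_side b1 b2 zeta \/ open_side b3 b4 zeta ->
       filterlim fd (within Q (locally zeta)) (Rbar_locally p_infty)) /\
    (forall zeta, open_side b4 b1 zeta \/ open_side b2 b3 zeta ->
       filterlim fd (within Q (locally zeta)) (Rbar_locally m_infty)).
Proof.
  intros Q.
  destruct (pitot_jumps _ _ _ _ hQ) as [Hsum [Hpitot [Ha0 [Hb0 Harea]]]].
  destruct hQ as [Hquad _].
  destruct (pitot_angle _ _ _ _ Hsum Hpitot Ha0 Hb0 Harea) as [p [Hp Hdisc]].
  destruct (weierstrass_square_root _ _ _ _ p Hsum Hp Harea Hdisc) as [mu [nu [Hlt [Ea [Ec [Eb Ed]]]]]].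
  clear Hsum Hpitot Hb0 Harea Hdisc Ha0.
  exists p. split. exact Hp. intros f.
  assert (Hpi := PI_RGT_0).
  set (F := step_extension 0 p b4 b1 b2 b3).
  set (H := cauchy_sum 0 p (b4 - b3) (b1 - b4) (b2 - b1) (b3 - b2)).
  set (G := cauchy_sum 0 p (Cconj (b4 - b3)) (Cconj (b1 - b4)) (Cconj (b2 - b1)) (Cconj (b3 - b2))).
  set (bq := gauss_coordinate mu nu p).
  assert (Hf : forall z, disk z -> f z = F z) by (intros z Hz; apply poisson_extension_step; assumption).
  assert (HG : forall z, disk z -> (H z * (bq z * bq z))%C = G z)
    by (intros z Hz; apply (gauss_coordinate_sqr _ _ _ _ _ _ _ Hp Hlt Ea Ec Eb Ed z Hz)).
  assert (HH : forall z, disk z -> H z <> RtoC 0)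
    by (intros z Hz; apply (cauchy_sum_h_neq_0 _ _ _ _ _ _ _ Hp Hlt Ea Ec Eb Ed z Hz)).
  assert (Hbq : forall z, disk z -> Cmod (bq z) < 1) by (intros z Hz; apply gauss_coordinate_disk; assumption).
  assert (HJ : forall z, Cmod z < 1 -> Cmod (G z) < Cmod (H z)).
  { intros z Hz. rewrite <- HG by exact Hz. rewrite !Cmod_mult.
    assert (P1 : 0 < Cmod (H z)) by (apply Cmod_gt_0, HH, Hz).
    assert (P2 := Hbq z Hz). assert (P3 := Cmod_ge_0 (bq z)).
    assert (P4 : Cmod (bq z) * Cmod (bq z) < 1) by nra.
    apply Rlt_le_trans with (Cmod (H z) * 1); [apply Rmult_lt_compat_l; assumption | lra]. }
  (* The first arc carries [b4], so the step extension sees the vertices in the order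
     [b4, b1, b2, b3]. *)
  assert (Hq4 : quadrilateral b4 b1 b2 b3) by (do 3 apply quadrilateral_cycle in Hquad; exact Hquad).
  assert (HQ4 : forall w, Q w <-> region b4 b1 b2 b3 w) by (intros w; symmetry; apply region_cycle).
  destruct (step_extension_quadrilateral 0 p b4 b1 b2 b3 Hp Hq4 HJ) as [Hinj [Himg HQopen]]. fold F in Hinj, Himg.
  assert (HQo : @open C_UniformSpace Q).
  { apply (open_ext (T := C_UniformSpace) (region b4 b1 b2 b3)). intros w. symmetry. apply HQ4. exact HQopen. }
  set (finv := fun w => epsilon (inhabits (RtoC 0)) (fun z => disk z /\ f z = w)).
  assert (Hfinv : forall w, Q w -> disk (finv w) /\ f (finv w) = w).
  { intros w Hw. unfold finv. apply epsilon_spec. apply HQ4, Himg in Hw. destruct Hw as [z [Hz E]].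
    exists z. split. exact Hz. rewrite Hf by exact Hz. exact E. }
  assert (HfinvF : forall w, Q w -> Cmod (finv w) < 1 /\ F (finv w) = w).
  { intros w Hw. destruct (Hfinv w Hw) as [Hz E]. split. exact Hz. rewrite <- Hf by exact Hz. exact E. }
  assert (HFQ : forall z, disk z -> Q (F z)) by (intros z Hz; apply HQ4, Himg; exists z; auto).
  assert (HfQ : forall z, disk z -> Q (f z) /\ finv (f z) = z).
  { intros z Hz. assert (Hw := HFQ z Hz). rewrite <- Hf in Hw by exact Hz. split. exact Hw.
    destruct (HfinvF _ Hw) as [Hz' E]. apply Hinj; trivial. rewrite E. apply Hf, Hz. }
  assert (Hcont : forall w, Q w -> continuous finv w).
  { intros w Hw. apply (step_extension_inverse_continuous 0 p b4 b1 b2 b3 finv Hp Hinj HQopen).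
    intros v Hv. apply HfinvF, HQ4, Hv. apply HQ4, Hw. }
  assert (HfwF : forall z, disk z -> wirt F z (H z) (Cconj (G z))) by (intros z Hz; apply wirt_step_extension, Hz).
  assert (Hlocdisk : forall z, disk z -> @locally C_UniformSpace z disk) by (intros z Hz; apply open_disk, Hz).
  assert (HfwG : forall z, disk z -> wirt f z (H z) (Cconj (G z))).
  { intros z Hz. apply (wirt_ext_loc F). 2: apply HfwF, Hz.
    apply (filter_imp disk). intros w Hw. symmetry. apply Hf, Hw. apply Hlocdisk, Hz. }
  assert (Hfw : forall z, disk z -> wirt f z (H z) (Cconj (H z * (bq z * bq z)))).
  { intros z Hz. rewrite HG by exact Hz. apply HfwG, Hz. }
  set (c0 := ((RtoC p * b4 + RtoC (PI - p) * b1 + RtoC p * b2 + RtoC (PI - p) * b3) / RtoC (2 * PI))%C).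
  set (h := log_sum 0 p c0 (b4 - b3) (b1 - b4) (b2 - b1) (b3 - b2)).
  set (g := log_sum 0 p 0 (Cconj (b4 - b3)) (Cconj (b1 - b4)) (Cconj (b2 - b1)) (Cconj (b3 - b2))).
  assert (Hh : forall z, disk z -> @is_derive C_AbsRing C_NormedModule h z (H z))
    by (intros z Hz; apply wirt_holo, wirt_log_sum, Hz).
  assert (Hg : forall z, disk z -> @is_derive C_AbsRing C_NormedModule g z (G z))
    by (intros z Hz; apply wirt_holo, wirt_log_sum, Hz).
  assert (Hh' : forall z, disk z -> C_derive h z = H z) by (intros z Hz; apply is_C_derive_unique, Hh, Hz).
  assert (Hg' : forall z, disk z -> C_derive g z = G z) by (intros z Hz; apply is_C_derive_unique, Hg, Hz).
  set (e := cis p).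
  set (k1 := - height_weight p (mu + nu)). set (k2 := height_weight p (mu + nu * e)).
  set (k3 := - height_weight p (mu - nu)). set (k4 := height_weight p (mu - nu * e)).
  (* The primitive of [h' q] that vanishes at [0], so that it equals the integral in the definition
     of the height. *)
  set (K := log_sum 0 p 0 (RtoC k1) (RtoC k2) (RtoC k3) (RtoC k4)).
  assert (HK : forall z, disk z -> wirt K z (H z * bq z)%C 0).
  { intros z Hz. unfold H, bq. rewrite (cauchy_sum_height _ _ _ _ _ _ _ Hp Hlt Ea Ec Eb Ed z Hz).
    apply wirt_log_sum, Hz. }
  assert (HCH : forall k, @class_Ck C_R_NormedModule C_R_NormedModule k disk H) by (intros k; apply class_Ck_cauchy_sum).
  assert (Haff : forall z, disk z -> (nu * z + mu)%C <> RtoC 0).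
  { intros z Hz. rewrite Cplus_comm. apply affine_neq_0. exact Hlt. apply Rlt_le, Hz. }
  assert (Hbqm : forall z, bq z = ((- Ci * e * Cconj mu * z + - Ci * e * Cconj nu) / (nu * z + mu))%C).
  { intros z. unfold bq, gauss_coordinate. fold e. f_equal; ring. }
  assert (HCq : forall k, @class_Ck C_R_NormedModule C_R_NormedModule k disk bq).
  { intros k. apply (class_Ck_ext (V := C_R_NormedModule) (W := C_R_NormedModule) k disk
      (fun z => (- Ci * e * Cconj mu * z + - Ci * e * Cconj nu) / (nu * z + mu))%C bq open_disk).
    intros z _. symmetry. apply Hbqm. apply class_Ck_mobius, Haff. }
  set (qinv := gauss_coordinate_inv mu nu p).
  assert (Haff' : forall w, disk w -> (- nu * w + - Ci * e * Cconj mu)%C <> RtoC 0).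
  { intros w Hw. replace (- nu * w + - Ci * e * Cconj mu)%C with (- Ci * e * Cconj mu - nu * w)%C by ring.
    apply gauss_inv_denominator; assumption. }
  assert (HCqinv : forall k, @class_Ck C_R_NormedModule C_R_NormedModule k disk qinv).
  { intros k. apply (class_Ck_ext (V := C_R_NormedModule) (W := C_R_NormedModule) k disk
      (fun z => (mu * z + Ci * e * Cconj nu) / (- nu * z + - Ci * e * Cconj mu))%C qinv open_disk).
    intros z _. unfold qinv, gauss_coordinate_inv. fold e. f_equal; ring. apply class_Ck_mobius, Haff'. }
  assert (HqW : forall z, disk z -> wirt bq z
    ((- Ci * e * Cconj mu * mu - - Ci * e * Cconj nu * nu) / ((nu * z + mu) * (nu * z + mu)))%C 0).
  { intros z Hz. apply (wirt_ext_loc (fun z => (- Ci * e * Cconj mu * z + - Ci * e * Cconj nu) / (nu * z + mu))%C).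
    apply filter_forall. intros w. symmetry. apply Hbqm. apply wirt_mobius, Haff, Hz. }
  assert (Hq1 : forall z, disk z -> disk (bq z) /\ qinv (bq z) = z).
  { intros z Hz. split. apply Hbq, Hz. apply gauss_coordinate_K; assumption. }
  assert (Hq2 : forall w, disk w -> disk (qinv w) /\ bq (qinv w) = w).
  { intros w Hw. split. apply gauss_coordinate_inv_disk; assumption. apply gauss_coordinate_inv_K; assumption. }
  exists finv, h, g, H, bq.
  set (T := fun z => 2 * Im (integral_from_0 (fun s => (H s * bq s)%C) z)).
  assert (HT : forall z, disk z -> T z = 2 * Im (K z)).
  { intros z Hz. unfold T. rewrite (integral_from_0_primitive _ K); trivial.
    - intros w Hw. split. apply HK, Hw. apply (class_Ck_Cmult 0 disk H bq (HCH 0%nat) (HCq 0%nat) w Hw).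
    - apply log_sum_at_0. }
  assert (Hcf := class_Ck_f f H bq Hfw HCH HCq).
  split; [|split; [|split; [|split; [|split; [|split; [|split; [|split; [|split; [|split]]]]]]]]].
  - exact (weierstrass_diffeomorphism Q f finv H bq qinv HQo HfQ Hfinv Hcont Hfw HH Hq1 HCH HCq).
  - split.
    + apply (smooth_on_open (V := C_R_NormedModule) (W := C_R_NormedModule)). exact open_disk. exact Hcf.
    + intros z Hz. destruct (wirt_cauchy_sum 0 p (b4 - b3) (b1 - b4) (b2 - b1) (b3 - b2) z Hz) as [l1 W1].
      destruct (wirt_cauchy_sum 0 p (Cconj (b4 - b3)) (Cconj (b1 - b4)) (Cconj (b2 - b1)) (Cconj (b3 - b2)) z Hz) as [l2 W2].
      apply (laplacian_wirt f H (fun w => Cconj (G w)) z l1 (Cconj l2)).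
      * apply (filter_imp disk). exact HfwG. apply Hlocdisk, Hz.
      * exact W1.
      * eapply wirt_eq. apply wirt_conj, W2. apply C_ext; cbn; ring. reflexivity.
  - intros z Hz. rewrite (jacobian_wirt f z _ _ (HfwG z Hz)), Cmod_conj.
    assert (P1 := HJ z Hz). assert (P2 := Cmod_ge_0 (G z)). nra.
  - intros z Hz. exists (H z). apply Hh, Hz.
  - intros z Hz. exists (G z). apply Hg, Hz.
  - apply log_sum_at_0.
  - intros z Hz. rewrite Hf by exact Hz. apply step_extension_decomp.
  - apply gauss_coordinate_mobius; assumption.
  - intros z Hz. rewrite Hh', Hg' by exact Hz. split. apply HH, Hz. rewrite <- HG by exact Hz.
    change (bq z ^ 2)%C with (bq z * (bq z * 1))%C. field. apply HH, Hz.
  - intros z Hz. symmetry. apply Hh', Hz.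
  - cbv zeta. fold T.
    assert (Hnz : forall x y, 0 < x - y < 2 * PI -> cis x <> cis y) by (intros; apply cis_neq; assumption).
    assert (Hsides : forall t s v1 v2 v3 v4 w0, 0 < s < PI -> quadrilateral v1 v2 v3 v4 -> open_side v1 v2 w0 ->
      (forall z, F z = step_extension t s v1 v2 v3 v4 z) -> (forall w, Q w <-> region v1 v2 v3 v4 w) ->
      forall eps, 0 < eps -> exists d, 0 < d /\ forall z, Cmod z < 1 -> Cmod (F z - w0) < d -> Cmod (z - cis (t + s)) < eps).
    { intros t s v1 v2 v3 v4 w0 Hs Hquad' Hw0 HF HQ' eps He.
      destruct (step_extension_near_side t s v1 v2 v3 v4 w0 Hs Hquad' Hw0) with (eps := eps) as [d [Hd Hnear]].
      - intros z Hz. rewrite <- HF. apply HQ', HFQ, Hz.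
      - exact He.
      - exists d. split. exact Hd. intros z Hz. rewrite HF. apply Hnear, Hz. }
    (* Each side in turn is brought into first position, where [step_extension_near_side] places its
       jump at [t + s]: [p] for [b4 b1], [PI] for [b1 b2], [PI + p] for [b2 b3], a full turn for
       [b3 b4]. *)
    assert (HF1 : forall z, F z = step_extension p (PI - p) b1 b2 b3 b4 z).
    { intros z. unfold F. rewrite step_extension_cycle, Rplus_0_l. reflexivity. }
    assert (HF2 : forall z, F z = step_extension PI p b2 b3 b4 b1 z).
    { intros z. rewrite HF1, step_extension_cycle. f_equal; ring. }
    assert (HF3 : forall z, F z = step_extension (PI + p) (PI - p) b3 b4 b1 b2 z).
    { intros z. rewrite HF2, step_extension_cycle. f_equal; ring. }
    assert (HTlog : forall z, disk z -> T z = k1 / PI * Re (clog_at 0 z) + k2 / PI * Re (clog_at p z) +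
      k3 / PI * Re (clog_at PI z) + k4 / PI * Re (clog_at (PI + p) z)).
    { intros z Hz. rewrite HT by exact Hz. unfold K. rewrite Im_log_sum, !Rplus_0_l. reflexivity. }
    assert (Hweight : forall x, Cmod x <= 1 -> 0 < height_weight p (mu + nu * x) / PI).
    { intros x Hx. apply Rdiv_lt_0_compat. apply height_weight_pos; assumption. lra. }
    assert (Hk1 : k1 / PI < 0).
    { assert (Hw := Hweight 1 ltac:(rewrite Cmod_1; lra)). replace (mu + nu * 1)%C with (mu + nu)%C in Hw by ring.
      unfold k1. unfold Rdiv in *. lra. }
    assert (Hk3 : k3 / PI < 0).
    { assert (Hw := Hweight (- (1))%C ltac:(rewrite Cmod_opp, Cmod_1; lra)).
      replace (mu + nu * - (1))%C with (mu - nu)%C in Hw by ring. unfold k3. unfold Rdiv in *. lra. }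
    assert (Hk2 : - (k2 / PI) < 0).
    { assert (Hw := Hweight e ltac:(unfold e; rewrite Cmod_cis; lra)). unfold k2. lra. }
    assert (Hk4 : - (k4 / PI) < 0).
    { assert (Hw := Hweight (- e)%C ltac:(unfold e; rewrite Cmod_opp, Cmod_cis; lra)).
      replace (mu + nu * - e)%C with (mu - nu * e)%C in Hw by ring. unfold k4. lra. }
    assert (N01 : cis p <> cis 0) by (apply Hnz; lra).
    assert (N02 : cis PI <> cis 0) by (apply Hnz; lra).
    assert (N03 : cis (PI + p) <> cis 0) by (apply Hnz; lra).
    assert (N12 : cis PI <> cis p) by (apply Hnz; lra).
    assert (N13 : cis (PI + p) <> cis p) by (apply Hnz; lra).
    assert (N23 : cis (PI + p) <> cis PI) by (apply Hnz; lra).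
    split; [|split; [|split; [|split]]].
    + exact (weierstrass_minimal_graph Q f finv H bq _ qinv K HQo HfQ Hfinv Hcont Hfw HH Hq1 HqW HK HCH HCq T HT).
    + exact (weierstrass_gauss_map Q f finv H bq qinv K HQo HfQ Hfinv Hcont Hfw HH Hq1 HK T HT).
    + exact (weierstrass_gauss_diffeomorphism Q f finv H bq qinv K HQo HfQ Hfinv Hcont Hfw HH Hq1 Hq2 HK HCH HCq HCqinv T HT).
    + intros zeta Hz. apply filterlim_p_infty_intro. intros M.
      destruct Hz as [Hz|Hz].
      * apply (blow_up_at_side F finv Q T zeta (cis PI) (fun y => M < y) HfinvF).
        -- assert (Hn := Hsides p (PI - p) b1 b2 b3 b4 zeta ltac:(lra) Hquad Hz HF1 ltac:(intros w; reflexivity)).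
           replace (p + (PI - p)) with PI in Hn by ring. exact Hn.
        (* The pole lying over the side is listed first; its weight has the sign that decides the
           limit. *)
        -- destruct (log_weights_limit PI 0 p (PI + p) (k3 / PI) (k1 / PI) (k2 / PI) (k4 / PI) M) as [d [Hd Hl]]; auto.
           exists d. split. exact Hd. intros z Hz1 Hz2. specialize (Hl z Hz1 Hz2). rewrite HTlog by exact Hz1. lra.
      * apply (blow_up_at_side F finv Q T zeta (cis 0) (fun y => M < y) HfinvF).
        -- assert (Hn := Hsides (PI + p) (PI - p) b3 b4 b1 b2 zeta ltac:(lra)
             ltac:(do 2 apply quadrilateral_cycle in Hquad; exact Hquad) Hz HF3
             ltac:(intros w; unfold Q; rewrite region_cycle; apply region_cycle)).
           replace (PI + p + (PI - p)) with (0 + 2 * PI) in Hn by ring. rewrite cis_2PI in Hn. exact Hn.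
        -- destruct (log_weights_limit 0 PI p (PI + p) (k1 / PI) (k3 / PI) (k2 / PI) (k4 / PI) M) as [d [Hd Hl]]; auto.
           exists d. split. exact Hd. intros z Hz1 Hz2. specialize (Hl z Hz1 Hz2). rewrite HTlog by exact Hz1. lra.
    + intros zeta Hz. apply filterlim_m_infty_intro. intros M.
      destruct Hz as [Hz|Hz].
      * apply (blow_up_at_side F finv Q T zeta (cis p) (fun y => y < M) HfinvF).
        -- assert (Hn := Hsides 0 p b4 b1 b2 b3 zeta Hp Hq4 Hz ltac:(intros z; reflexivity) HQ4).
           rewrite Rplus_0_l in Hn. exact Hn.
        (* Here the dominant weight is positive; negating all weights and the bound reduces the
           limit to the previous case. *)
        -- destruct (log_weights_limit p 0 PI (PI + p) (- (k2 / PI)) (- (k1 / PI)) (- (k3 / PI)) (- (k4 / PI)) (- M)) as [d [Hd Hl]]; auto.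
           exists d. split. exact Hd. intros z Hz1 Hz2. specialize (Hl z Hz1 Hz2). rewrite HTlog by exact Hz1. lra.
      * apply (blow_up_at_side F finv Q T zeta (cis (PI + p)) (fun y => y < M) HfinvF).
        -- exact (Hsides PI p b2 b3 b4 b1 zeta Hp (quadrilateral_cycle _ _ _ _ Hquad) Hz HF2 (fun w => region_cycle b1 b2 b3 b4 w)).
        -- destruct (log_weights_limit (PI + p) 0 p PI (- (k4 / PI)) (- (k1 / PI)) (- (k2 / PI)) (- (k3 / PI)) (- M)) as [d [Hd Hl]]; auto.
           exists d. split. exact Hd. intros z Hz1 Hz2. specialize (Hl z Hz1 Hz2). rewrite HTlog by exact Hz1. lra.
Qed.
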